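(* There exist a (large enough) absolute constant $C>0$ and absolute constants $K,c_0,c_1>0$ such that the following holds for all integers $1\le d\le n$, all $\delta\in(0,1/2)$ and all $\theta\in\mathbf{R}^d$ with $\|\theta\|^2\le 1$. Let $M$ be the greatest integer with $2^Md\le n$, let $g_i=2^i d$ for $i=0,1,\dots,M$. Define $$\tilde{m}= \min\Big\{m\in \{0,1,\ldots,M\}:\; L^2(\tilde{\theta}(g_j),\tilde{\theta}(g_{j-1}))\leq 4 C^2 \Big(\frac{\sqrt{d g_j}}{n}\wedge\frac{d g_j}{n^2\|\tilde\theta(g_j) \|^2 }\Big)\ \text{for all } m+1\le j\le M\Big\},\qquad \tilde\ell=2^{\tilde m}d,$$ and then $$\tilde{m}_2= \min\Big\{m\in \{0,1,\ldots,M\}:\; L^2(\tilde{\theta}(g_j),\tilde{\theta}(g_{j-1}))\leq 4 C^2 \Big(\frac{\sqrt{d g_j}}{n}\wedge\frac{d g_j}{n^2\|\tilde\theta(\tilde\ell) \|^2 }\Big)\ \text{for all } m+1\le j\le M\Big\},\qquad \tilde\ell_2=2^{\tilde m_2}d.$$ Let also $$\ell^{**}=d\vee\left\lceil n\delta\vee\frac{\delta^{2/3}n^{4/3}\|\theta\|^{4/3}}{d^{1/3}}\vee n \|\theta\|^2 \right\rceil\wedge n .$$ Then, with probability at least $1-c_1\log(en/d)\,e^{-c_0 d}$, the estimator $\tilde\theta(\tilde\ell_2)$ satisfies $$ L^2(\tilde{\theta}(\tilde{\ell}_2),\theta) \le K\left[\left(\sqrt{\frac{\delta d }{n}} + \frac{d}{n}\right)\wedge\left(\frac{\ell^{**}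 d}{n^2\|\theta\|^2} + \frac{d}{n}\right)\right]. $$ In particular, globally, $L^2(\tilde{\theta}(\tilde{\ell}_2),\theta) \le K\left(\sqrt{\frac{\delta d}{n}} + \frac{d}{n}\right)$ with probability at least $1-c_1\log(en/d)\,e^{-c_0 d}$.
   Context: Model. For $i=1,\dots,n$ one observes $Y_i=\eta_i\theta+\xi_i\in\mathbf{R}^d$, where $\theta\in\mathbf{R}^d$ is unknown, $\eta_1$ is a Rademacher variable, $(\eta_i)$ is a homogeneous Markov chain on $\{-1,1\}$ with $\eta_{i+1}=\eta_i$ with probability $1-\delta$ and $\eta_{i+1}=-\eta_i$ with probability $\delta$, $\delta\in(0,1/2)$ (unknown), and $\xi_1,\dots,\xi_n$ are i.i.d. isotropic ($\mathbf{E}\,\xi_i\xi_i^\top=\mathbf{I}_d$) $1$-sub-Gaussian vectors, independent of $\eta$. A random vector $\omega\in\mathbf{R}^d$ is $1$-sub-Gaussian if $\mathbf{E}\exp(\langle v,\omega\rangle)\le\exp(\|v\|^2/2)$ for all $v\in\mathbf{R}^d$. Absolute constants do not depend on $n,d,\delta,\theta$ or the noise distribution. Notation. $a\vee b=\max(a,b)$, $a\wedge b=\min(a,b)$, $\|\cdot\|$ is the Euclidean norm, $x_+=\max(x,0)$; a ratio with zero denominator and positive numerator is read as $+\infty$. The loss is $L(u,v)=\min\{\|u-v\|,\|u+v\|\}$ for $u,v\in\mathbf{R}^d$. Estimator. For a number of buckets $\ell\in\{1,\dots,n\}$ let $k=\lfloor n/\ell\rfloor$ and divide the indices $1,\dots,k\ell$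 into $\ell$ consecutive blocks $I_1,\dots,I_\ell$ of length $k$ (so all observations are used when $n=k\ell$). Set $\tilde Y_i=\frac1k\sum_{j\in I_i}Y_j$, let $\tilde Y\in\mathbf{R}^{d\times\ell}$ be the matrix with columns $\tilde Y_i$, and $\hat\Sigma=\frac1\ell\tilde Y\tilde Y^\top$. Let $\lambda_{max}(\hat\Sigma)$ and $v_{max}(\hat\Sigma)$ be its top eigenvalue and a corresponding unit eigenvector. The estimator is $$\tilde{\theta}(\ell) = \sqrt{\Big(\lambda_{max}(\hat{\Sigma})-\frac{1}{k}\Big)_+}\; v_{max}(\hat{\Sigma}),$$ and $\tilde\theta(\tilde\ell)$, $\tilde\theta(\tilde\ell_2)$ denote this family evaluated at the data-dependent values $\tilde\ell$, $\tilde\ell_2$. *)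

(* Defs.v *)
From HB Require Import structures.
From mathcomp Require Import all_boot all_order all_algebra.
From mathcomp Require Import all_classical all_reals all_analysis.

Set Implicit Arguments.
Unset Strict Implicit.
Unset Printing Implicit Defensive.

Import Order.TTheory GRing.Theory Num.Theory.
Import numFieldNormedType.Exports.

Local Open Scope classical_set_scope.
Local Open Scope ring_scope.

Section Euclidean.
Context {R : realType} {d : nat}.
Implicit Types u v : 'cV[R]_d.

Definition dotp u v : R := \sum_i u i 0 * v i 0.

(* The library norm on matrices is the sup norm. *)
Definition norm2 u : R := Num.sqrt (dotp u u).

Definition loss u v : R := Num.min (norm2 (u - v)) (norm2 (u + v)).

(* For symmetric S with d >= 1 the set of eigenvalues is finite and nonempty,
   so that this supremum is the largest eigenvalue. *)
Definition lambda_max (S : 'M[R]_d) : R := sup [set a | eigenvalue S a].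

(* An arbitrary (not necessarily measurable) choice of a unit eigenvector for
   the top eigenvalue of each symmetric matrix. *)
Definition top_eigenvector (vmax : 'M[R]_d -> 'cV[R]_d) : Prop :=
  forall S : 'M[R]_d, S^T = S ->
    S *m vmax S = lambda_max S *: vmax S /\ norm2 (vmax S) = 1.

End Euclidean.

(* R^d with its Borel sigma-algebra. *)
Definition borel_cV (R : realType) (d : nat) :=
  g_sigma_algebraType (@open ('cV[R]_d)).

Section Probability.
Context {disp : measure_display} {T : measurableType disp} {R : realType}.
Variable P : probability T R.

(* "E holds with probability at least p"; E itself need not be measurable. *)
Definition with_prob_ge (p : R) (E : set T) : Prop :=
  exists A : set T, [/\ measurable A, A `<=` E & (p%:E <= P A)%E].

Definition mutually_independent {dU : measure_display}
    {U : measurableType dU} {I : finType} (X : I -> T -> U) : Prop :=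
  forall (J : {set I}) (B : I -> set U), (forall i, measurable (B i)) ->
    P (\bigcap_(i in [set` J]) (X i @^-1` B i)) =
    (\prod_(i in J) P (X i @^-1` B i))%E.

Definition sigma_of {dU : measure_display} {U : measurableType dU}
    {I : Type} (X : I -> T -> U) : set (set T) :=
  <<s \bigcup_i preimage_set_system [set: T] (X i) measurable >>.

Definition independent_families {dU dV : measure_display}
    {U : measurableType dU} {V : measurableType dV} {I J : Type}
    (X : I -> T -> U) (Z : J -> T -> V) : Prop :=
  forall A B : set T, sigma_of X A -> sigma_of Z B ->
    P (A `&` B) = (P A * P B)%E.

Definition identically_distributed {dU : measure_display}
    {U : measurableType dU} {I : Type} (X : I -> {RV P >-> U}) : Prop :=
  forall i j (B : set U), measurable B ->
    distribution P (X i) B = distribution P (X j) B.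

Definition isotropic {d : nat} (X : T -> 'cV[R]_d) : Prop :=
  forall a b : 'I_d, ('E_P[fun w => (X w a 0 * X w b 0)%R] = ((a == b)%:R)%:E)%E.

Definition subgaussian1 {d : nat} (X : T -> 'cV[R]_d) : Prop :=
  forall v : 'cV[R]_d,
    ('E_P[fun w => expR (dotp v (X w))] <= (expR (norm2 v ^+ 2 / 2))%:E)%E.

(* Time is 0-based: eta 0, ..., eta (n-1). The last clause is the Markov
   property with conditioning on the whole past, multiplied out by the
   probability of the conditioning event. *)
Definition switching_chain {n : nat} (delta : R) (eta : 'I_n -> T -> R) :
    Prop :=
  [/\ forall i w, eta i w = 1 \/ eta i w = -1,
      forall i : 'I_n, i = 0%N :> nat ->
        P [set w | eta i w = 1] = (2^-1)%:E /\
        P [set w | eta i w = -1] = (2^-1)%:E &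
      forall i j : 'I_n, j = i.+1 :> nat ->
      forall e : 'I_n -> R, (forall k, e k = 1 \/ e k = -1) ->
        P [set w | forall k : 'I_n, (k <= j)%N -> eta k w = e k] =
        (P [set w | forall k : 'I_n, (k <= i)%N -> eta k w = e k] *
         (if e j == e i then 1 - delta else delta)%:E)%E].

End Probability.

(* The greatest M with 2 ^ M * d <= n; since d >= 1, any such M is <= n. *)
Definition max_level (n d : nat) : nat := \max_(i < n.+1 | (2 ^ i * d <= n)%N) i.

Definition grid (d i : nat) : nat := (2 ^ i * d)%N.

Section Estimator.
Context {R : realType} {n d : nat}.
Variables (vmax : 'M[R]_d -> 'cV[R]_d) (Y : 'I_n -> 'cV[R]_d).

(* With k = n %/ l, the i-th block (0-based) is { i k, ..., (i+1) k - 1 }. *)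
Definition bucket_mean (l : nat) (i : 'I_l) : 'cV[R]_d :=
  let k := (n %/ l)%N in
  k%:R^-1 *: \sum_(j < n | (i * k <= j < i.+1 * k)%N) Y j.

Definition bucket_mx (l : nat) : 'M[R]_(d, l) :=
  \matrix_(a < d, i < l) bucket_mean i a 0.

Definition sigma_hat (l : nat) : 'M[R]_d :=
  l%:R^-1 *: (bucket_mx l *m (bucket_mx l)^T).

Definition theta_tilde (l : nat) : 'cV[R]_d :=
  Num.sqrt (Num.max (lambda_max (sigma_hat l) - ((n %/ l)%N)%:R^-1) 0) *:
    vmax (sigma_hat l).

(* The j-th comparison, where s stands for the norm in the denominator. The
   division is that of the extended reals, for which a / 0 = +oo if a > 0. *)
Definition close_levels (C : R) (s : R) (j : nat) : bool :=
  ((loss (theta_tilde (grid d j)) (theta_tilde (grid d j.-1)) ^+ 2)%:E <=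
   (4 * C ^+ 2)%:E *
   Order.min (Num.sqrt (d%:R * (grid d j)%:R) / n%:R)%:E
             ((d%:R * (grid d j)%:R)%:E / (n%:R ^+ 2 * s ^+ 2)%:E))%E.

(* The default candidate m = M of the minimum satisfies the condition
   vacuously. *)
Definition select_level (C : R) (s : nat -> R) : nat :=
  [arg min_(m < (ord_max : 'I_(max_level n d).+1) |
     [forall j : 'I_(max_level n d).+1, (m < j)%N ==> close_levels C (s j) j])
   (m : nat)]%N.

Definition l_tilde (C : R) : nat :=
  grid d (select_level C (fun j => norm2 (theta_tilde (grid d j)))).

Definition l_tilde2 (C : R) : nat :=
  grid d (select_level C (fun=> norm2 (theta_tilde (l_tilde C)))).

End Estimator.

Section Rates.
Context {R : realType}.
Variables (n d : nat) (delta : R) (theta : 'cV[R]_d).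

(* (d \/ x) /\ n and d \/ (x /\ n) agree because d <= n. *)
Definition l_star2 : int :=
  Num.min (Num.max d%:Z
    (Num.ceil
      (Num.max
        (Num.max (n%:R * delta)
           ((delta `^ (2 / 3)) * (n%:R `^ (4 / 3)) * (norm2 theta `^ (4 / 3))
              / (d%:R `^ (1 / 3))))
        (n%:R * norm2 theta ^+ 2)))) n%:Z.

Definition global_rate : R := Num.sqrt (delta * d%:R / n%:R) + d%:R / n%:R.

(* Equal to +oo when theta = 0. *)
Definition local_rate : \bar R :=
  ((l_star2%:~R * d%:R)%:E / (n%:R ^+ 2 * norm2 theta ^+ 2)%:E
     + (d%:R / n%:R)%:E)%E.

End Rates.

(* Main.v *)
Require Import Defs.
From HB Require Import structures.
From mathcomp Require Import all_boot all_order all_algebra.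
From mathcomp Require Import all_classical all_reals all_analysis.
From mathcomp Require Import measurable_realfun.
From mathcomp Require Import ring lra.

(* For a level l with k = n / l, write Sigma_hat - I / k = rho theta theta^T + E,
   where rho is the mean squared block average of the signs. A 1/4-net of at
   most e^(18 d) points, the sub-Gaussian tail of the cross term (conditionally
   on the signs) and a Bernstein bound for the quadratic term give, at all
   levels simultaneously, |E| <= c (a + |theta| sqrt(d / n)) with
   a = sqrt(d l) / n. Perturbation of the top eigenpair then bounds the loss of
   theta_tilde(l) against sqrt(rho) theta, and the bias 1 - rho is at most the
   number of sign flips over l, which has an exponential tail. Thus from an
   oracle level l** on, the squared loss is at most
   C0^2 (a /\ a^2 / |theta|^2). Lepski's first pass gives this with a at the
   oracle level, up to a constant and without the second term; this locates
   |theta| well enough for the threshold of the second pass to recover the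
   second term. *)

Set Implicit Arguments.
Unset Strict Implicit.
Unset Printing Implicit Defensive.

Import Order.TTheory GRing.Theory Num.Theory.
Import numFieldNormedType.Exports.

Local Open Scope classical_set_scope.
Local Open Scope ring_scope.

(** * Euclidean geometry and top eigenvalues *)

(** The choice [vmax] need not be measurable, so no probability is ever computed for the estimator
    itself. All randomness is confined to [good_event], which involves only the signs and the noise
    tested at finitely many net points; on that event the rest is a deterministic argument for each
    outcome. Conditioning on the signs is a finite sum over sign patterns. Since a /\ a^2 / s = a^2
    / (a \/ s), a bound on a squared loss X is written X max(a, s) <= c a^2. No division occurs,
    theta = 0 is included, and both terms of the rate are carried by one inequality. The selection
    needs two passes because the second term of the threshold depends on |theta|. Below the oracle
    level the norms of the estimates are not controlled, so there the first pass can only use the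
    term free of them; its output is nevertheless close enough to theta to serve as one fixed norm
    for all tests of the second pass. *)

Section DotProduct.
Context {R : realType} {d : nat}.
Implicit Types (u v w x y : 'cV[R]_d) (a b : R).

Lemma dotpC u v : dotp u v = dotp v u.
Proof. by apply: eq_bigr => i _; rewrite mulrC. Qed.

Lemma dotpDl u v w : dotp (u + v) w = dotp u w + dotp v w.
Proof. by rewrite -big_split; apply: eq_bigr => i _; rewrite mxE mulrDl. Qed.

Lemma dotpDr u v w : dotp w (u + v) = dotp w u + dotp w v.
Proof. by rewrite dotpC dotpDl !(dotpC w). Qed.

Lemma dotpZl a u v : dotp (a *: u) v = a * dotp u v.
Proof. by rewrite mulr_sumr; apply: eq_bigr => i _; rewrite mxE mulrA. Qed.

Lemma dotpZr a u v : dotp u (a *: v) = a * dotp u v.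
Proof. by rewrite dotpC dotpZl dotpC. Qed.

Lemma dotpNl u v : dotp (- u) v = - dotp u v.
Proof. by rewrite -scaleN1r dotpZl mulN1r. Qed.

Lemma dotpNr u v : dotp u (- v) = - dotp u v.
Proof. by rewrite dotpC dotpNl dotpC. Qed.

Lemma dotp_sumr (I : Type) (s : seq I) (Q : pred I) (F : I -> 'cV[R]_d) u :
  dotp u (\sum_(i <- s | Q i) F i) = \sum_(i <- s | Q i) dotp u (F i).
Proof.
apply: (big_morph (dotp u) (fun v w => dotpDr v w u)).
by apply: big1 => i _; rewrite mxE mulr0.
Qed.

Lemma dotp_ge0 u : 0 <= dotp u u.
Proof. by apply: sumr_ge0 => i _; rewrite -expr2 sqr_ge0. Qed.

Lemma dotp_eq0 u : dotp u u = 0 -> u = 0.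
Proof.
move=> /eqP; rewrite psumr_eq0; last by move=> i _; rewrite -expr2 sqr_ge0.
move=> /allP H; apply/matrixP => i j; rewrite mxE ord1.
by have := H i (mem_index_enum i); rewrite /= -expr2 sqrf_eq0 => /eqP.
Qed.

Lemma dotp0l u : dotp 0 u = 0.
Proof. by rewrite /dotp big1// => i _; rewrite mxE mul0r. Qed.

Lemma dotp0r u : dotp u 0 = 0.
Proof. by rewrite dotpC dotp0l. Qed.

Lemma norm2_ge0 u : 0 <= norm2 u.
Proof. exact: sqrtr_ge0. Qed.

Lemma norm2_sqr u : norm2 u ^+ 2 = dotp u u.
Proof. by rewrite sqr_sqrtr// dotp_ge0. Qed.

Lemma norm2_eq0 u : norm2 u = 0 -> u = 0.
Proof. by move=> h; apply: dotp_eq0; rewrite -norm2_sqr h expr0n. Qed.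

Lemma norm2N u : norm2 (- u) = norm2 u.
Proof. by rewrite /norm2 dotpNl dotpNr opprK. Qed.

Lemma norm2Z a u : norm2 (a *: u) = `|a| * norm2 u.
Proof.
by rewrite /norm2 dotpZl dotpZr mulrA -expr2 sqrtrM ?sqr_ge0// sqrtr_sqr.
Qed.

Lemma norm2_0 : norm2 (0 : 'cV[R]_d) = 0.
Proof. by rewrite -(scale0r (0 : 'cV[R]_d)) norm2Z normr0 mul0r. Qed.

Lemma dotp_sqr_le u v : dotp u v ^+ 2 <= dotp u u * dotp v v.
Proof.
have [v0|v0] := eqVneq (dotp v v) 0.
  by rewrite v0 mulr0 (dotp_eq0 v0) dotp0r expr0n.
have vp : 0 < dotp v v by rewrite lt_def v0 dotp_ge0.
have := dotp_ge0 (dotp v v *: u - dotp u v *: v).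
rewrite dotpDl !dotpDr !dotpNl !dotpNr !dotpZl !dotpZr (dotpC v u) => h.
have : 0 <= dotp v v * (dotp u u * dotp v v - dotp u v ^+ 2) by nra.
by rewrite pmulr_rge0// subr_ge0.
Qed.

Lemma dotp_le u v : `|dotp u v| <= norm2 u * norm2 v.
Proof.
have p0 : 0 <= norm2 u * norm2 v by rewrite mulr_ge0 ?norm2_ge0.
rewrite -(ger0_norm p0) -ler_sqr ?nnegrE ?normr_ge0// !real_normK ?num_real//.
by rewrite exprMn !norm2_sqr dotp_sqr_le.
Qed.

Lemma norm2D u v : norm2 (u + v) <= norm2 u + norm2 v.
Proof.
have p0 : 0 <= norm2 u + norm2 v by rewrite addr_ge0 ?norm2_ge0.
rewrite -ler_sqr ?nnegrE ?norm2_ge0// norm2_sqr dotpDl !dotpDr sqrrD !norm2_sqr.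
by rewrite (dotpC v u); have := dotp_le u v; rewrite ler_norml => /andP[_ h]; lra.
Qed.

Lemma norm2B u v : norm2 (u - v) <= norm2 u + norm2 v.
Proof. by rewrite -(norm2N v) norm2D. Qed.

Lemma norm2_gt0 u : u != 0 -> 0 < norm2 u.
Proof. by move=> u0; rewrite lt_def norm2_ge0 andbT; apply: contra_neq u0; exact: norm2_eq0. Qed.

Lemma norm2_le u a : 0 <= a -> dotp u u <= a ^+ 2 -> norm2 u <= a.
Proof. by move=> a0; rewrite -norm2_sqr ler_pXn2r// nnegrE norm2_ge0. Qed.

Lemma norm2_unit u : u != 0 -> norm2 ((norm2 u)^-1 *: u) = 1.
Proof.
move=> u0; have n0 : norm2 u != 0 by apply: contra_neq u0; exact: norm2_eq0.
by rewrite norm2Z ger0_norm ?invr_ge0 ?norm2_ge0// mulVf.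
Qed.

Lemma dotp_trmx l (A : 'M[R]_(d, l)) u (v : 'cV[R]_l) : dotp u (A *m v) = dotp (A^T *m u) v.
Proof.
rewrite /dotp; under eq_bigr do rewrite mxE mulr_sumr.
rewrite exchange_big/=; apply: eq_bigr => i _; rewrite mxE mulr_suml.
by apply: eq_bigr => j _; rewrite mxE; ring.
Qed.

(** The squared Frobenius norm serves as c. Only the existence of some c matters: it makes the sets
    of Rayleigh quotients bounded and yields coercivity of an invertible form. *)
Lemma mulmx_norm2_bound (A : 'M[R]_d) : exists2 c : R, 0 <= c &
  forall x, dotp (A *m x) (A *m x) <= c * dotp x x.
Proof.
exists (\sum_i dotp (row i A)^T (row i A)^T).
  by apply: sumr_ge0 => i _; exact: dotp_ge0.
move=> x; rewrite mulr_suml; apply: ler_sum => i _.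
rewrite -expr2; apply: le_trans (dotp_sqr_le _ _).
suff -> : (A *m x) i 0 = dotp (row i A)^T x by [].
by rewrite mxE; apply: eq_bigr => j _; rewrite !mxE.
Qed.

Lemma loss_ge0 u v : 0 <= loss u v.
Proof. by rewrite le_min !norm2_ge0. Qed.

Lemma lossC u v : loss u v = loss v u.
Proof. by rewrite /loss -norm2N opprB [u + v]addrC. Qed.

Lemma lossNl u v : loss (- u) v = loss u v.
Proof. by rewrite /loss -norm2N opprD !opprK -[X in Num.min _ X]norm2N opprD opprK minC. Qed.

Lemma loss_le u v : loss u v <= norm2 (u - v).
Proof. by rewrite ge_min lexx. Qed.

Lemma loss_refl u : loss u u = 0.
Proof. by apply/eqP; rewrite eq_le loss_ge0 andbT (le_trans (loss_le _ _))// subrr norm2_0. Qed.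

(** [loss] is the quotient distance that identifies u with -u: the signs attaining the two minima on
    the right multiply to an admissible sign for the pair u, w. *)
Lemma loss_triangle u v w : loss u w <= loss u v + loss v w.
Proof.
have t (a b c : 'cV[R]_d) : a = b + c -> norm2 a <= norm2 b + norm2 c.
  by move=> ->; exact: norm2D.
rewrite /loss; have [_|_] := leP (norm2 (u - v)) (norm2 (u + v));
  have [_|_] := leP (norm2 (v - w)) (norm2 (v + w)); rewrite ge_min.
- by rewrite (t (u - w) (u - v) (v - w))// addrA subrK.
- by rewrite (t (u + w) (u - v) (v + w)) ?orbT// addrA subrK.
- by rewrite -(norm2N (v - w)) (t (u + w) (u + v) (- (v - w))) ?orbT// opprB addrACA subrr addr0 addrC.
- by rewrite -(norm2N (v + w)) (t (u - w) (u + v) (- (v + w)))// opprD addrA addrK.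
Qed.

Lemma loss_norm2 u v : norm2 u <= norm2 v + loss u v.
Proof.
rewrite /loss minEle; case: ifP => _.
  by rewrite -{1}(subrK v u) addrC norm2D.
rewrite -(norm2N v) -{1}(addrK v u) [leRHS]addrC; exact: norm2D.
Qed.

Lemma loss_le_norm2D u v : loss u v <= norm2 u + norm2 v.
Proof. exact: le_trans (loss_le _ _) (norm2B _ _). Qed.

End DotProduct.

(** * The top eigenvalue and the Rayleigh quotient *)

Section LambdaMax.
Context {R : realType} {d : nat}.
Implicit Types (x y v : 'cV[R]_d) (S B : 'M[R]_d).

Lemma psd_cauchy_schwarz B x y : B^T = B -> (forall z, 0 <= dotp z (B *m z)) ->
  dotp x (B *m y) ^+ 2 <= dotp x (B *m x) * dotp y (B *m y).
Proof.
move=> sB B0.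
have xy : dotp y (B *m x) = dotp x (B *m y) by rewrite dotp_trmx sB dotpC.
set p := dotp x (B *m x); set q := dotp x (B *m y); set r := dotp y (B *m y).
have H (s t : R) : 0 <= s ^+ 2 * p + 2 * s * t * q + t ^+ 2 * r.
  have := B0 (s *: x + t *: y); rewrite mulmxDr -!scalemxAr dotpDl !dotpDr.
  by rewrite !dotpZl !dotpZr xy -/p -/q -/r => h; lra.
have p0 : 0 <= p := B0 x; have r0 : 0 <= r := B0 y.
have [r1|r1] := eqVneq r 0.
  (* For r = 0 the form is affine in t, and at s = q, t = - (p + 1) / 2 it equals - q^2, which
     forces q = 0. *)
  by have := H 1 (- (p + 1) / 2 * q); have := H q (- (p + 1) / 2); rewrite r1; nra.
have rp : 0 < r by rewrite lt_def r1.
have := H r (- q) => h.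
have : 0 <= r * (p * r - q ^+ 2) by nra.
by rewrite pmulr_rge0// subr_ge0.
Qed.

(* The supremum q of the Rayleigh quotient is an eigenvalue: otherwise q - S
   is positive semidefinite and invertible, hence coercive. *)
Lemma rayleigh_le S x : S^T = S -> dotp x (S *m x) <= lambda_max S * dotp x x.
Proof.
move=> sS.
have [->|x0] := eqVneq x 0; first by rewrite mulmx0 !dotp0r mulr0.
pose E := [set r | exists2 y, dotp y y = 1 & r = dotp y (S *m y)].
have unit_dotp y : y != 0 -> dotp ((norm2 y)^-1 *: y) ((norm2 y)^-1 *: y) = 1.
  by move=> y0; rewrite -norm2_sqr norm2_unit// expr1n.
have E0 : E !=set0.
  by exists (dotp ((norm2 x)^-1 *: x) (S *m ((norm2 x)^-1 *: x))); exists ((norm2 x)^-1 *: x) => //; exact: unit_dotp.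
have [c c0 Sc] := mulmx_norm2_bound S.
have Eub : has_ubound E.
  exists (1 + c) => _ [y y1 ->].
  have := dotp_sqr_le y (S *m y); rewrite y1 mul1r => h1.
  have := Sc y; rewrite y1 mulr1 => h2; nra.
set q := sup E.
have qR y : dotp y (S *m y) <= q * dotp y y.
  have [->|y0] := eqVneq y 0; first by rewrite mulmx0 !dotp0r mulr0.
  have ny := norm2_gt0 y0.
  have : dotp ((norm2 y)^-1 *: y) (S *m ((norm2 y)^-1 *: y)) <= q.
    by apply: ub_le_sup => //; exists ((norm2 y)^-1 *: y) => //; exact: unit_dotp.
  rewrite -scalemxAr dotpZl dotpZr mulrA -expr2 -norm2_sqr exprVn.
  by rewrite ler_pdivrMl ?exprn_gt0// mulrC.
pose B := q%:M - S.
have Bx y : B *m y = q *: y - S *m y by rewrite mulmxBl mul_scalar_mx.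
have sB : B^T = B by rewrite linearB/= tr_scalar_mx sS.
have B0 y : 0 <= dotp y (B *m y) by rewrite Bx dotpDr dotpNr dotpZr subr_ge0.
have Bsing : B \notin unitmx.
  apply/negP => uB.
  have [b b0 Bb] := mulmx_norm2_bound B.
  have [k k0 Bk] := mulmx_norm2_bound (invmx B).
  (* [psd_cauchy_schwarz] for the pair y, B y bounds |B y|^2 by (b + 1) <y, B y>; the bound k for
     the inverse of B turns this into coercivity. Using b + 1 instead of sqrt b avoids a root. *)
  have coer y : dotp y y <= k * ((b + 1) * dotp y (B *m y)).
    have := Bk (B *m y); rewrite mulKmx// => /le_trans; apply.
    rewrite ler_wpM2l//.
    set z := B *m y.
    have h1 := psd_cauchy_schwarz y z sB B0.
    have h2 : dotp z (B *m z) <= (b + 1) * dotp z z.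
      have := dotp_sqr_le z (B *m z); have := Bb z; have := dotp_ge0 z => z0 h3 h4.
      have : dotp z (B *m z) ^+ 2 <= ((b + 1) * dotp z z) ^+ 2.
        apply: le_trans h4 _; apply: (@le_trans _ _ (dotp z z * (b * dotp z z))).
          by rewrite ler_wpM2l.
        by nra.
      by rewrite ler_sqr ?nnegrE// ?mulr_ge0//; lra.
    have h3 : dotp y (B *m z) = dotp z z by rewrite dotp_trmx sB.
    rewrite h3 -/z in h1.
    have [z0|z0] := eqVneq (dotp z z) 0.
      by rewrite z0 mulr_ge0 ?B0//; lra.
    have zp : 0 < dotp z z by rewrite lt_def z0 dotp_ge0.
    have := B0 y; rewrite -/z => By0.
    have h4 : dotp z z ^+ 2 <= dotp y z * ((b + 1) * dotp z z).
      by apply: le_trans h1 _; rewrite ler_wpM2l.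
    by rewrite -(ler_pM2r zp); lra.
  have e0 : 0 < k * (b + 1) + 1 by have := mulr_ge0 k0 b0; lra.
  (* Coercivity would make a number smaller than q an upper bound of the quotients. *)
  have : q <= q - (k * (b + 1) + 1)^-1.
    apply: ge_sup => // _ [y y1 ->].
    have := coer y; rewrite y1 Bx dotpDr dotpNr dotpZr y1 mulr1 => h.
    have h' : (k * (b + 1) + 1) * (q - dotp y (S *m y)) >= 1.
      by have := qR y; rewrite y1 mulr1; lra.
    have : (k * (b + 1) + 1)^-1 <= q - dotp y (S *m y).
      by rewrite -[leLHS]mulr1 ler_pdivrMl.
    lra.
  by have := e0; rewrite -invr_gt0; lra.
have qeig : eigenvalue S q.
  rewrite /eigenvalue /eigenspace kermx_eq0 row_free_unit.
  by rewrite -opprB -/B -scaleN1r unitmxZ ?unitrN1.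
rewrite (le_trans (qR x))// ler_wpM2r ?dotp_ge0//.
(* [lambda_max] is a supremum, so the eigenvalues must also be bounded: each is a Rayleigh quotient,
   hence at most q. Eigenvectors are row vectors here, whence the transposes. *)
apply: ub_le_sup => //; exists q => a /eigenvalueP[v va v0].
have Sv : S *m v^T = a *: v^T by rewrite -linearZ/= -va trmx_mul sS.
have vT0 : v^T != 0 by rewrite trmx_eq0.
have := qR v^T; rewrite Sv dotpZr ler_pM2r// lt_def dotp_ge0 andbT.
by apply: contra_neq vT0; exact: dotp_eq0.
Qed.

End LambdaMax.

(** * Independence *)

Section IndependentPair.
Context {disp : measure_display} {T : measurableType disp} {R : realType}.
Variable P : probability T R.
Implicit Types f g : T -> R.

Definition independent_pair f g : Prop :=
  forall A B : set R, measurable A -> measurable B ->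
    P (f @^-1` A `&` g @^-1` B) = (P (f @^-1` A) * P (g @^-1` B))%E.

Lemma expectationM_ge0 f g :
  measurable_fun [set: T] f -> measurable_fun [set: T] g ->
  (forall x, 0 <= f x) -> (forall x, 0 <= g x) -> independent_pair f g ->
  ('E_P[fun w => (f w * g w)%R] = 'E_P[f] * 'E_P[g])%E.
Proof.
move=> mf mg f0 g0 fg.
(* The absolute values make F nonnegative on the whole plane, as Tonelli requires, and change
   nothing on the range of (f, g). *)
pose F (p : R * R) := (`|p.1| * `|p.2|)%:E.
have mF : measurable_fun setT F.
  apply/measurable_EFinP; apply: measurable_funM; apply: measurableT_comp => //.
pose f' := mfun_Sub (mem_set mf : f \in mfun).
pose g' := mfun_Sub (mem_set mg : g \in mfun).
pose h (x : T) := (f x, g x).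
have mh : measurable_fun [set: T] h by exact: measurable_fun_pair.
have E1 : ('E_P[fun w => (f w * g w)%R] = \int[pushforward P h]_p F p)%E.
  rewrite ge0_integral_pushforward//; last by move=> p _; rewrite lee_fin mulr_ge0.
  rewrite unlock preimage_setT; apply: eq_integral => x _ /=.
  by rewrite /F/= !ger0_norm.
have E2 : (\int[pushforward P h]_p F p =
    \int[distribution P f' \x distribution P g']_p F p)%E.
  apply: eq_measure_integral => A mA _; apply/esym.
  apply: product_measure_unique => // B C mB mC.
rewrite E1 E2 fubini_tonelli1//; last by move=> p; rewrite lee_fin mulr_ge0.
have mabs : measurable_fun [set: R] (fun x : R => `|x|%:E).
  by apply/measurable_EFinP; exact: normr_measurable.
have absE (k : T -> R) (k' : {mfun T >-> R}) : (k' : T -> R) = k ->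
    (forall x, 0 <= k x) -> (\int[distribution P k']_x `|x|%:E = 'E_P[k])%E.
  move=> <- k0; rewrite ge0_integral_distribution// unlock.
  by apply: eq_integral => x _ /=; rewrite ger0_norm.
transitivity (\int[distribution P f']_x (`|x|%:E * 'E_P[g]))%E.
  apply: eq_integral => x _; rewrite -(absE g g')// /fubini_F/= -ge0_integralZl//.
by rewrite ge0_integralZr ?(absE f f')//; exact: expectation_ge0.
Qed.

End IndependentPair.

Section Cylinders.
Context {disp : measure_display} {T : measurableType disp} {R : realType}.
Context {dU : measure_display} {U : measurableType dU} {I : finType}.
Variables (P : probability T R) (X : I -> T -> U).
Hypothesis mX : forall i, measurable_fun [set: T] (X i).
Hypothesis indX : mutually_independent P X.

(** The pi-system that generates the sigma-algebra of the coordinates in J. *)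
Definition cylinder (J : {set I}) : set (set T) :=
  [set A | exists B : I -> set U, (forall i, measurable (B i)) /\
    A = \bigcap_(i in [set` J]) (X i @^-1` B i)].

Lemma measurable_cylinder J : cylinder J `<=` measurable.
Proof.
move=> _ [B [mB ->]]; apply: fin_bigcap_measurable => [|i _]; first exact: finite_finset.
by rewrite -[X in measurable X]setTI; exact: mX.
Qed.

Lemma cylinder_setI J : setI_closed (cylinder J).
Proof.
move=> _ _ [B [mB ->]] [C [mC ->]]; exists (fun i => B i `&` C i); split.
  by move=> i; exact: measurableI.
by rewrite -bigcapI.
Qed.

Lemma cylinder_setT J : cylinder J [set: T].
Proof.
exists (fun=> setT); split => //.
by apply/seteqP; split.
Qed.

Lemma cylinder_indep (J K : {set I}) A B : {in J, forall i, i \notin K} -> cylinder J A -> cylinder K B ->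
  P (A `&` B) = (P A * P B)%E.
Proof.
move=> JK [B1 [mB1 ->]] [B2 [mB2 ->]].
pose B3 i := if i \in J then B1 i else B2 i.
have mB3 i : measurable (B3 i) by rewrite /B3; case: ifP.
have -> : \bigcap_(i in [set` J]) (X i @^-1` B1 i) =
    \bigcap_(i in [set` J]) (X i @^-1` B3 i).
  by apply: eq_bigcapr => i /= iJ; rewrite /B3 iJ.
have -> : \bigcap_(i in [set` K]) (X i @^-1` B2 i) =
    \bigcap_(i in [set` K]) (X i @^-1` B3 i).
  by apply: eq_bigcapr => i /= iK; rewrite /B3; case: ifPn => // /JK; rewrite iK.
rewrite -bigcap_setU (_ : _ `|` _ = [set` J :|: K]); last first.
  by apply/seteqP; split => i /=; rewrite inE => /orP.
rewrite !indX//.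
rewrite -bigU/=.
  by apply: eq_bigl => i; rewrite inE.
by rewrite disjoint_subset; apply/fintype.subsetP => i iJ; rewrite inE JK.
Qed.

Lemma sub_cylinder J A : <<s cylinder J >> A -> measurable A.
Proof.
apply: smallest_sub; first exact: sigma_algebra_measurable.
exact: measurable_cylinder.
Qed.

(** Uniqueness of finite measures agreeing on a pi-system, used twice: with one event C fixed, D |->
    P (C & D) and D |-> P C * P D agree on cylinders, hence on the generated sigma-algebra. This
    frees first one event, then the other. *)
Lemma sigma_cylinder_indep (J K : {set I}) A B : {in J, forall i, i \notin K} ->
  <<s cylinder J >> A -> <<s cylinder K >> B -> P (A `&` B) = (P A * P B)%E.
Proof.
suff H (J' K' : {set I}) (C : set T) : measurable C ->
    (forall D, cylinder K' D -> P (C `&` D) = (P C * P D)%E) ->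
    forall D, <<s cylinder K' >> D -> P (C `&` D) = (P C * P D)%E.
  move=> JK sA sB; apply: (H J K) => //; first exact: sub_cylinder sA.
  move=> D cD; rewrite setIC muleC; move: sA; apply: (H K J).
    exact: measurable_cylinder cD.
  by move=> E cE; apply: cylinder_indep cD cE => i iK; apply/negP => /JK; rewrite iK.
move=> mC CD D sD.
have pC : 0 <= fine (P C) by rewrite fine_ge0.
pose m1 := mrestr P mC.
pose m2 := mscale (NngNum pC) P.
have -> : P (C `&` D) = m1 D by rewrite /m1 /mrestr setIC.
have -> : (P C * P D)%E = m2 D by rewrite /m2 /mscale/= fineK ?fin_num_measure.
apply: (@g_sigma_algebra_measure_unique _ _ _ (cylinder K')
  (@measurable_cylinder K') (fun=> setT)) => //.
- by move=> _; exact: cylinder_setT.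
- by rewrite bigcup_const//; exists 0%N.
- exact: cylinder_setI.
- move=> A' cA'; rewrite /= /mrestr /mscale/= fineK ?fin_num_measure//.
  by rewrite setIC CD.
- move=> _; rewrite /= /mrestr setTI.
  by rewrite (le_lt_trans (probability_le1 _ _)) ?ltry.
Qed.

Definition cyl_measurable (J : {set I}) (f : T -> R) : Prop :=
  measurable_fun [set: g_sigma_algebraType (cylinder J)] f.

Lemma cyl_measurableW J f : cyl_measurable J f -> measurable_fun [set: T] f.
Proof.
move=> mf _ B mB; apply: sub_cylinder; exact: mf.
Qed.

Lemma cyl_measurable_sub (J K : {set I}) f : J \subset K -> cyl_measurable J f ->
  cyl_measurable K f.
Proof.
move=> JK mf _ B mB.
have := mf measurableT B mB; apply: smallest_sub => [|_ [C [mC ->]]].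
  exact: smallest_sigma_algebra.
apply: sub_sigma_algebra; exists (fun i => if i \in J then C i else setT).
split; first by move=> i; case: ifP.
apply/seteqP; split => w /= H i /= iJ.
  by case: ifP => // iJ'; exact: H.
by have /= := H i (fintype.subsetP JK _ iJ); rewrite iJ.
Qed.

Lemma cyl_measurable_comp (J : {set I}) i (h : U -> R) : i \in J ->
  measurable_fun [set: U] h -> cyl_measurable J (h \o X i).
Proof.
move=> iJ mh _ B mB; rewrite setTI; apply: sub_sigma_algebra.
exists (fun k => if k == i then h @^-1` B else setT); split.
  by move=> k; case: ifP => // _; rewrite -[X in measurable X]setTI; exact: mh.
apply/seteqP; split => w /=.
  by move=> H k /= kJ; case: eqP => [->|].
by move=> /(_ i iJ); rewrite /= eqxx.
Qed.

Lemma cyl_independent (J K : {set I}) f g : {in J, forall i, i \notin K} -> cyl_measurable J f ->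
  cyl_measurable K g -> independent_pair P f g.
Proof.
move=> JK mf mg A B mA mB; apply: sigma_cylinder_indep JK _ _.
  by rewrite -[X in <<s _ >> X]setTI; exact: mf.
by rewrite -[X in <<s _ >> X]setTI; exact: mg.
Qed.

(** A list of blocks allows peeling off one factor at a time; [mprod] records that the remaining
    product depends only on the union of the remaining blocks, which is disjoint from the block
    removed. *)
Lemma expectation_prod_blocks (L : eqType) (s : seq L) (J : L -> {set I})
    (F : L -> T -> R) : uniq s ->
  (forall a b, a \in s -> b \in s -> a != b -> {in J a, forall i, i \notin J b}) ->
  (forall a, cyl_measurable (J a) (F a)) -> (forall a w, 0 <= F a w) ->
  ('E_P[fun w => (\prod_(a <- s) F a w)%R] = \prod_(a <- s) 'E_P[F a])%E.
Proof.
move=> us dJ mF F0.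
have mprod t : cyl_measurable (\bigcup_(a <- t) J a) (fun w => \prod_(a <- t) F a w).
  elim: t => [|a t IH].
    rewrite (_ : (fun w => _) = cst 1); first exact: measurable_cst.
    by apply/funext => w; rewrite big_nil.
  rewrite (_ : (fun w => _) = (fun w => F a w * \prod_(b <- t) F b w)); last first.
    by apply/funext => w; rewrite big_cons.
  apply: measurable_funM.
    by apply: cyl_measurable_sub (mF a); rewrite big_cons finset.subsetUl.
  by apply: cyl_measurable_sub IH; rewrite big_cons finset.subsetUr.
elim: s us dJ => [|a s IH] us dJ.
  rewrite (_ : (fun w => _) = cst 1) ?expectation_cst ?big_nil//.
  by apply/funext => w; rewrite big_nil.
rewrite big_cons (_ : (fun w => _) = (fun w => F a w * \prod_(b <- s) F b w)); last first.
  by apply/funext => w; rewrite big_cons.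
rewrite expectationM_ge0 //.
- rewrite IH//; first by case/andP : us.
  by move=> b c bs cs; apply: dJ; rewrite inE ?bs ?cs orbT.
- exact: cyl_measurableW (mF a).
- exact: cyl_measurableW (mprod s).
- by move=> w; apply: prodr_ge0.
- apply: cyl_independent (mF a) (mprod s).
  have mem_cup t i : i \in \bigcup_(b <- t) J b -> exists2 b, b \in t & i \in J b.
    elim: t => [|c t IHt]; first by rewrite big_nil inE.
    rewrite big_cons inE => /orP[ic|/IHt[b bt ib]].
      by exists c => //; rewrite mem_head.
    by exists b => //; rewrite inE bt orbT.
  move=> i iJ; apply/negP => /mem_cup[b bs iJb].
  have ab : a != b by apply: contraNneq (andP us).1 => ->.
  have bas : b \in a :: s by rewrite inE bs orbT.
  by have /negP := dJ a b (mem_head _ _) bas ab i iJ.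
Qed.
End Cylinders.

(** * Sub-Gaussian variables *)

Section ExpInequalities.
Context {R : realType}.
Implicit Types x y t : R.

(** The linear term is kept exact so that it vanishes in expectation when y is centred. *)
Lemma expR_le_quadratic y : expR y <= 1 + y + y ^+ 2 * expR `|y|.
Proof.
have [y0|y0] := leP 0 y.
  have h : expR y <= 1 + y * expR y.
    have := expR_ge1Dx (- y); rewrite expRN => h.
    have := ler_wpM2r (expR_ge0 y) h; rewrite mulVf ?gt_eqF ?expR_gt0//; lra.
  have := ler_wpM2l y0 h; rewrite ger0_norm// expr2; lra.
have [z [z0 ->]] : exists z, 0 < z /\ y = - z by exists (- y); rewrite opprK oppr_gt0.
rewrite normrN gtr0_norm// sqrrN.
have h1 : expR (- z) <= 1 - z + z ^+ 2.
  rewrite expRN; apply: (@le_trans _ _ (1 + z)^-1).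
    by rewrite lef_pV2 ?posrE ?expR_gt0 ?expR_ge1Dx//; lra.
  by rewrite -[leLHS]mul1r ler_pdivrMr; nra.
have h2 : 1 <= expR z by rewrite -expR0 ler_expR ltW.
by nra.
Qed.

(** 512 = 2 * 16^2, from exp x >= x^2 / 2 at x = t / 16. *)
Lemma sqr_le_expR t : 0 <= t -> t ^+ 2 <= 512 * expR (t / 16).
Proof.
move=> t0; have := @expR_ge1Dxn R (t / 16) 1; rewrite divr_ge0// => /(_ isT).
rewrite (_ : (2`!)%N = 2%N)//; nra.
Qed.

(** exp (x^2 / 4) is the maximum over s of exp (s x - s^2), attained at s = x / 2. Rounding |x| / 2
    down to an integer m loses at most 1 in the exponent, whence the factor [expR 1]. A sum over m
    then plays the part of the usual Gaussian integral that linearises a square. *)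
Lemma expR_sqr_le_step x : exists m : nat,
  expR (x ^+ 2 / 4) <= expR 1 * (expR (- m%:R ^+ 2) * (expR (m%:R * x) + expR (- (m%:R * x)))).
Proof.
wlog x0 : x / 0 <= x => [H|].
  have [/H//|x0] := leP 0 x; have [|m] := H (- x); first lra.
  by rewrite sqrrN mulrN opprK => Hm; exists m; rewrite [X in _ * (_ * X)]addrC.
exists (Num.truncn (x / 2)).
have /andP[m1 m2] : ((Num.truncn (x / 2))%:R <= x / 2 < (Num.truncn (x / 2)).+1%:R).
  by apply: truncn_itv; lra.
set m : R := (Num.truncn _)%:R in m1 *.
have {}m2 : x / 2 < m + 1 by move: m2; rewrite -[X in _ < X]natr1.
apply: (@le_trans _ _ (expR 1 * (expR (- m ^+ 2) * expR (m * x)))).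
  rewrite -!expRD ler_expR; nra.
rewrite ler_pM2l ?expR_gt0// ler_pM2l ?expR_gt0// lerDl; exact: expR_ge0.
Qed.

(** As m <= m^2, the sum is dominated by a geometric series of ratio exp (- 1 / 2) <= 2 / 3. *)
Lemma sum_expR_half (n : nat) : \sum_(0 <= m < n) expR (- (m%:R ^+ 2 / 2) : R) <= 3.
Proof.
pose q : R := expR (- (1 / 2)).
have q0 : 0 < q := expR_gt0 _.
have q1 : q <= 2 / 3.
  have qe : q * expR (1 / 2) = 1 by rewrite -expRD addNr expR0.
  by have := expR_ge1Dx (1 / 2 : R); nra.
apply: (@le_trans _ _ (series (geometric 1 q) n)).
  rewrite /series/=; apply: ler_sum_nat => m _.
  rewrite mul1r /q -expRM_natl ler_expR.
  have : (m%:R <= m%:R ^+ 2 :> R) by rewrite -natrX ler_nat; case: m => // m; rewrite leq_pmulr.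
  by lra.
apply: le_trans (geometric_le_lim _ _ q0 _) _; [lra|rewrite ger0_norm; lra|].
rewrite ler_pdivrMr; lra.
Qed.

End ExpInequalities.

Section Expectation.
Context {disp : measure_display} {T : measurableType disp} {R : realType}.
Variable P : probability T R.
Implicit Types f g : T -> R.
Local Open Scope ereal_scope.

Lemma ge0_expectationD f g :
  measurable_fun [set: T] f -> measurable_fun [set: T] g ->
  (forall w, 0 <= f w)%R -> (forall w, 0 <= g w)%R ->
  'E_P[fun w => (f w + g w)%R] = 'E_P[f] + 'E_P[g].
Proof.
move=> mf mg f0 g0; rewrite unlock -ge0_integralD//.
- by move=> x _; rewrite lee_fin.
- exact/measurable_EFinP.
- by move=> x _; rewrite lee_fin.
- exact/measurable_EFinP.
Qed.

Lemma ge0_expectationZl (c : R) f : measurable_fun [set: T] f ->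
  (0 <= c)%R -> (forall w, 0 <= f w)%R ->
  'E_P[fun w => (c * f w)%R] = c%:E * 'E_P[f].
Proof.
move=> mf c0 f0; rewrite unlock -ge0_integralZl_EFin//.
- by move=> x _; rewrite lee_fin.
- exact/measurable_EFinP.
Qed.

Lemma ge0_expectation_le f g :
  measurable_fun [set: T] f -> measurable_fun [set: T] g ->
  (forall w, 0 <= f w)%R -> (forall w, f w <= g w)%R -> 'E_P[f] <= 'E_P[g].
Proof.
move=> mf mg f0 fg; rewrite unlock; apply: ge0_le_integral => //.
- by move=> x _; rewrite lee_fin.
- exact/measurable_EFinP.
- exact/measurable_EFinP.
- by move=> x _; rewrite lee_fin.
Qed.

Definition subgaussian f : Prop :=
  forall s : R, 'E_P[fun w => expR (s * f w)%R] <= (expR (s ^+ 2 / 2))%:E.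

Lemma measurable_expRZ (s : R) f : measurable_fun [set: T] f ->
  measurable_fun [set: T] (fun w => expR (s * f w)%R).
Proof.
move=> mf; apply: measurableT_comp; first exact: measurable_expR.
exact: measurable_funM.
Qed.

(** Summing [expR_sqr_le_step] over all m and integrating termwise: the m-th term has mean at most 2
    e exp (- m^2 / 2), and [sum_expR_half] contributes the factor 3. *)
Lemma subgaussian_expR_sqr f : measurable_fun [set: T] f -> subgaussian f ->
  'E_P[fun w => expR (f w ^+ 2 / 4)%R] <= (6 * expR 1)%:E.
Proof.
move=> mf sf.
pose F (m : nat) w : R :=
  (expR 1 * (expR (- m%:R ^+ 2) * (expR (m%:R * f w) + expR (- m%:R * f w))))%R.
have mF m : measurable_fun [set: T] (F m).
  by do 2 apply: measurable_funM => //; apply: measurable_funD; exact: measurable_expRZ.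
have F0 m w : (0 <= F m w)%R by rewrite !(mulr_ge0, addr_ge0, expR_ge0).
have EF m : 'E_P[F m] <= ((2 * expR 1) * expR (- (m%:R ^+ 2 / 2)))%:E.
  have mc : measurable_fun [set: T] (fun w => expR (m%:R * f w) + expR (- m%:R * f w))%R.
    by apply: measurable_funD; exact: measurable_expRZ.
  have c0 w : (0 <= expR (m%:R * f w) + expR (- m%:R * f w))%R.
    by rewrite addr_ge0 ?expR_ge0.
  have mc' : measurable_fun [set: T] (fun w => expR (- m%:R ^+ 2) *
      (expR (m%:R * f w) + expR (- m%:R * f w)))%R by exact: measurable_funM.
  have c0' w : (0 <= expR (- m%:R ^+ 2) * (expR (m%:R * f w) + expR (- m%:R * f w)))%R.
    by rewrite mulr_ge0 ?expR_ge0.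
  rewrite /F ge0_expectationZl ?expR_ge0// ge0_expectationZl ?expR_ge0//.
  rewrite ge0_expectationD//; [|exact: measurable_expRZ..].
  apply: (@le_trans _ _ ((expR 1)%:E * ((expR (- m%:R ^+ 2))%:E *
     ((expR (m%:R ^+ 2 / 2))%:E + (expR ((- m%:R) ^+ 2 / 2))%:E)))).
    by do 2 (apply: lee_wpmul2l; first by rewrite lee_fin expR_ge0); apply: leeD; exact: sf.
  rewrite -EFinD -!EFinM lee_fin sqrrN.
  rewrite [X in (_ <= _ * expR X)%R](_ : _ = - m%:R ^+ 2 + m%:R ^+ 2 / 2)%R; last by field.
  by rewrite expRD; lra.
apply: (@le_trans _ _ (\int[P]_w \sum_(0 <= m <oo) (F m w)%:E)).
  rewrite unlock; apply: ge0_le_integral => //.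
  - apply/measurable_EFinP; apply: measurableT_comp; first exact: measurable_expR.
    by apply: measurable_funM => //; exact: measurable_funX.
  - apply: ge0_emeasurable_sum => // m; first by move=> w _ _; rewrite lee_fin.
    by move=> _; exact/measurable_EFinP.
  - move=> w _; have [m Hm] := expR_sqr_le_step (f w).
    apply: (@le_trans _ _ (F m w)%:E); first by rewrite lee_fin /F mulNr.
    apply: le_trans (nneseries_lim_ge m.+1 _); last by move=> k _ _; rewrite lee_fin.
    rewrite big_nat_recr//= leeDr// sume_ge0// => k _; by rewrite lee_fin.
rewrite integral_nneseries//; [|by move=> m; exact/measurable_EFinP|by move=> m w _; rewrite lee_fin].
apply: lime_le.
  by apply: is_cvg_nneseries => m _ _; apply: integral_ge0 => w _; rewrite lee_fin.
near=> n.
apply: (@le_trans _ _ (\sum_(0 <= m < n) ((2 * expR 1) * expR (- (m%:R ^+ 2 / 2)))%:E)).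
  by apply: lee_sum => m _; have := EF m; rewrite unlock.
rewrite sumEFin lee_fin -mulr_sumr.
have := ler_wpM2l _ (@sum_expR_half R n) => /(_ (2 * expR 1)%R); rewrite mulr_ge0 ?expR_ge0// => /(_ isT); lra.
Unshelve. all: by end_near. Qed.

(** The variable y = l (f^2 - v) is centred, so [expR_le_quadratic] leaves only y^2 exp |y|. For |l|
    <= 1 / 16 both factors are absorbed by exp (f^2 / 4), up to 512 e l^2; with the mean 6 e of that
    exponential this gives 3072 e^2. *)
Lemma subgaussian_bernstein f (v l : R) : measurable_fun [set: T] f ->
  subgaussian f -> 'E_P[fun w => (f w ^+ 2)%R] = v%:E -> (0 <= v <= 1)%R ->
  (`|l| <= 1 / 16)%R ->
  'E_P[fun w => expR (l * (f w ^+ 2 - v))%R] <= (expR (3072 * expR 1 ^+ 2 * l ^+ 2))%:E.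
Proof.
move=> mf sf Ef /andP[v0 v1] l16.
(* Positive and negative parts of l. Moving terms across the inequality [pt] leaves nonnegative
   functions on both sides, whose expectations add without integrability conditions. *)
pose a := Num.max l 0%R; pose b := Num.max (- l)%R 0%R.
have a0 : (0 <= a)%R by rewrite le_max lexx orbT.
have b0 : (0 <= b)%R by rewrite le_max lexx orbT.
have lab : l = (a - b)%R.
  by rewrite /a /b; case: (leP l 0%R) => h; case: (leP (- l)%R 0%R) => h'; lra.
have mf2 : measurable_fun [set: T] (fun w => (f w ^+ 2)%R) by exact: measurable_funX.
pose y w : R := (l * (f w ^+ 2 - v))%R.
have my : measurable_fun [set: T] (fun w => expR (y w)).
  apply: measurableT_comp; first exact: measurable_expR.
  by apply: measurable_funM => //; exact: measurable_funB.
have me4 : measurable_fun [set: T] (fun w => expR (f w ^+ 2 / 4)%R).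
  apply: measurableT_comp; first exact: measurable_expR.
  by apply: measurable_funM.
have pt w : (expR (y w) + a * v + b * f w ^+ 2 <=
    1 + b * v + a * f w ^+ 2 + 512 * expR 1 * l ^+ 2 * expR (f w ^+ 2 / 4))%R.
  have := expR_le_quadratic (y w).
  suff : (y w ^+ 2 * expR `|y w| <= 512 * expR 1 * l ^+ 2 * expR (f w ^+ 2 / 4))%R.
    have -> : y w = ((a - b) * (f w ^+ 2 - v))%R by rewrite -lab.
    lra.
  set x := f w; have x0 : (0 <= x ^+ 2)%R by exact: sqr_ge0.
  have yx : (`|y w| <= `|l| * (x ^+ 2 + 1))%R.
    by rewrite /y normrM ler_wpM2l// -/x ler_norml; apply/andP; split; lra.
  have y16 : (`|y w| <= (x ^+ 2 + 1) / 16)%R.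
    apply: le_trans yx _; rewrite mulrC [leRHS]mulrC; nra.
  have y2 : (y w ^+ 2 <= l ^+ 2 * (x ^+ 2 + 1) ^+ 2)%R.
    rewrite -[leLHS]real_normK ?num_real// -[(l ^+ 2)%R]real_normK ?num_real// -exprMn.
    by rewrite ler_pXn2r// ?nnegrE// mulr_ge0//; lra.
  have e16 : (expR `|y w| <= expR ((x ^+ 2 + 1) / 16))%R by rewrite ler_expR.
  have s512 : ((x ^+ 2 + 1) ^+ 2 <= 512 * expR ((x ^+ 2 + 1) / 16))%R.
    by apply: sqr_le_expR; lra.
  apply: (@le_trans _ _ (l ^+ 2 * (512 * expR ((x ^+ 2 + 1) / 16)) * expR ((x ^+ 2 + 1) / 16))%R).
    apply: ler_pM => //; first exact: sqr_ge0.
    by apply: le_trans y2 _; rewrite ler_wpM2l ?sqr_ge0.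
  rewrite [leLHS](_ : _ = 512 * l ^+ 2 * (expR ((x ^+ 2 + 1) / 16) * expR ((x ^+ 2 + 1) / 16)))%R; last by ring.
  rewrite [leRHS](_ : _ = 512 * l ^+ 2 * (expR 1 * expR (x ^+ 2 / 4)))%R; last by ring.
  apply: ler_wpM2l; first exact: mulr_ge0 (ler0n _ _) (sqr_ge0 _).
  by rewrite -!expRD ler_expR; clear -x0; lra.
have m1 : measurable_fun [set: T] (fun w => expR (y w) + a * v + b * f w ^+ 2)%R.
  by apply: measurable_funD; [apply: measurable_funD|apply: measurable_funM].
have m2 : measurable_fun [set: T] (fun w => 1 + b * v + a * f w ^+ 2 + 512 * expR 1 * l ^+ 2 * expR (f w ^+ 2 / 4))%R.
  by apply: measurable_funD; [apply: measurable_funD => //; apply: measurable_funM|apply: measurable_funM].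
have := ge0_expectation_le m1 m2 _ pt.
have K0 : (0 <= 512 * expR 1 * l ^+ 2)%R.
  exact: mulr_ge0 (mulr_ge0 (ler0n _ _) (expR_ge0 _)) (sqr_ge0 _).
have p0 w : (0 <= expR (y w) + a * v + b * f w ^+ 2)%R.
  by rewrite !(sqr_ge0, addr_ge0, mulr_ge0, expR_ge0).
move=> /(_ p0).
rewrite ge0_expectationD; last 4 first.
- by apply: measurable_funD.
- exact: measurable_funM.
- by move=> w; rewrite !(addr_ge0, mulr_ge0, expR_ge0).
- by move=> w; rewrite mulr_ge0 ?sqr_ge0.
rewrite ge0_expectationD//; last by move=> w; rewrite mulr_ge0.
rewrite (ge0_expectationD (f := fun w => 1 + b * v + a * f w ^+ 2)%R); last 4 first.
- by apply: measurable_funD => //; exact: measurable_funM.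
- exact: measurable_funM.
- by move=> w; rewrite !(sqr_ge0, addr_ge0, mulr_ge0).
- by move=> w; exact: mulr_ge0 K0 (expR_ge0 _).
rewrite (ge0_expectationD (f := fun w => 1 + b * v)%R); last 4 first.
- exact: measurable_cst.
- exact: measurable_funM.
- by move=> w; rewrite !(addr_ge0, mulr_ge0).
- by move=> w; rewrite mulr_ge0 ?sqr_ge0.
rewrite !(ge0_expectationZl (f := fun w => f w ^+ 2)%R)//; last 2 first.
- by move=> w; rewrite sqr_ge0.
- by move=> w; rewrite sqr_ge0.
rewrite (ge0_expectationZl (f := fun w => expR (f w ^+ 2 / 4)))//.
rewrite !(expectation_cst P) Ef => H.
have E4 := subgaussian_expR_sqr mf sf.
have : 'E_P[(fun w => expR (y w))] + (a * v)%:E + b%:E * v%:E <=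
  (1 + b * v)%:E + a%:E * v%:E + (512 * expR 1 * l ^+ 2)%:E * (6 * expR 1)%:E.
  apply: le_trans H _; rewrite leeD2l// lee_wpmul2l// lee_fin.
have : 0 <= 'E_P[(fun w => expR (y w))] by apply: expectation_ge0 => w; exact: expR_ge0.
case: ('E_P[_]) => [r| |] //=.
rewrite -!EFinM -!EFinD !lee_fin => _.
have -> : (512 * expR 1 * l ^+ 2 * (6 * expR 1) = 3072 * expR 1 ^+ 2 * l ^+ 2 :> R)%R by ring.
have := expR_ge1Dx (3072 * expR 1 ^+ 2 * l ^+ 2)%R.
set c := (3072 * _ * _)%R; move: (expR c) => ec; clear; lra.
Qed.

Lemma expectation_chernoff f (l t b : R) : measurable_fun [set: T] f -> (0 < l)%R ->
  'E_P[fun w => expR (l * f w)%R] <= (expR b)%:E ->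
  P [set w | t <= f w]%R <= (expR (b - l * t))%:E.
Proof.
move=> mf l0 H.
have := @chernoff _ _ _ P (mfun_Sub (mem_set mf : f \in mfun)) l t l0.
rewrite /mmt_gen_fun/= => /le_trans; apply.
rewrite expRD EFinM lee_wpmul2r ?lee_fin ?expR_ge0//.
apply: le_trans H; rewrite le_eqVlt; apply/orP; left; apply/eqP; congr expectation.
by apply/funext => w /=; rewrite mulrC.
Qed.

End Expectation.

Section Integrability.
Context {disp : measure_display} {T : measurableType disp} {R : realType}.
Variable P : probability T R.
Implicit Types f g : T -> R.

Definition L1 f := P.-integrable [set: T] (EFin \o f).

Lemma ge0_L1 f (e : R) : measurable_fun [set: T] f -> (forall w, 0 <= f w) ->
  ('E_P[f] <= e%:E)%E -> L1 f.
Proof.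
move=> mf f0 Ef; apply/integrableP; split; first exact/measurable_EFinP.
apply: (@le_lt_trans _ _ e%:E); last exact: ltry.
apply: le_trans Ef; rewrite unlock le_eqVlt; apply/orP; left; apply/eqP.
by apply: eq_integral => w _ /=; rewrite ger0_norm.
Qed.

Lemma L1_le f g : measurable_fun [set: T] f -> L1 g ->
  (forall w, `|f w| <= g w) -> L1 f.
Proof.
move=> mf Lg fg; apply: (le_integrable measurableT _ _ Lg).
  exact/measurable_EFinP.
by move=> w _ /=; rewrite lee_fin (le_trans (fg w))// ler_norm.
Qed.

Lemma L1_cst (c : R) : L1 (fun=> c).
Proof. exact: finite_measure_integrable_cst. Qed.

Lemma L1_measurable f : L1 f -> measurable_fun [set: T] f.
Proof. by move=> /integrableP[/measurable_EFinP]. Qed.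

Lemma L1D f g : L1 f -> L1 g -> L1 (fun w => f w + g w).
Proof. exact: integrableD. Qed.

Lemma L1Zl (c : R) f : L1 f -> L1 (fun w => c * f w).
Proof. exact: integrableZl. Qed.

Lemma L1_expectation_fin f : L1 f -> 'E_P[f]%E = (fine 'E_P[f])%:E.
Proof. by move=> Lf; rewrite fineK// unlock integrable_fin_num. Qed.

Lemma expectation_lincomb (I : finType) (c e : I -> R) (F : I -> T -> R) :
  (forall i, L1 (F i)) -> (forall i, 'E_P[F i]%E = (e i)%:E) ->
  ('E_P[fun w => (\sum_i c i * F i w)%R] = (\sum_i c i * e i)%:E)%E.
Proof.
move=> LF EF; rewrite unlock.
under eq_integral do rewrite -sumEFin.
rewrite integral_sum//; last by move=> i; exact: (L1Zl (c i) (LF i)).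
rewrite -sumEFin; apply: eq_bigr => i _.
under eq_integral do rewrite EFinM.
rewrite integralZl//; last exact: LF.
by have := EF i; rewrite unlock => ->; rewrite EFinM.
Qed.

Lemma L1_le_expectation f g : L1 f -> L1 g -> (forall w, f w <= g w) ->
  ('E_P[f] <= 'E_P[g])%E.
Proof.
move=> Lf Lg fg; rewrite unlock; apply: le_integral => //.
by move=> w _; rewrite /= lee_fin.
Qed.

Lemma independent_pair_comp f g (h k : R -> R) : independent_pair P f g ->
  measurable_fun [set: R] h -> measurable_fun [set: R] k ->
  independent_pair P (h \o f) (k \o g).
Proof.
move=> fg mh mk A B mA mB; apply: (fg (h @^-1` A) (k @^-1` B)).
  by rewrite -[X in measurable X]setTI; exact: mh.
by rewrite -[X in measurable X]setTI; exact: mk.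
Qed.

(** [expectationM_ge0] covers nonnegative factors only, so f and g are split into positive and
    negative parts. The four products recombine with signs, and the two parts of f having equal
    means makes them cancel. *)
Lemma indep_prod_centered f g : L1 f -> L1 g -> independent_pair P f g ->
  'E_P[f]%E = 0%E -> L1 (fun w => f w * g w) /\ 'E_P[fun w => (f w * g w)%R]%E = 0%E.
Proof.
move=> Lf Lg fg Ef0.
have mf := L1_measurable Lf; have mg := L1_measurable Lg.
pose h (s : bool) (x : R) := if s then Num.max x 0 else Num.max (- x) 0.
have mh s : measurable_fun [set: R] (h s).
  case: s; rewrite /h; apply: measurable_maxr => //.
have h0 s x : 0 <= h s x by rewrite /h; case: s; rewrite le_max lexx orbT.
have hx s x : `|h s x| <= `|x|.
  rewrite ger0_norm// /h; case: s; rewrite ge_max normr_ge0 andbT ?ler_norm//.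
  by rewrite -normrN ler_norm.
have hB x : x = h true x - h false x.
  by rewrite /h; case: (leP x 0) => h1; case: (leP (- x) 0) => h2; lra.
have Lh s (k : T -> R) : L1 k -> L1 (h s \o k).
  move=> Lk; apply: (@L1_le _ (fun w => `|k w|)).
  - by apply: measurableT_comp => //; exact: L1_measurable.
  - exact: (integrable_abse Lk).
  - by move=> w; exact: hx.
clearbody h.
pose F (p : bool * bool) w := h p.1 (f w) * h p.2 (g w).
have EF p : ('E_P[F p] = (fine 'E_P[h p.1 \o f] * fine 'E_P[h p.2 \o g])%:E)%E.
  rewrite /F expectationM_ge0//.
  - by rewrite EFinM -!L1_expectation_fin//; exact: Lh.
  - exact: measurableT_comp.
  - exact: measurableT_comp.
  - exact: independent_pair_comp.
have mF p : measurable_fun [set: T] (F p).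
  by apply: measurable_funM; exact: measurableT_comp.
have LF p : L1 (F p).
  apply: (ge0_L1 (mF p)); first by move=> w; rewrite /F mulr_ge0.
  by rewrite EF.
pose c (p : bool * bool) : R := (-1) ^+ (~~ p.1) * (-1) ^+ (~~ p.2).
have fgE : (fun w => f w * g w) = (fun w => \sum_p c p * F p w).
  apply/funext => w; rewrite -(pair_bigA _ (fun s t => c (s, t) * F (s, t) w))/=.
  rewrite !big_bool/= /c /F/=; have := hB (f w); have := hB (g w).
  by move: (h true (f w)) (h false (f w)) (h true (g w)) (h false (g w)) => a b a' b' -> ->; ring.
split.
  rewrite fgE /L1 (_ : EFin \o _ = (fun w => \sum_p (c p * F p w)%:E)%E); last first.
    by apply/funext => w /=; rewrite -sumEFin.
  by apply: integrable_sum => // p _; exact: L1Zl (LF p).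
have := expectation_lincomb c LF EF; rewrite -fgE => ->.
have : (fine 'E_P[h true \o f]%E = fine 'E_P[h false \o f]%E).
  have := @expectation_lincomb bool (fun s => (-1) ^+ (~~ s)) (fun s => fine 'E_P[h s \o f]%E) (fun s => h s \o f) (fun s => Lh s _ Lf) (fun s => L1_expectation_fin (Lh s _ Lf)).
  rewrite (_ : (fun w => _) = f); last first.
    by apply/funext => w; rewrite big_bool/= {3}(hB (f w)) expr0 expr1; ring.
  by rewrite Ef0 big_bool/= expr0 expr1 => -[]; lra.
move=> hE; congr EFin.
rewrite -(pair_bigA _ (fun s t => c (s, t) * (fine 'E_P[h s \o f]%E * fine 'E_P[h t \o g]%E)))/=.
rewrite !big_bool/= /c/= hE; ring.
Qed.

End Integrability.

(** A comparison of first-order terms at s = 0, carried out at the single point s = m / D instead of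
    in a limit. It provides the centring of the noise, which [subgaussian1] implies without stating
    it. *)
Lemma linear_le_gaussian_eq0 {R : realType} (m c : R) : 0 <= c ->
  (forall s, 1 + s * m <= expR (s ^+ 2 * c)) -> m = 0.
Proof.
move=> c0 H.
have e2 (t : R) : 0 <= t -> t <= 1 / 2 -> expR t <= 1 + 2 * t.
  move=> t0 t1; have := expR_ge1Dx (- t); rewrite expRN => h.
  have := ler_wpM2r (expR_ge0 t) h; rewrite mulVf ?gt_eqF ?expR_gt0// => h2.
  have : 1 + 2 * t - expR t >= 0; last lra.
  have : 0 < 1 - t by lra.
  by move=> h3; rewrite -(pmulr_rge0 _ h3); nra.
(* D is large enough for s^2 c <= 1 / 2, where exp is at most 1 + 2 x, and for the resulting m^2 D
   <= 2 c m^2 to force m = 0, as D >= 2 c + 1. *)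
pose D := 2 * (1 + c) * (1 + m ^+ 2).
have m2 : 0 <= m ^+ 2 := sqr_ge0 m.
have cm : 0 <= c * m ^+ 2 by rewrite mulr_ge0.
have D2 : 2 <= D by rewrite /D; lra.
have Dc : 2 * c + 1 <= D by rewrite /D; lra.
have Dcm : 2 * (c * m ^+ 2) <= D by rewrite /D; lra.
have D0 : 0 < D by lra.
have hs : (m / D) ^+ 2 * c * D ^+ 2 = c * m ^+ 2 by rewrite expr_div_n; field; lra.
have s0 : 0 <= (m / D) ^+ 2 * c by rewrite mulr_ge0 ?sqr_ge0.
have sh : (m / D) ^+ 2 * c <= 1 / 2.
  have : (m / D) ^+ 2 * c * D ^+ 2 <= 1 / 2 * D ^+ 2 by rewrite hs; nra.
  by rewrite ler_pM2r// exprn_gt0.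
have := le_trans (H (m / D)) (e2 _ s0 sh).
have -> : m / D * m = m ^+ 2 / D by rewrite expr2; ring.
move=> h; have : m ^+ 2 / D * D ^+ 2 <= 2 * (c * m ^+ 2).
  by rewrite -hs mulrA ler_pM2r ?exprn_gt0//; lra.
have -> : m ^+ 2 / D * D ^+ 2 = m ^+ 2 * D by field; lra.
move=> h2; apply/eqP; rewrite -sqrf_eq0; apply/eqP; nra.
Qed.

(** * Linear and quadratic forms in the noise *)

Section RandomVectors.
Context {disp : measure_display} {T : measurableType disp} {R : realType}.
Variables (P : probability T R) (n d : nat).
Variable xi : 'I_n -> {RV P >-> borel_cV R d}.
Hypothesis indep_xi : mutually_independent P xi.
Hypothesis iso_xi : forall i, isotropic P (xi i).
Hypothesis subg_xi : forall i, subgaussian1 P (xi i).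
Implicit Types v : 'cV[R]_d.

Lemma measurable_coord (a : 'I_d) :
  measurable_fun [set: borel_cV R d] (fun u : borel_cV R d => (u : 'cV[R]_d) a 0).
Proof.
apply: (measurability _ (RGenOpens.measurableE R)).
move=> _ [_ [x [y ->] <-]]; rewrite setTI; apply: sub_sigma_algebra.
have := @coord_continuous R d 1 a 0.
by move=> /continuousP; apply; exact: interval_open.
Qed.

Lemma measurable_dotp v :
  measurable_fun [set: borel_cV R d] (fun u : borel_cV R d => dotp v (u : 'cV[R]_d)).
Proof.
apply: measurable_sum => a; apply: measurable_funM => //; exact: measurable_coord.
Qed.

Definition noise_proj v j (w : T) : R := dotp v (xi j w : 'cV[R]_d).

Lemma measurable_xi j : measurable_fun [set: T] (xi j).
Proof. exact: measurable_funPT. Qed.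

Lemma measurable_proj v j : measurable_fun [set: T] (noise_proj v j).
Proof. exact: measurableT_comp (measurable_dotp v) (measurable_xi j). Qed.

Lemma cyl_measurable_proj v (J : {set 'I_n}) j : j \in J ->
  cyl_measurable (fun j => xi j : T -> _) J (noise_proj v j).
Proof. move=> jJ; exact: cyl_measurable_comp jJ (measurable_dotp v). Qed.

Lemma L1_coordM j (a b : 'I_d) :
  L1 P (fun w => (xi j w : 'cV[R]_d) a 0 * (xi j w : 'cV[R]_d) b 0).
Proof.
have mc e : measurable_fun [set: T] (fun w => (xi j w : 'cV[R]_d) e 0).
  exact: measurableT_comp (measurable_coord e) (measurable_xi j).
have L2 e : L1 P (fun w => (xi j w : 'cV[R]_d) e 0 ^+ 2).
  apply: (@ge0_L1 _ _ _ _ _ 1).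
  - exact: measurable_funX.
  - by move=> w; exact: sqr_ge0.
  - by have := iso_xi j e e; rewrite eqxx => <-; rewrite le_eqVlt; apply/orP; left; apply/eqP; congr expectation.
apply: L1_le (L1D (L2 a) (L2 b)) _.
  exact: measurable_funM.
move=> w; set x := (xi j w : 'cV[R]_d) a 0; set y := (xi j w : 'cV[R]_d) b 0.
by rewrite normrM -(real_normK (num_real x)) -(real_normK (num_real y)); nra.
Qed.

Lemma proj_sqrE v j : (fun w => noise_proj v j w ^+ 2) =
  (fun w => \sum_(p : 'I_d * 'I_d) (v p.1 0 * v p.2 0) *
    ((xi j w : 'cV[R]_d) p.1 0 * (xi j w : 'cV[R]_d) p.2 0)).
Proof.
apply/funext => w; rewrite /noise_proj /dotp expr2 big_distrlr/= pair_bigA/=.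
by apply: eq_bigr => p _; rewrite mulrACA.
Qed.

Lemma L1_bigsum (I : finType) (c : I -> R) (F : I -> T -> R) :
  (forall i, L1 P (F i)) -> L1 P (fun w => \sum_i c i * F i w).
Proof.
move=> LF; rewrite /L1 (_ : EFin \o _ = (fun w => \sum_i (c i * F i w)%:E)%E); last first.
  by apply/funext => w /=; rewrite -sumEFin.
by apply: integrable_sum => // p _; exact: L1Zl (LF p).
Qed.

Lemma L1_proj_sqr v j : L1 P (fun w => noise_proj v j w ^+ 2).
Proof. by rewrite proj_sqrE; apply: L1_bigsum => p; exact: L1_coordM. Qed.

Lemma expectation_proj_sqr v j : 'E_P[fun w => (noise_proj v j w ^+ 2)%R]%E = (dotp v v)%:E.
Proof.
rewrite proj_sqrE (@expectation_lincomb _ _ _ _ _ _ (fun p => (p.1 == p.2)%:R)); last 2 first.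
- by move=> p; exact: L1_coordM.
- by move=> p; exact: iso_xi.
congr EFin; rewrite -(pair_bigA _ (fun a b => v a 0 * v b 0 * (a == b)%:R))/=.
apply: eq_bigr => a _; rewrite (bigD1 a)//= eqxx mulr1 big1 ?addr0// => b ab.
by rewrite eq_sym (negbTE ab) mulr0.
Qed.

Lemma L1_proj v j : L1 P (noise_proj v j).
Proof.
apply: L1_le (L1D (L1_cst P 1) (L1_proj_sqr v j)) _; first exact: measurable_proj.
by move=> w; rewrite -(real_normK (num_real (noise_proj v j w))); have := normr_ge0 (noise_proj v j w); nra.
Qed.

Lemma expectation_expR_proj v j (s : R) :
  ('E_P[fun w => expR (s * noise_proj v j w)%R] <= (expR (s ^+ 2 * dotp v v / 2))%:E)%E.
Proof.
have := subg_xi j (s *: v); rewrite norm2_sqr dotpZl dotpZr mulrA -expr2.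
rewrite (_ : (fun w => expR (dotp _ _)) = (fun w => expR (s * noise_proj v j w)))//.
by apply/funext => w; rewrite dotpZl.
Qed.

Lemma expectation_proj v j : 'E_P[noise_proj v j]%E = 0%E.
Proof.
have Lp := L1_proj v j.
rewrite (L1_expectation_fin Lp); congr EFin.
apply: (@linear_le_gaussian_eq0 _ _ (dotp v v / 2)).
  by rewrite divr_ge0 ?dotp_ge0.
move=> s; rewrite -lee_fin mulrA; apply: le_trans (expectation_expR_proj v j s).
have ms : measurable_fun [set: T] (fun w => expR (s * noise_proj v j w)).
  exact: measurable_expRZ (measurable_proj v j).
have Ls : L1 P (fun w => expR (s * noise_proj v j w)).
  by apply: ge0_L1 ms _ (expectation_expR_proj v j s) => w; exact: expR_ge0.
have := @expectation_lincomb _ _ _ P bool (fun b => if b then 1 else s)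
  (fun b => if b then 1 else fine 'E_P[noise_proj v j]%E)
  (fun b => if b then cst 1 else noise_proj v j).
have LF b : L1 P (if b then cst 1 else noise_proj v j) by case: b => //; exact: L1_cst.
have EF b : expectation P (if b then cst 1 else noise_proj v j) = (if b then 1 else fine 'E_P[noise_proj v j]%E)%:E.
  by case: b; [rewrite expectation_cst|exact: L1_expectation_fin].
move=> /(_ LF EF); rewrite big_bool/= mulr1 => <-.
apply: L1_le_expectation => //.
  by apply: L1_bigsum.
by move=> w; rewrite big_bool/= mulr1 expR_ge1Dx.
Qed.

Lemma proj_independent v i j : i != j -> independent_pair P (noise_proj v i) (noise_proj v j).
Proof.
move=> ij; apply: (@cyl_independent _ _ _ _ _ _ P (fun j => xi j : T -> _) measurable_xi indep_xi (finset.set1 i) (finset.set1 j)).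
- by move=> k; rewrite !inE => /eqP ->.
- by apply: cyl_measurable_proj; rewrite inE.
- by apply: cyl_measurable_proj; rewrite inE.
Qed.

(** The value must be exact, since [subgaussian_bernstein] subtracts the second moment; the cross
    terms vanish by independence and centring. *)
Lemma expectation_lincomb_sqr v (c : 'I_n -> R) :
  'E_P[fun w => ((\sum_j c j * noise_proj v j w) ^+ 2)%R]%E = (dotp v v * \sum_j c j ^+ 2)%:E.
Proof.
have ij_prod (p : 'I_n * 'I_n) : L1 P (fun w => noise_proj v p.1 w * noise_proj v p.2 w) /\
    'E_P[fun w => (noise_proj v p.1 w * noise_proj v p.2 w)%R]%E = ((p.1 == p.2)%:R * dotp v v)%:E.
  case: p => i j /=; have [<-|ij] := eqVneq i j.
    by rewrite mul1r -(expectation_proj_sqr v i); split => //; exact: L1_proj_sqr.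
  rewrite mul0r; apply: indep_prod_centered; [exact: L1_proj..|exact: proj_independent|exact: expectation_proj].
rewrite (_ : (fun w => _) = (fun w => \sum_(p : 'I_n * 'I_n) (c p.1 * c p.2) * (noise_proj v p.1 w * noise_proj v p.2 w))); last first.
  apply/funext => w; rewrite expr2 big_distrlr/= pair_bigA/=.
  by apply: eq_bigr => p _; rewrite mulrACA.
rewrite (expectation_lincomb _ (fun p => (ij_prod p).1) (fun p => (ij_prod p).2)).
congr EFin; rewrite -(pair_bigA _ (fun a b => c a * c b * ((a == b)%:R * dotp v v)))/= mulr_sumr.
apply: eq_bigr => a _; rewrite (bigD1 a)//= eqxx mul1r big1 ?addr0 1?mulrC// => b ab.
by rewrite eq_sym (negbTE ab) mul0r mulr0.
Qed.

Lemma expectation_expR_lincomb v (c : 'I_n -> R) :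
  ('E_P[fun w => expR (\sum_j c j * noise_proj v j w)%R] <=
   (expR (dotp v v * (\sum_j c j ^+ 2) / 2))%:E)%E.
Proof.
rewrite (_ : (fun w => _) = (fun w => \prod_j expR (c j * noise_proj v j w))); last first.
  by apply/funext => w; rewrite expR_sum.
rewrite (@expectation_prod_blocks _ _ _ _ _ _ P (fun j => xi j : T -> _) measurable_xi indep_xi _ _ (fun j => finset.set1 j)).
- rewrite (_ : (expR _)%:E = (\prod_j (expR (c j ^+ 2 * dotp v v / 2))%:E)%E); last first.
    by rewrite prodEFin -expR_sum -!mulr_suml [dotp v v * _]mulrC.
  have : forall j, (0 <= 'E_P[fun w => expR (c j * noise_proj v j w)%R] <= (expR (c j ^+ 2 * dotp v v / 2))%:E)%E.
    move=> j; rewrite expectation_expR_proj andbT; apply: expectation_ge0 => w; exact: expR_ge0.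
  move=> H; suff /andP[] : (0 <= \prod_j 'E_P[fun w => expR (c j * noise_proj v j w)%R] <=
    \prod_j (expR (c j ^+ 2 * dotp v v / 2))%:E)%E by [].
  elim/big_ind2 : _ => //; first by rewrite lexx lee_fin ler01.
  move=> x1 x2 y1 y2 /andP[h1 h2] /andP[h3 h4]; rewrite mule_ge0//=; exact: lee_pmul.
- exact: index_enum_uniq.
- by move=> i j _ _ ij k; rewrite !inE => /eqP ->.
- move=> j; have := @cyl_measurable_proj v (finset.set1 j) j; rewrite inE => /(_ (eqxx _)) m.
  exact: measurable_expRZ m.
- by move=> j w; exact: expR_ge0.
Qed.

(** The normalisation of c gives every block sum variance |v|^2 <= 1 and makes it sub-Gaussian;
    disjoint blocks are independent, so the l Bernstein bounds multiply. *)
Lemma expectation_expR_quadratic v (l : nat) (J : 'I_l -> {set 'I_n}) (c s : R) :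
  (forall i k, i != k -> {in J i, forall j, j \notin J k}) ->
  (forall i, c ^+ 2 * #|J i|%:R = 1) -> dotp v v <= 1 -> `|s| <= 1 / 16 ->
  ('E_P[fun w => expR (s * \sum_(i < l) ((\sum_(j in J i) c * noise_proj v j w) ^+ 2 - dotp v v))%R]
    <= (expR (l%:R * (3072 * expR 1 ^+ 2 * s ^+ 2)))%:E)%E.
Proof.
move=> dJ cJ v1 s1.
pose g i w := \sum_(j in J i) c * noise_proj v j w.
have gE i : g i = (fun w => \sum_j (if j \in J i then c else 0) * noise_proj v j w).
  apply/funext => w; rewrite /g big_mkcond/=; apply: eq_bigr => j _.
  by case: ifP; rewrite ?mul0r.
have sumc i : \sum_j (if j \in J i then c else 0) ^+ 2 = 1.
  rewrite -(cJ i) mulr_natr -sumr_const [RHS]big_mkcond/=.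
  by apply: eq_bigr => j _; case: ifP; rewrite ?expr0n.
have cg i : cyl_measurable (fun j => xi j : T -> _) (J i) (g i).
  rewrite /g /cyl_measurable (_ : (fun w => _) = (fun w => \sum_(j <- enum (J i)) c * (if j \in J i then noise_proj v j w else 0))); last first.
    by apply/funext => w; rewrite big_enum/=; apply: eq_bigr => j ->.
  apply: measurable_sum => j; apply: measurable_funM => //.
  by case: (boolP (j \in J i)) => jJ; [exact: cyl_measurable_proj|exact: measurable_cst].
have mg i : measurable_fun [set: T] (g i).
  exact: cyl_measurableW measurable_xi _ _ (cg i).
have sg i : subgaussian P (g i).
  move=> t; rewrite gE.
  rewrite (_ : (fun w => _) = (fun w => expR (\sum_j (t * (if j \in J i then c else 0)) * noise_proj v j w))); last first.
    by apply/funext => w; rewrite mulr_sumr; congr expR; apply: eq_bigr => j _; rewrite mulrA.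
  apply: le_trans (expectation_expR_lincomb _ _) _; rewrite lee_fin ler_expR.
  under eq_bigr do rewrite exprMn.
  by rewrite -mulr_sumr sumc mulr1; have := sqr_ge0 t; nra.
have g2 i : 'E_P[fun w => (g i w ^+ 2)%R]%E = (dotp v v)%:E.
  by rewrite gE expectation_lincomb_sqr sumc mulr1.
have v01 : 0 <= dotp v v <= 1 by rewrite dotp_ge0.
rewrite (_ : (fun w => _) = (fun w => \prod_(i < l) expR (s * (g i w ^+ 2 - dotp v v)))); last first.
  by apply/funext => w; rewrite mulr_sumr expR_sum.
rewrite (@expectation_prod_blocks _ _ _ _ _ _ P (fun j => xi j : T -> _) measurable_xi indep_xi _ _ J).
- rewrite (_ : (expR _)%:E = (\prod_(i < l) (expR (3072 * expR 1 ^+ 2 * s ^+ 2))%:E)%E); last first.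
    rewrite prodEFin -expR_sum sumr_const card_ord; congr (expR _)%:E; exact: mulr_natl.
  have H i : (0 <= 'E_P[fun w => expR (s * (g i w ^+ 2 - dotp v v))%R] <= (expR (3072 * expR 1 ^+ 2 * s ^+ 2))%:E)%E.
    rewrite subgaussian_bernstein// andbT; apply: expectation_ge0 => w; exact: expR_ge0.
  suff /andP[] : (0 <= \prod_(i < l) 'E_P[fun w => expR (s * (g i w ^+ 2 - dotp v v))%R] <=
    \prod_(i < l) (expR (3072 * expR 1 ^+ 2 * s ^+ 2))%:E)%E by [].
  elim/big_ind2 : _ => //; first by rewrite lexx lee_fin ler01.
  move=> x1 x2 y1 y2 /andP[h1 h2] /andP[h3 h4]; rewrite mule_ge0//=; exact: lee_pmul.
- exact: index_enum_uniq.
- by move=> i k _ _ ik; exact: dJ.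
- move=> i; apply: measurableT_comp; first exact: measurable_expR.
  apply: measurable_funM => //; apply: measurable_funB => //; apply: measurable_funX; exact: cg.
- by move=> j w; exact: expR_ge0.
Qed.

End RandomVectors.

(** * Tail bounds and the net *)

Section UnionBound.
Context {disp : measure_display} {T : measurableType disp} {R : realType}.
Variable P : probability T R.

Lemma union_bound (I : finType) (Q : pred I) (A : I -> set T) (e : R) :
  (forall i, measurable (A i)) -> (forall i, Q i -> (P (A i) <= e%:E)%E) -> 0 <= e ->
  (P (\big[setU/set0]_(i | Q i) A i) <= (#|Q|%:R * e)%:E)%E.
Proof.
move=> mA PA e0.
have H : measurable (\big[setU/set0]_(i | Q i) A i) /\
    (P (\big[setU/set0]_(i | Q i) A i) <= \sum_(i | Q i) e%:E)%E.
  apply: (big_ind2 (fun (B : set T) (b : \bar R) => measurable B /\ (P B <= b)%E)).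
  - by rewrite measure0.
  - move=> B b C c [mB hB] [mC hC]; split; first exact: measurableU.
    by apply: le_trans (measureU2 _ mB mC) _; apply: leeD.
  - by move=> i Qi; split => //; exact: PA.
apply: le_trans H.2 _.
by rewrite sumEFin sumr_const mulr_natl.
Qed.

Lemma abs_tail (S : T -> R) (t e : R) : measurable_fun [set: T] S ->
  (P [set w | t <= S w]%R <= e%:E)%E -> (P [set w | t <= - S w]%R <= e%:E)%E ->
  (P [set w | t <= `|S w|]%R <= (2 * e)%:E)%E.
Proof.
move=> mS h1 h2.
have m1 : measurable [set w | t <= S w].
  by rewrite -[X in measurable X]setTI; exact: measurable_fun_le.
have m2 : measurable [set w | t <= - S w].
  rewrite -[X in measurable X]setTI; apply: measurable_fun_le => //.
  exact: measurableT_comp.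
have -> : [set w | t <= `|S w|] = [set w | t <= S w] `|` [set w | t <= - S w].
  apply/seteqP; split => w /=; rewrite ler_normr.
    by move=> /orP[]; [left|right].
  by move=> [->|->]; rewrite ?orbT.
apply: le_trans (measureU2 _ m1 m2) _.
rewrite mulr2n mulrDl mul1r EFinD; exact: leeD.
Qed.

End UnionBound.

Section Tails.
Context {disp : measure_display} {T : measurableType disp} {R : realType}.
Variables (P : probability T R) (n d : nat).
Variable xi : 'I_n -> {RV P >-> borel_cV R d}.
Hypothesis indep_xi : mutually_independent P xi.
Hypothesis iso_xi : forall i, isotropic P (xi i).
Hypothesis subg_xi : forall i, subgaussian1 P (xi i).
Implicit Types v : 'cV[R]_d.

(* The exponent 19 d in the tails beats the e^(18 d) points of the net and
   leaves e^(- d). *)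
Definition quad_const : R := 16 * (12 * expR 1 ^+ 2 + 19).

Definition block_quadratic (l : nat) (J : 'I_l -> {set 'I_n}) (c : R) v (w : T) : R :=
  \sum_(i < l) ((\sum_(j in J i) c * noise_proj xi v j w) ^+ 2 - dotp v v).

Lemma measurable_block_quadratic (l : nat) (J : 'I_l -> {set 'I_n}) c v :
  measurable_fun [set: T] (block_quadratic J c v).
Proof.
apply: measurable_sum => i; apply: measurable_funB => //; apply: measurable_funX.
rewrite (_ : (fun w => _) = (fun w => \sum_(j <- enum (J i)) c * noise_proj xi v j w)); last first.
  by apply/funext => w; rewrite big_enum.
apply: measurable_sum => j; apply: measurable_funM => //; exact: measurable_proj.
Qed.

(** Chernoff at r / 16 with r = sqrt (d / l). The hypothesis d <= l keeps this within the range of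
    the Bernstein bound, whose exponent becomes 12 e^2 d because 3072 = 12 * 16^2; since r sqrt (d
    l) = d, the factor [quad_const] leaves 19 d. *)
Lemma block_quadratic_tail v (l : nat) (J : 'I_l -> {set 'I_n}) (c : R) :
  (0 < d)%N -> (d <= l)%N ->
  (forall i k, i != k -> {in J i, forall j, j \notin J k}) ->
  (forall i, c ^+ 2 * #|J i|%:R = 1) -> dotp v v <= 1 ->
  (P [set w | quad_const * Num.sqrt (d%:R * l%:R) <= `|block_quadratic J c v w|]%R
    <= (2 * expR (- (19 * d%:R)))%:E)%E.
Proof.
move=> d0 dl dJ cJ v1.
have dR : 0 < d%:R :> R by rewrite ltr0n.
have lR : 0 < l%:R :> R by rewrite ltr0n (leq_trans d0).
have dlR : d%:R <= l%:R :> R by rewrite ler_nat.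
pose r : R := Num.sqrt (d%:R / l%:R).
have r0 : 0 < r by rewrite sqrtr_gt0 divr_gt0.
have r2 : r ^+ 2 = d%:R / l%:R by rewrite sqr_sqrtr// divr_ge0// ltW.
have r1 : r <= 1.
  rewrite -(@ler_pXn2r _ 2)// ?nnegrE ?(ltW r0)// r2 expr1n ler_pdivrMr// mul1r//.
have rt : r * Num.sqrt (d%:R * l%:R) = d%:R.
  rewrite /r -sqrtrM ?divr_ge0 ?ltW//.
  rewrite (_ : d%:R / l%:R * _ = d%:R ^+ 2); last by field; lra.
  by rewrite sqrtr_sqr ger0_norm// ltW.
have mS := measurable_block_quadratic J c v.
have key (s : R) : s = 1 \/ s = -1 ->
    (P [set w | quad_const * Num.sqrt (d%:R * l%:R) <= s * block_quadratic J c v w]%R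
      <= (expR (- (19 * d%:R)))%:E)%E.
  move=> s1.
  have s2 : s ^+ 2 = 1 by case: s1 => ->; rewrite ?sqrrN expr1n.
  have r16 : 0 < r / 16 by rewrite divr_gt0.
  have H : ('E_P[fun w => expR (r / 16 * (s * block_quadratic J c v w))%R] <=
      (expR (12 * expR 1 ^+ 2 * d%:R))%:E)%E.
    rewrite (_ : (fun w => _) = (fun w => expR ((r / 16 * s) * block_quadratic J c v w))); last first.
      by apply/funext => w; rewrite mulrA.
    apply: le_trans (expectation_expR_quadratic indep_xi iso_xi subg_xi dJ cJ v1 _) _.
      have -> : `|r / 16 * s| = r / 16.
        by rewrite normrM (gtr0_norm r16); case: s1 => ->; rewrite ?normrN normr1 mulr1.
      by rewrite ler_wpM2r// invr_ge0.
    rewrite lee_fin ler_expR exprMn s2 mulr1 expr_div_n r2 le_eqVlt; apply/orP; left; apply/eqP.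
    by field; lra.
  have ms : measurable_fun [set: T] (fun w => s * block_quadratic J c v w).
    exact: measurable_funM.
  apply: le_trans (@expectation_chernoff _ _ _ P _ _ _ _ ms r16 H) _.
  rewrite lee_fin ler_expR /quad_const.
  set q := Num.sqrt _ in rt *; set e2 := expR 1 ^+ 2.
  rewrite (_ : r / 16 * (16 * (12 * e2 + 19) * q) = (12 * e2 + 19) * (r * q)); last by field.
  by rewrite rt; lra.
apply: abs_tail => //.
  by have := key 1 (or_introl erefl); under eq_fun do rewrite mul1r.
by have := key (-1) (or_intror erefl); under eq_fun do rewrite mulN1r.
Qed.

(** Chernoff at r = sqrt (d / n), where the exponential moment is at most exp d; hence 20 = 19 +
    1. *)
Lemma lincomb_tail v (c : 'I_n -> R) : (0 < d)%N -> (0 < n)%N ->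
  (forall j, `|c j| <= 1) -> dotp v v <= 1 ->
  (P [set w | 20 * Num.sqrt (d%:R * n%:R) <= `|\sum_j c j * noise_proj xi v j w|]%R
    <= (2 * expR (- (19 * d%:R)))%:E)%E.
Proof.
move=> d0 n0 c1 v1.
have dR : 0 < d%:R :> R by rewrite ltr0n.
have nR : 0 < n%:R :> R by rewrite ltr0n.
pose r : R := Num.sqrt (d%:R / n%:R).
have r0 : 0 < r by rewrite sqrtr_gt0 divr_gt0.
have r2 : r ^+ 2 = d%:R / n%:R by rewrite sqr_sqrtr// divr_ge0// ltW.
have rt : r * Num.sqrt (d%:R * n%:R) = d%:R.
  rewrite /r -sqrtrM ?divr_ge0 ?ltW//.
  rewrite (_ : d%:R / n%:R * _ = d%:R ^+ 2); last by field; lra.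
  by rewrite sqrtr_sqr ger0_norm// ltW.
have mS : measurable_fun [set: T] (fun w => \sum_j c j * noise_proj xi v j w).
  by apply: measurable_sum => j; apply: measurable_funM => //; exact: measurable_proj.
have key (s : R) : s = 1 \/ s = -1 ->
    (P [set w | 20 * Num.sqrt (d%:R * n%:R) <= s * \sum_j c j * noise_proj xi v j w]%R
      <= (expR (- (19 * d%:R)))%:E)%E.
  move=> s1.
  have s2 : s ^+ 2 = 1 by case: s1 => ->; rewrite ?sqrrN expr1n.
  have H : ('E_P[fun w => expR (r * (s * \sum_j c j * noise_proj xi v j w))%R] <=
      (expR (d%:R))%:E)%E.
    rewrite (_ : (fun w => _) = (fun w => expR (\sum_j (r * s * c j) * noise_proj xi v j w))); last first.
      by apply/funext => w; rewrite mulrA mulr_sumr; congr expR; apply: eq_bigr => j _; rewrite mulrA.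
    apply: le_trans (expectation_expR_lincomb indep_xi subg_xi _ _) _.
    rewrite lee_fin ler_expR.
    have h1 : \sum_j (r * s * c j) ^+ 2 <= d%:R.
      apply: (@le_trans _ _ (\sum_(j < n) d%:R / n%:R)).
        apply: ler_sum => j _; rewrite !exprMn s2 mulr1 r2 ler_piMr ?divr_ge0//.
        by rewrite -(real_normK (num_real (c j))) expr_le1.
      by rewrite sumr_const card_ord -[_ *+ n]mulr_natr divfK// gt_eqF.
    have h2 : 0 <= \sum_j (r * s * c j) ^+ 2 by apply: sumr_ge0 => j _; exact: sqr_ge0.
    by have := dotp_ge0 v; nra.
  have ms : measurable_fun [set: T] (fun w => s * \sum_j c j * noise_proj xi v j w).
    exact: measurable_funM.
  apply: le_trans (@expectation_chernoff _ _ _ P _ _ _ _ ms r0 H) _.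
  rewrite lee_fin ler_expR.
  rewrite (_ : r * (20 * _) = 20 * (r * Num.sqrt (d%:R * n%:R))); last by ring.
  by rewrite rt; lra.
apply: abs_tail => //.
  by have := key 1 (or_introl erefl); under eq_fun do rewrite mul1r.
by have := key (-1) (or_intror erefl); under eq_fun do rewrite mulN1r.
Qed.

End Tails.

(** * A quarter-net of the Euclidean unit ball *)

Section Net.
Context {R : realType} {d : nat}.

(* A point of the net has coordinates +-z_i / (4 sqrt d) with z_i natural and
   norm at most 1; the boolean is the sign. *)
Definition net_index := {ffun 'I_d -> bool * 'I_(4 * d).+1}.

Definition net_point (f : net_index) : 'cV[R]_d :=
  \col_i ((-1) ^+ (f i).1 * ((f i).2 : nat)%:R / (4 * Num.sqrt d%:R)).

Definition net_mem (f : net_index) : bool := dotp (net_point f) (net_point f) <= 1.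

Lemma dotp_net_point (f : net_index) : dotp (net_point f) (net_point f) =
  (\sum_i ((f i).2 : nat)%:R ^+ 2) / (16 * d%:R).
Proof.
rewrite mulr_suml; apply: eq_bigr => i _; rewrite mxE -expr2 !exprMn exprVn.
rewrite -exprM mulnC exprM sqrrN expr1n expr1n mul1r exprMn sqr_sqrtr//.
by congr (_ / _); congr (_ * _); ring.
Qed.

(** Each coordinate is rounded towards 0, so the net point stays in the unit ball. The error per
    coordinate is at most 1 / (4 sqrt d), and the d squares add up to 1 / 16. The range 4 d of the
    indices suffices because 4 sqrt d <= 4 d. *)
Lemma net_approx (v : 'cV[R]_d) : (0 < d)%N -> dotp v v <= 1 ->
  exists f, net_mem f /\ dotp (v - net_point f) (v - net_point f) <= 1 / 16.
Proof.
move=> d0 v1.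
have dR : 0 < d%:R :> R by rewrite ltr0n.
pose s : R := 4 * Num.sqrt d%:R.
have s0 : 0 < s by rewrite mulr_gt0// sqrtr_gt0.
have s2 : s ^+ 2 = 16 * d%:R by rewrite exprMn sqr_sqrtr//; congr (_ * _); ring.
pose m i := Num.truncn (s * `|v i 0|).
have mv i : (m i)%:R <= s * `|v i 0| < (m i).+1%:R.
  by apply: truncn_itv; rewrite mulr_ge0// ltW.
have vi i : `|v i 0| <= 1.
  rewrite -(@ler_pXn2r _ 2)// ?nnegrE// expr1n real_normK ?num_real//.
  apply: le_trans v1; rewrite /dotp (bigD1 i)//= -expr2 lerDl.
  by apply: sumr_ge0 => j _; rewrite -expr2 sqr_ge0.
have md i : (m i < (4 * d).+1)%N.
  rewrite ltnS -(ler_nat R); have /andP[h _] := mv i.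
  apply: le_trans h _; apply: (@le_trans _ _ s); first by rewrite ler_piMr// ltW.
  rewrite natrM /s ler_pM2l// -(@ler_pXn2r _ 2)// ?nnegrE ?sqrtr_ge0//.
  rewrite sqr_sqrtr; last exact: ltW.
  by rewrite expr2 ler_peMr ?ler1n//; exact: ltW.
pose f : net_index := [ffun i => (v i 0 < 0, Ordinal (md i))].
have fE i : net_point f i 0 = (-1) ^+ (v i 0 < 0)%R * (m i)%:R / s.
  by rewrite mxE ffunE.
have vE i : v i 0 = (-1) ^+ (v i 0 < 0)%R * `|v i 0| by exact: numEsign.
exists f; split.
  rewrite /net_mem; apply: le_trans v1; apply: ler_sum => i _.
  rewrite fE -!expr2 -[leRHS]real_normK ?num_real// expr_div_n exprMn.
  rewrite -exprM mulnC exprM sqrrN !expr1n mul1r ler_pdivrMr ?exprn_gt0//.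
  have /andP[h _] := mv i.
  by rewrite -exprMn ler_pXn2r// ?nnegrE ?mulr_ge0 ?(ltW s0)// mulrC.
apply: (@le_trans _ _ (\sum_(i < d) (1 / s) ^+ 2)); last first.
  rewrite sumr_const card_ord expr_div_n s2 expr1n -mulr_natr le_eqVlt.
  by apply/orP; left; apply/eqP; field; lra.
apply: ler_sum => i _; rewrite -expr2 mxE [in leLHS]mxE fE.
rewrite {1}(vE i) -mulrA -mulrBr exprMn -exprM mulnC exprM sqrrN !expr1n mul1r.
have /andP[h1 h2] := mv i; rewrite -[(m i).+1%:R]natr1 in h2.
have h3 : 0 <= `|v i 0| - (m i)%:R / s by rewrite subr_ge0 ler_pdivrMr// mulrC.
rewrite ler_pXn2r// ?nnegrE ?divr_ge0 ?(ltW s0)//.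
rewrite ler_pdivlMr// mulrBl divfK ?gt_eqF//; lra.
Qed.

(** At a net point the sum of the z_i is at most that of the z_i^2, hence at most 16 d, so the
    product over i of 2^(16 - z_i) is at least 1. Summed over all index functions this weight
    factorises; each coordinate gives at most 2^16 times 2 for the sign and 2 for the geometric
    series, and 2^18 <= e^18. *)
Lemma net_card : (0 < d)%N -> (#|net_mem|%:R : R) <= expR (18 * d%:R).
Proof.
move=> d0.
have dR : 0 < d%:R :> R by rewrite ltr0n.
pose q : R := 2 ^+ 16.
have q0 : 0 < q by rewrite exprn_gt0.
pose F (p : bool * 'I_(4 * d).+1) : R := q * 2^-1 ^+ (p.2 : nat).
have F0 p : 0 <= F p by rewrite mulr_ge0 ?exprn_ge0 ?invr_ge0// ltW.
apply: (@le_trans _ _ (\sum_(f : net_index) \prod_(i < d) F (f i))).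
  rewrite -sum1_card natr_sum big_mkcond/=; apply: ler_sum => f _.
  case: ifP => [|_]; last by apply: prodr_ge0 => i _; exact: F0.
  rewrite unfold_in /net_mem dotp_net_point ler_pdivrMr ?mulr_gt0// mul1r => fm.
  have h1 : (\sum_i ((f i).2 : nat) <= 16 * d)%N.
    rewrite -(ler_nat R) natrM; apply: le_trans fm; rewrite natr_sum.
    apply: ler_sum => i _; rewrite -natrX ler_nat; case: (nat_of_ord _) => // k.
    by rewrite leq_pmulr.
  rewrite /F big_split/= prodr_const card_ord -exprM -expr_sum.
  rewrite exprVn ler_pdivlMr ?exprn_gt0// mul1r.
  by rewrite ler_eXn2l ?ltr1n.
rewrite -(bigA_distr_bigA (fun _ p => F p))/=.
apply: (@le_trans _ _ (\prod_(i < d) expR 18)); last first.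
  by rewrite prodr_const card_ord expRM_natr.
apply: ler_prod => i _; rewrite sumr_ge0//=.
apply: (@le_trans _ _ (q * 4)).
  rewrite -(pair_bigA _ (fun b m => F (b, m)))/= big_bool/= /F/=.
  have h : \sum_(m < (4 * d).+1) 2^-1 ^+ m <= (2 : R).
    have := @geometric_le_lim R (4 * d).+1 1 2^-1 ler01.
    rewrite /series/= big_mkord => h; apply: (@le_trans _ _ (\sum_(m < (4 * d).+1) 1 * 2^-1 ^+ m)).
      by apply: ler_sum => m _; rewrite mul1r.
    apply: le_trans (h _ _) _; [lra|rewrite ger0_norm; lra|].
    by rewrite (_ : 1 / (1 - 2^-1) = 2 :> R)//; field.
  by rewrite -mulr_sumr; nra.
have e1 : 2 <= expR 1 :> R by have := expR_ge1Dx (1 : R); lra.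
have -> : expR 18 = expR 1 ^+ 18 :> R by rewrite -expRM_natr mul1r.
rewrite (_ : q * 4 = 2 ^+ 18); last by rewrite /q; ring.
by rewrite ler_pXn2r ?nnegrE ?expR_ge0.
Qed.

End Net.

(** * The switching chain *)

Section Patterns.
Context {disp : measure_display} {T : measurableType disp} {R : realType}.
Variables (P : probability T R) (n : nat).
Variable eta : 'I_n -> {RV P >-> R}.
Hypothesis eta_sign : forall i w, eta i w = 1 \/ eta i w = -1.

Definition sgn (b : bool) : R := if b then 1 else -1.

Definition pattern (w : T) : {ffun 'I_n -> bool} := [ffun i => eta i w == 1].

Lemma sgn_inj : injective sgn.
Proof. by move=> [] [] //=; rewrite /sgn => h; exfalso; lra. Qed.

Lemma eta_pattern i w : eta i w = sgn (pattern w i).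
Proof.
rewrite ffunE /sgn; case: eqP => // h.
by case: (eta_sign i w).
Qed.

Lemma pattern_eqP w e : pattern w = e <-> forall i, eta i w = sgn (e i).
Proof.
split => [<- i|H]; first exact: eta_pattern.
by apply/ffunP => i; apply: sgn_inj; rewrite -eta_pattern H.
Qed.

Definition pattern_set (e : {ffun 'I_n -> bool}) : set T := [set w | pattern w = e].

Lemma pattern_setE e :
  pattern_set e = \bigcap_(i in [set: 'I_n]) (eta i @^-1` [set sgn (e i)]).
Proof.
apply/seteqP; split => w.
  by move=> /pattern_eqP H i _; exact: H.
by move=> H; apply/pattern_eqP => i; exact: H.
Qed.

Lemma pattern_set_sigma e : sigma_of (fun i => eta i : T -> R) (pattern_set e).
Proof.
rewrite pattern_setE.
apply: (@fin_bigcap_measurable _ (g_sigma_algebraType (\bigcup_(i in [set: 'I_n]) preimage_set_system [set: T] (eta i : T -> R) measurable)) 'I_n) => // i _.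
apply: sub_sigma_algebra; exists i => //; exists [set sgn (e i)] => //.
by rewrite setTI.
Qed.

Lemma measurable_pattern_set e : measurable (pattern_set e).
Proof.
rewrite pattern_setE; apply: fin_bigcap_measurable => // i _.
Qed.

Lemma pattern_cover (B : {ffun 'I_n -> bool} -> set T) :
  [set w | B (pattern w) w] = \big[setU/set0]_e (pattern_set e `&` B e).
Proof.
apply/seteqP; split => w.
  by move=> h; rewrite (bigD1 (pattern w))//=; left.
apply: (big_ind (fun A : set T => A w -> B (pattern w) w)) => //.
  by move=> A C hA hC [].
by move=> e _ [] /= ->.
Qed.

Lemma measurable_pattern_event (B : {ffun 'I_n -> bool} -> set T) :
  (forall e, measurable (B e)) -> measurable [set w | B (pattern w) w].
Proof.
move=> mB; rewrite pattern_cover; apply: bigsetU_measurable => e _.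
by apply: measurableI => //; exact: measurable_pattern_set.
Qed.

Lemma pattern_sum (A : {ffun 'I_n -> bool} -> set T) :
  (forall e, measurable (A e)) -> (forall e, A e `<=` pattern_set e) ->
  (P (\big[setU/set0]_e A e) = \sum_e P (A e))%E.
Proof.
move=> mA Ae; have : uniq (index_enum {ffun 'I_n -> bool}) := index_enum_uniq _.
elim: (index_enum _) => [|e s IH]; first by rewrite !big_nil measure0.
move=> /andP[es us]; rewrite !big_cons measureU//.
- by congr (_ + _)%E; exact: IH.
- by apply: bigsetU_measurable => e' _.
- rewrite -subset0 => w [/Ae we]; have {}we : pattern w = e := we; rewrite big_seq.
  apply: (big_ind (fun B : set T => B w -> False)) => //.
    by move=> B C hB hC [].
  by move=> e' e's /Ae we'; move: es; rewrite -we (we' : pattern w = e') e's.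
Qed.

(** Conditioning on the signs by hand: the event splits over the finitely many patterns, each
    independent of its B e, and the weights P (pattern_set e) add up to at most 1. *)
Lemma pattern_bound (B : {ffun 'I_n -> bool} -> set T) (q : R) : 0 <= q ->
  (forall e, measurable (B e)) ->
  (forall e, P (pattern_set e `&` B e) = (P (pattern_set e) * P (B e))%E) ->
  (forall e, (P (B e) <= q%:E)%E) -> (P [set w | B (pattern w) w] <= q%:E)%E.
Proof.
move=> q0 mB iB qB; rewrite pattern_cover pattern_sum; last 2 first.
- by move=> e; apply: measurableI => //; exact: measurable_pattern_set.
- by move=> e; exact: subIsetl.
apply: (@le_trans _ _ (\sum_e P (pattern_set e) * q%:E)%E).
  by apply: lee_sum => e _; rewrite iB; apply: lee_wpmul2l.
rewrite -ge0_sume_distrl//.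
rewrite -(pattern_sum measurable_pattern_set)//; last by move=> e.
apply: (@le_trans _ _ (1 * q%:E)%E); last by rewrite mul1e.
by rewrite lee_wpmul2r// probability_le1//; apply: bigsetU_measurable => e _; exact: measurable_pattern_set.
Qed.

End Patterns.

(** * The law of the chain and its number of flips *)

Section SwitchingChain.
Context {disp : measure_display} {T : measurableType disp} {R : realType}.
Variables (P : probability T R) (m : nat) (delta : R).
Variable eta : 'I_m.+1 -> {RV P >-> R}.
Hypothesis chain : switching_chain P delta eta.
Hypothesis delta01 : 0 <= delta <= 1.

Let eta_sign i w : eta i w = 1 \/ eta i w = -1.
Proof. by case: chain => H _ _; exact: H. Qed.

Definition flips (e : {ffun 'I_m.+1 -> bool}) : nat :=
  \sum_(i < m) (e (widen_ord (leqnSn m) i) (+) e (lift ord0 i) : nat).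

Definition flip_prob (b : bool) : R := if b then delta else 1 - delta.

Lemma pattern_prob_prefix (e : {ffun 'I_m.+1 -> bool}) (j : nat) : (j <= m)%N ->
  P [set w | forall k : 'I_m.+1, (k <= j)%N -> eta k w = sgn (e k)] =
  (2^-1 * \prod_(i < j) flip_prob (e (inord i) (+) e (inord i.+1)))%:E.
Proof.
case: chain => _ H0 HS.
elim: j => [|j IH] jm.
  rewrite big_ord0 mulr1; have [h1 h2] := H0 ord0 erefl.
  have -> : [set w | forall k : 'I_m.+1, (k <= 0)%N -> eta k w = sgn (e k)] =
      [set w | eta ord0 w = sgn (e ord0)].
    apply/seteqP; split => w /= H; first exact: H.
    by move=> k; rewrite leqn0 => /eqP k0; have -> : k = ord0 by exact: val_inj.
  by rewrite /sgn; case: (e ord0).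
have vj : (inord j : 'I_m.+1) = j :> nat by rewrite inordK// ltnS ltnW.
have vj1 : (inord j.+1 : 'I_m.+1) = j.+1 :> nat by rewrite inordK// ltnS.
have := HS (inord j) (inord j.+1) _ (fun k => sgn (e k)).
rewrite vj vj1 => /(_ erefl) -> //; last by move=> k; rewrite /sgn; case: (e k); [left|right].
rewrite IH; last exact: ltnW.
rewrite big_ord_recr/= mulrA [RHS]EFinM; congr (_ * _%:E)%E.
rewrite (inj_eq sgn_inj) /flip_prob.
by case: (e (inord j)); case: (e (inord j.+1)).
Qed.

Lemma pattern_prob (e : {ffun 'I_m.+1 -> bool}) : P (pattern_set eta e) =
  (2^-1 * \prod_(i < m) flip_prob (e (widen_ord (leqnSn m) i) (+) e (lift ord0 i)))%:E.
Proof.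
have := pattern_prob_prefix e (leqnn m).
rewrite (_ : [set w | _] = pattern_set eta e); last first.
  apply/seteqP; split => w /=.
    by move=> H; apply/(pattern_eqP eta_sign) => i; apply: H; rewrite -ltnS.
  by move=> /(pattern_eqP eta_sign) H k _.
move=> ->; congr (_ * _)%:E; apply: eq_bigr => i _; congr (flip_prob (e _ (+) e _)).
  by apply: val_inj; rewrite /= inordK// ltnS ltnW.
by apply: val_inj; rewrite /= inordK// ltnS.
Qed.

(** Change of variables from a pattern to its first sign and its flips, in which the probability of
    a pattern is a product over coordinates. As an injective self-map of a finite type it can be
    used to reindex sums. *)
Definition increments (e : {ffun 'I_m.+1 -> bool}) : {ffun 'I_m.+1 -> bool} :=
  [ffun k : 'I_m.+1 => if k == 0%N :> nat then e ord0 else e (inord k.-1) (+) e k].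

Lemma increments_inj : injective increments.
Proof.
move=> e e' /ffunP H.
have key (k : nat) : (k <= m)%N -> e (inord k) = e' (inord k).
  elim: k => [|k IH] km.
    by have := H ord0; rewrite !ffunE/= (_ : inord 0 = ord0)//; apply: val_inj; rewrite /= inordK.
  have := H (inord k.+1); rewrite !ffunE inordK// /= IH; last exact: ltnW.
  exact: addbI.
by apply/ffunP => k; have := key k; rewrite inord_val; apply; rewrite -ltnS.
Qed.

Lemma sum_patterns (h : bool -> R) :
  \sum_(e : {ffun 'I_m.+1 -> bool}) \prod_(i < m) h (e (widen_ord (leqnSn m) i) (+) e (lift ord0 i))
  = 2 * (h true + h false) ^+ m.
Proof.
pose H (k : 'I_m.+1) b := if k == 0%N :> nat then 1 else h b.
transitivity (\sum_(e : {ffun 'I_m.+1 -> bool}) \prod_(k < m.+1) H k (increments e k)).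
  apply: eq_bigr => e _; rewrite big_ord_recl /H/= mul1r.
  apply: eq_bigr => i _; rewrite ffunE/=; congr (h (e _ (+) _)).
  by apply: val_inj; rewrite /= inordK add0n// ltnS ltnW.
rewrite -(reindex_inj increments_inj (P := predT) (F := fun f : {ffun 'I_m.+1 -> bool} => \prod_k H k (f k)))/=.
rewrite -(bigA_distr_bigA (fun k b => H k b))/= big_ord_recl.
rewrite big_bool /H/=; congr (_ * _).
transitivity (\prod_(i < m) (h true + h false)); last by rewrite prodr_const card_ord.
by apply: eq_bigr => i _; rewrite big_bool.
Qed.

(** Chernoff at parameter 1: the exponential moment of the number of flips is (1 + (e - 1) delta)^m,
    at most exp (3 delta m) since e <= 4. *)
Lemma flips_tail (a : R) :
  (P [set w | 3 * (m%:R * delta) + a <= (flips (pattern eta w))%:R]%R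
    <= (expR (- a))%:E)%E.
Proof.
have /andP[de0 de1] := delta01.
pose t := 3 * (m%:R * delta) + a.
pose B (e : {ffun 'I_m.+1 -> bool}) : set T := if t <= (flips e)%:R then setT else set0.
have -> : [set w | t <= (flips (pattern eta w))%:R] = [set w | B (pattern eta w) w].
  by apply/seteqP; split => w /=; rewrite /B; case: ifP.
rewrite pattern_cover (pattern_sum (eta := eta)); last 2 first.
- move=> e; apply: measurableI; first exact: measurable_pattern_set.
  by rewrite /B; case: ifP.
- by move=> e; exact: subIsetl.
have fp0 b : 0 <= flip_prob b by case: b; rewrite /flip_prob; lra.
pose h b := flip_prob b * expR (b : nat)%:R.
apply: (@le_trans _ _ (\sum_(e : {ffun 'I_m.+1 -> bool}) (expR (- t) * (2^-1 * \prod_(i < m) h (e (widen_ord (leqnSn m) i) (+) e (lift ord0 i))))%:E)%E).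
  apply: lee_sum => e _.
  have p0 : 0 <= 2^-1 * \prod_(i < m) flip_prob (e (widen_ord (leqnSn m) i) (+) e (lift ord0 i)).
    by rewrite mulr_ge0 ?invr_ge0// prodr_ge0.
  rewrite /h big_split/= -expR_sum -natr_sum -/(flips e).
  rewrite /B; case: ifP => ht; last first.
    by rewrite setI0 measure0 lee_fin !(mulr_ge0, expR_ge0, prodr_ge0, invr_ge0).
  rewrite setIT pattern_prob lee_fin.
  rewrite (_ : expR (- t) * _ = 2^-1 * \prod_(i < m) flip_prob (e (widen_ord (leqnSn m) i) (+) e (lift ord0 i)) * expR ((flips e)%:R - t)); last by rewrite expRD; ring.
  apply: ler_peMr => //; apply: le_trans (expR_ge1Dx _); lra.
rewrite sumEFin -!mulr_sumr sum_patterns lee_fin mulKf//.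
have e3 : expR 1 <= 4 :> R.
  have := expR_ge1Dx (- (1 / 2) : R).
  have : expR (- (1 / 2)) ^+ 2 * expR 1 = 1 :> R.
    by rewrite expr2 -!expRD (_ : _ + _ = 0) ?expR0//; field.
  move=> h1 h2; have : 0 <= (expR (- (1 / 2)) ^+ 2 - 1 / 4) * expR 1 :> R.
    by rewrite mulr_ge0 ?expR_ge0//; nra.
  by rewrite mulrBl h1; lra.
have hb : h true + h false <= expR (3 * delta).
  rewrite /h /flip_prob/= expR0; apply: le_trans (expR_ge1Dx _); nra.
have h0 : 0 <= h true + h false by rewrite addr_ge0// mulr_ge0 ?expR_ge0.
apply: (@le_trans _ _ (expR (- t) * expR (3 * delta) ^+ m)).
  by apply: ler_wpM2l; rewrite ?expR_ge0//; apply: lerXn2r; rewrite ?nnegrE ?expR_ge0.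
by rewrite -expRM_natr -expRD ler_expR /t; lra.
Qed.

End SwitchingChain.

(** * Spectral perturbation *)

Section Perturbation.
Context {R : realType} {d : nat}.
Implicit Types (x y u v w : 'cV[R]_d) (S W : 'M[R]_d).

Lemma sym_dotp W x y : W^T = W -> dotp x (W *m y) = dotp y (W *m x).
Proof. by move=> sW; rewrite dotp_trmx sW dotpC. Qed.

Lemma polarization_bound W (q : R) : W^T = W -> 0 <= q ->
  (forall x, `|dotp x (W *m x)| <= q * dotp x x) ->
  forall x y, `|dotp x (W *m y)| <= q * (norm2 x * norm2 y).
Proof.
move=> sW q0 Wq.
have key x y : `|dotp x (W *m y)| <= q / 2 * (dotp x x + dotp y y).
  have h1 := Wq (x + y); have h2 := Wq (x - y).
  move: h1 h2; rewrite !mulmxDr !mulmxN !(dotpDl, dotpDr, dotpNl, dotpNr) (dotpC y x) (sym_dotp y x sW).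
  rewrite !ler_norml => /andP[h1 h2] /andP[h3 h4]; apply/andP; split; lra.
move=> x y.
have [->|x0] := eqVneq x 0; first by rewrite dotp0l normr0 !mulr_ge0 ?norm2_ge0.
have [->|y0] := eqVneq y 0; first by rewrite mulmx0 dotp0r normr0 !mulr_ge0 ?norm2_ge0.
have nx : 0 < norm2 x := norm2_gt0 x0.
have ny : 0 < norm2 y := norm2_gt0 y0.
have := key ((norm2 x)^-1 *: x) ((norm2 y)^-1 *: y).
rewrite -!norm2_sqr !norm2_unit// -scalemxAr dotpZl dotpZr mulrA normrM.
rewrite ger0_norm ?mulr_ge0 ?invr_ge0 ?norm2_ge0// -invfM ler_pdivrMl ?mulr_gt0// => h.
by apply: le_trans h _; rewrite expr1n; lra.
Qed.

(** At a net point near h / |h| one finds |h| <= t + |h| / 4. *)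
Lemma net_linear (h : 'cV[R]_d) (t : R) : (0 < d)%N ->
  (forall f : net_index, @net_mem R d f -> `|dotp (net_point f) h| <= t) ->
  forall x, `|dotp x h| <= 2 * t * norm2 x.
Proof.
move=> d0 H x.
have t0 : 0 <= t.
  have [|f [fm _]] := @net_approx R d 0 d0; first by rewrite dotp0l.
  exact: le_trans (H f fm).
have hh : norm2 h <= 2 * t.
  have [->|h0] := eqVneq h 0; first by rewrite norm2_0 mulr_ge0.
  pose v := (norm2 h)^-1 *: h.
  have nv : norm2 v = 1 := norm2_unit h0.
  have [|f [fm fv]] := @net_approx R d v d0; first by rewrite -norm2_sqr nv expr1n.
  have nvp : norm2 (v - net_point f) <= 1 / 4 by apply: norm2_le => //; lra.
  have vh : dotp v h = norm2 h.
    by rewrite dotpZl -norm2_sqr expr2 mulKf// gt_eqF// norm2_gt0.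
  have := dotp_le (v - net_point f) h; rewrite dotpDl dotpNl vh ler_norml => /andP[_ h1].
  have := H f fm; rewrite ler_norml => /andP[_ h2].
  have := ler_wpM2r (norm2_ge0 h) nvp; lra.
apply: le_trans (dotp_le _ _) _; rewrite mulrC ler_wpM2r ?norm2_ge0//.
Qed.

(** Let q be the supremum over unit vectors. For p in the net near v, symmetry gives <v, W v> - <p,
    W p> = <v - p, W (v + p)>, at most q * (1 / 4) * 2; hence q <= t + q / 2. *)
Lemma net_quadratic W (t : R) : (0 < d)%N -> W^T = W ->
  (forall f : net_index, @net_mem R d f -> `|dotp (net_point f) (W *m net_point f)| <= t) ->
  forall x, `|dotp x (W *m x)| <= 2 * t * dotp x x.
Proof.
move=> d0 sW H.
have t0 : 0 <= t.
  have [|f [fm _]] := @net_approx R d 0 d0; first by rewrite dotp0l.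
  exact: le_trans (H f fm).
have [c c0 Wc] := mulmx_norm2_bound W.
have bnd x : dotp x x = 1 -> `|dotp x (W *m x)| <= 1 + c.
  move=> x1; have := dotp_sqr_le x (W *m x); rewrite x1 mul1r => h1.
  have := Wc x; rewrite x1 mulr1 => h2.
  have := real_normK (num_real (dotp x (W *m x))); have := normr_ge0 (dotp x (W *m x)); nra.
pose E := [set r | exists2 x, dotp x x = 1 & r = `|dotp x (W *m x)|].
have [E0|/nonemptyPn E0] := pselect (E !=set0); last first.
  move=> x; have [->|x0] := eqVneq x 0; first by rewrite mulmx0 !dotp0r normr0 mulr0.
  exfalso; have : E `|dotp ((norm2 x)^-1 *: x) (W *m ((norm2 x)^-1 *: x))|.
    by exists ((norm2 x)^-1 *: x) => //; rewrite -norm2_sqr norm2_unit// expr1n.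
  by rewrite E0.
have Eub : has_ubound E by exists (1 + c) => _ [x x1 ->]; exact: bnd.
set q := sup E.
have q0 : 0 <= q by have [r [x x1 rE]] := E0; apply: le_trans (ub_le_sup Eub (ex_intro2 _ _ x x1 rE)); rewrite rE.
have qW x : `|dotp x (W *m x)| <= q * dotp x x.
  have [->|x0] := eqVneq x 0; first by rewrite mulmx0 !dotp0r normr0 mulr0.
  have nx : 0 < norm2 x := norm2_gt0 x0.
  have : `|dotp ((norm2 x)^-1 *: x) (W *m ((norm2 x)^-1 *: x))| <= q.
    by apply: ub_le_sup => //; exists ((norm2 x)^-1 *: x) => //; rewrite -norm2_sqr norm2_unit// expr1n.
  rewrite -scalemxAr dotpZl dotpZr mulrA -expr2 -norm2_sqr normrM ger0_norm ?sqr_ge0// exprVn.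
  by rewrite ler_pdivrMl ?exprn_gt0// mulrC.
have qB := polarization_bound sW q0 qW.
have qt : q <= 2 * t.
  suff : q <= t + q / 2 by lra.
  apply: ge_sup => // _ [v v1 ->].
  have [|f [fm fv]] := @net_approx R d v d0; first by rewrite v1.
  set p := net_point f in fv *.
  have nv : norm2 v <= 1 by apply: norm2_le; rewrite ?v1 ?expr1n.
  have np : norm2 p <= 1 by apply: norm2_le; rewrite ?expr1n.
  have nvp : norm2 (v - p) <= 1 / 4 by apply: norm2_le => //; lra.
  have e : dotp v (W *m v) = dotp p (W *m p) + dotp (v - p) (W *m (v + p)).
    by rewrite mulmxDr !(dotpDl, dotpDr, dotpNl) (sym_dotp v p sW); ring.
  rewrite e; apply: le_trans (ler_normD _ _) _; apply: lerD; first exact: H.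
  apply: le_trans (qB _ _) _.
  have nvp2 : norm2 (v + p) <= 2 by apply: le_trans (norm2D _ _) _; lra.
  have : norm2 (v - p) * norm2 (v + p) <= 1 / 4 * 2 by apply: ler_pM; rewrite ?norm2_ge0.
  by move=> /(ler_wpM2l q0); lra.
by move=> x; apply: le_trans (qW x) _; rewrite ler_wpM2r ?dotp_ge0.
Qed.

(* With m = lambda_max S - kappa, the eigenvector equation reads
   m v = <u, v> u + r with |r| <= A, and m >= |u|^2 - A. *)
Lemma spectral_perturbation S (kappa A : R) u v : (0 < d)%N -> S^T = S -> 0 < A ->
  (forall x y, `|dotp x (S *m y) - kappa * dotp x y - dotp u x * dotp u y| <= A * (norm2 x * norm2 y)) ->
  S *m v = lambda_max S *: v -> norm2 v = 1 ->
  loss (Num.sqrt (Num.max (lambda_max S - kappa) 0) *: v) u ^+ 2 * Num.max A (norm2 u ^+ 2) <= 72 * A ^+ 2.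
Proof.
move=> d0 sS A0 HA Sv v1.
set lam := lambda_max S in Sv *; set mu := lam - kappa; set U := norm2 u ^+ 2.
have vv : dotp v v = 1 by rewrite -norm2_sqr v1 expr1n.
have mu_up : `|mu - dotp u v ^+ 2| <= A.
  have := HA v v; rewrite Sv dotpZr vv !mulr1 v1 !mulr1 -expr2.
  by rewrite /mu.
have uv : dotp u v ^+ 2 <= U by have := dotp_sqr_le u v; rewrite vv mulr1 -norm2_sqr.
have U0 : 0 <= U by exact: sqr_ge0.
have mu_lo : u != 0 -> U - A <= mu.
  move=> u0; have nu : 0 < U.
    by rewrite /U exprn_gt0// norm2_gt0.
  have := HA u u; rewrite -!norm2_sqr -/U -!expr2 -/U => h.
  have := rayleigh_le u sS; rewrite -/lam -norm2_sqr -/U => h2.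
  have : (U - A) * U <= mu * U by move: h; rewrite ler_norml /mu => /andP[h3 _]; lra.
  by rewrite ler_pM2r.
(* Weak signal: both vectors have squared norm of order A, so the trivial bound on the loss gives 18
   A * 4 A. Otherwise U > 4 A, and the eigenvalue bound gives mu >= 3 U / 4. *)
have [hU|hU] := leP U (4 * A).
  have hm : Num.max mu 0 <= 5 * A.
    by rewrite ge_max; move: mu_up; rewrite ler_norml => /andP[_ h]; apply/andP; split; lra.
  have m0 : 0 <= Num.max mu 0 by rewrite le_max lexx orbT.
  set th := _ *: v.
  have th2 : norm2 th ^+ 2 <= 5 * A.
    by rewrite norm2Z v1 mulr1 real_normK ?num_real// sqr_sqrtr.
  have hl := loss_le_norm2D th u; have l0 := loss_ge0 th u.
  have l2 : loss th u ^+ 2 <= 18 * A.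
    have := norm2_ge0 th; have := norm2_ge0 u => n1 n2.
    have : loss th u ^+ 2 <= (norm2 th + norm2 u) ^+ 2 by rewrite ler_pXn2r// ?nnegrE// addr_ge0.
    have := sqr_ge0 (norm2 th - norm2 u); rewrite /U in hU *; lra.
  have hM : Num.max A U <= 4 * A by rewrite ge_max hU andbT; lra.
  have M0 : 0 <= Num.max A U by rewrite le_max U0 orbT.
  apply: (@le_trans _ _ (18 * A * (4 * A))); last by rewrite expr2; lra.
  by apply: ler_pM => //; exact: sqr_ge0.
have u0 : u != 0.
  by apply: contraTneq hU => u0; rewrite /U u0 norm2_0 expr0n/= -leNgt; lra.
have {}mu_lo := mu_lo u0.
have mu0 : 0 < mu by lra.
have -> : Num.max mu 0 = mu by apply/max_idPl; exact: ltW.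
have -> : Num.max A U = U by apply/max_idPr; lra.
pose s := Num.sqrt mu.
have s0 : 0 < s by rewrite sqrtr_gt0.
have s2 : s ^+ 2 = mu by rewrite sqr_sqrtr// ltW.
(* The sign of an eigenvector is arbitrary and the loss does not see it, so v may be turned to make
   <u, v> nonnegative. *)
have [v' [lv' [Sv' v'1 c0]]] : exists v', loss (s *: v') u = loss (s *: v) u /\
    [/\ S *m v' = lam *: v', norm2 v' = 1 & 0 <= dotp u v'].
  have [c0|c0] := leP 0 (dotp u v); first by exists v.
  exists (- v); split; first by rewrite scalerN lossNl.
  by split; rewrite ?mulmxN ?Sv ?scalerN ?norm2N// dotpNr oppr_ge0 ltW.
rewrite -/s -lv'.
have vv' : dotp v' v' = 1 by rewrite -norm2_sqr v'1 expr1n.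
set c := dotp u v' in c0.
have mu_c : `|mu - c ^+ 2| <= A.
  have := HA v' v'; rewrite Sv' dotpZr vv' !mulr1 v'1 !mulr1 -expr2.
  by rewrite /mu.
pose r := mu *: v' - c *: u.
have rA : norm2 r <= A.
  have h := HA r v'.
  have e : dotp r (S *m v') - kappa * dotp r v' - dotp u r * dotp u v' = norm2 r ^+ 2.
    have rr : dotp r r = mu * dotp r v' - c * dotp u r.
      by rewrite (dotpC u r) -!dotpZr -dotpNr -dotpDr.
    rewrite Sv' dotpZr norm2_sqr rr -/c /mu; ring.
  move: h; rewrite e v'1 mulr1 ger0_norm ?sqr_ge0// expr2.
  have [->|nr] := eqVneq (norm2 r) 0; first by move=> _; exact: ltW.
  by rewrite ler_pM2r// lt_def nr norm2_ge0.
pose w := s *: v' - u.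
have sw : s *: w = r + (c - s) *: u.
  by rewrite /w /r -s2; apply/matrixP => i j; rewrite !mxE; ring.
(* By c >= 0, the left side is at most |c - s| (c + s) = |c^2 - mu|. *)
have e1 : `|c - s| * s <= A.
  apply: le_trans mu_c; rewrite -s2 distrC subr_sqr normrM.
  by rewrite (ger0_norm (addr_ge0 (ltW s0) c0)); apply: ler_wpM2l => //; rewrite lerDl.
have n1 : s * norm2 w <= A + `|c - s| * norm2 u.
  have -> : s * norm2 w = norm2 (r + (c - s) *: u) by rewrite -sw norm2Z (gtr0_norm s0).
  apply: le_trans (norm2D _ _) _.
  by rewrite norm2Z lerD2r.
have n2 : mu * norm2 w <= A * (s + norm2 u).
  rewrite -s2 expr2 -mulrA; have := norm2_ge0 u => nu.
  have := ler_wpM2l (ltW s0) n1; have := ler_wpM2r nu e1; lra.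
have w0 := norm2_ge0 w.
have n3 : mu * (norm2 w ^+ 2 * mu) <= mu * (5 * A ^+ 2).
  have h1 : (mu * norm2 w) ^+ 2 <= (A * (s + norm2 u)) ^+ 2.
    rewrite ler_pXn2r// ?nnegrE; first by rewrite mulr_ge0// ltW.
    by rewrite mulr_ge0 ?addr_ge0 ?norm2_ge0 ?ltW.
  have h2 : (s + norm2 u) ^+ 2 <= 2 * mu + 2 * U.
    by rewrite -s2 /U; have := sqr_ge0 (s - norm2 u); lra.
  have h3 : (s + norm2 u) ^+ 2 <= 5 * mu by lra.
  have := ler_wpM2l (sqr_ge0 A) h3; move: h1; rewrite !exprMn; lra.
rewrite ler_pM2l// in n3.
apply: (@le_trans _ _ (norm2 w ^+ 2 * U)).
  rewrite ler_wpM2r// ler_pXn2r// ?nnegrE ?loss_ge0//; exact: loss_le.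
have : norm2 w ^+ 2 * U <= norm2 w ^+ 2 * (2 * mu) by rewrite ler_wpM2l ?sqr_ge0//; lra.
have := sqr_ge0 A; lra.
Qed.

End Perturbation.

(** * Loss at a fixed level *)

Section Blocks.
Variables (n l : nat).
Hypothesis l0 : (0 < l)%N.
Let k := (n %/ l)%N.

Definition block (i : 'I_l) : {set 'I_n} :=
  finset (fun j : 'I_n => (i * k <= j < i.+1 * k)%N).

Lemma mem_block i j : (j \in block i) = (i * k <= j < i.+1 * k)%N.
Proof. by rewrite inE. Qed.

Lemma block_uniq (i i' : 'I_l) (t : nat) : (i * k <= t < i.+1 * k)%N ->
  (i' * k <= t < i'.+1 * k)%N -> i = i'.
Proof.
have H (a b : 'I_l) : (a * k <= t < a.+1 * k)%N -> (b * k <= t < b.+1 * k)%N -> (a <= b)%N.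
  move=> /andP[h1 h2] /andP[h3 h4]; rewrite leqNgt; apply/negP => ab.
  have : (b.+1 * k <= a * k)%N by rewrite leq_mul2r ab orbT.
  by move=> h; have := leq_trans h4 (leq_trans h h1); rewrite ltnn.
by move=> hi hi'; apply/val_inj/eqP; rewrite eqn_leq /= !H.
Qed.

Lemma block_disjoint i i' : i != i' -> {in block i, forall j, j \notin block i'}.
Proof.
move=> ii' j; rewrite !mem_block => h; apply/negP => h'.
by move: ii'; rewrite (block_uniq h h') eqxx.
Qed.

Lemma card_block i : #|block i| = k.
Proof.
have ik : (i.+1 * k <= n)%N.
  by rewrite (leq_trans _ (leq_divM n l))// mulnC leq_mul2l ltn_ord orbT.
have <- : (\sum_(i * k <= j < i.+1 * k) 1 = k)%N.
  by rewrite sum_nat_const_nat muln1 mulSn addnK.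
rewrite (big_nat_widenl _ 0)// (big_nat_widen _ _ n)// big_mkord -sum1_card.
by apply: eq_bigl => j; rewrite mem_block.
Qed.

End Blocks.

Section SigmaHat.
Context {R : realType} {n d l : nat}.
Variables (theta : 'cV[R]_d) (e : {ffun 'I_n -> bool}) (xi : 'I_n -> 'cV[R]_d).
Hypothesis d0 : (0 < d)%N.
Hypothesis dl : (d <= l)%N.
Hypothesis ln : (l <= n)%N.
Let k := (n %/ l)%N.
Let l0 : (0 < l)%N := leq_trans d0 dl.
Let k0 : (0 < k)%N. Proof. by rewrite divn_gt0. Qed.
Let kR : 0 < k%:R :> R. Proof. by rewrite ltr0n. Qed.
Let lR : 0 < l%:R :> R. Proof. by rewrite ltr0n. Qed.

Definition observation (j : 'I_n) : 'cV[R]_d := sgn (e j) *: theta + xi j.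

Definition sign_mean (i : 'I_l) : R := k%:R^-1 * \sum_(j in block n i) sgn (e j).

(** This is rho, the factor by which averaging inside the blocks shrinks |theta|^2. *)
Definition sign_energy : R := l%:R^-1 * \sum_(i < l) sign_mean i ^+ 2.

(** At most one summand is nonzero: the sign mean of the block containing j. The value is 0 for the
    observations left over when l does not divide n. *)
Definition cross_coef (j : 'I_n) : R :=
  \sum_(i < l) if j \in block n i then sign_mean i else 0.

Lemma sum_blocks (F : 'I_l -> 'I_n -> R) :
  \sum_(i < l) \sum_(j in block n i) F i j = \sum_j \sum_(i < l) if j \in block n i then F i j else 0.
Proof.
rewrite exchange_big/=; apply: eq_bigr => i _; rewrite [LHS]big_mkcond/=.
by apply: eq_bigr => j _.
Qed.

Lemma sign_mean_le1 i : `|sign_mean i| <= 1.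
Proof.
rewrite /sign_mean normrM ger0_norm ?invr_ge0// ler_pdivrMl// mulr1.
apply: le_trans (ler_norm_sum _ _ _) _.
rewrite (eq_bigr (fun=> 1)); last by move=> j _; rewrite /sgn; case: (e j); rewrite ?normrN normr1.
by rewrite sumr_const card_block.
Qed.

Lemma cross_coef_le1 j : `|cross_coef j| <= 1.
Proof.
have [[i ij]|H] := pselect (exists i, j \in block n (l := l) i).
  rewrite /cross_coef (bigD1 i)//= ij big1 ?addr0 ?sign_mean_le1// => i' ii'.
  by case: ifPn => // ij'; have /negP := block_disjoint ii' ij'.
rewrite /cross_coef big1 ?normr0// => i _; case: ifPn => // ij.
by exfalso; apply: H; exists i.
Qed.

Lemma sign_energy_ge0 : 0 <= sign_energy.
Proof. by rewrite mulr_ge0 ?invr_ge0// sumr_ge0// => i _; exact: sqr_ge0. Qed.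

Lemma sign_energy_le1 : sign_energy <= 1.
Proof.
rewrite /sign_energy ler_pdivrMl// mulr1.
apply: (@le_trans _ _ (\sum_(i < l) 1)); last by rewrite sumr_const card_ord.
apply: ler_sum => i _; rewrite -real_normK ?num_real// expr_le1//.
exact: sign_mean_le1.
Qed.

Lemma dotp_bucket_mean x (i : 'I_l) : dotp x (bucket_mean observation i) =
  sign_mean i * dotp x theta + k%:R^-1 * \sum_(j in block n i) dotp x (xi j).
Proof.
rewrite /bucket_mean dotpZr dotp_sumr (eq_bigl (fun j => j \in block n i)); last first.
  by move=> j; rewrite mem_block.
rewrite /sign_mean -mulrA -mulrDr; congr (_ * _).
rewrite mulr_suml -big_split/=; apply: eq_bigr => j _.
by rewrite /observation dotpDr dotpZr.
Qed.

Lemma sigma_hat_sym (Y : 'I_n -> 'cV[R]_d) : (sigma_hat Y l)^T = sigma_hat Y l.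
Proof. by rewrite /sigma_hat linearZ/= trmx_mul trmxK. Qed.

Lemma dotp_sigma_hat (Y : 'I_n -> 'cV[R]_d) x y : dotp x (sigma_hat Y l *m y) =
  l%:R^-1 * \sum_(i < l) dotp x (bucket_mean Y i) * dotp y (bucket_mean Y i).
Proof.
rewrite /sigma_hat -scalemxAl dotpZr; congr (_ * _).
rewrite -mulmxA dotp_trmx; apply: eq_bigr => i _; rewrite !mxE.
by congr (_ * _); apply: eq_bigr => a _; rewrite !mxE mulrC.
Qed.

(** For isotropic independent noise the factor 1 / sqrt k gives each inner sum variance |x|^2, which
    is the normalisation that [block_quadratic_tail] asks for. *)
Definition block_form x : R :=
  \sum_(i < l) ((\sum_(j in block n i) (Num.sqrt k%:R)^-1 * dotp x (xi j)) ^+ 2 - dotp x x).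

Definition cross_form x : R := \sum_j cross_coef j * dotp x (xi j).

Lemma sigma_hat_decomposition x :
  dotp x (sigma_hat observation l *m x) - k%:R^-1 * dotp x x - sign_energy * dotp theta x ^+ 2 =
  (l%:R * k%:R)^-1 * (2 * dotp x theta * cross_form x + block_form x).
Proof.
have sk2 : (Num.sqrt k%:R)^-1 ^+ 2 = k%:R^-1 :> R by rewrite exprVn sqr_sqrtr// ltW.
have bE : block_form x = \sum_(i < l) (k%:R^-1 * (\sum_(j in block n i) dotp x (xi j)) ^+ 2 - dotp x x).
  by apply: eq_bigr => i _; rewrite -mulr_sumr exprMn sk2.
have cE : cross_form x = \sum_(i < l) sign_mean i * \sum_(j in block n i) dotp x (xi j).
  rewrite [RHS](eq_bigr (fun i => \sum_(j in block n i) sign_mean i * dotp x (xi j))); last first.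
    by move=> i _; rewrite mulr_sumr.
  rewrite sum_blocks; apply: eq_bigr => j _; rewrite mulr_suml.
  by apply: eq_bigr => i _; case: ifP => _ //; rewrite mul0r.
have lx : l%:R * dotp x x = \sum_(i < l) dotp x x by rewrite sumr_const card_ord mulr_natl.
have -> : k%:R^-1 * dotp x x = l%:R^-1 * (\sum_(i < l) k%:R^-1 * dotp x x).
  by rewrite -mulr_sumr -lx; field; apply/andP; split; rewrite gt_eqF.
have -> : sign_energy * dotp theta x ^+ 2 = l%:R^-1 * \sum_(i < l) sign_mean i ^+ 2 * dotp theta x ^+ 2.
  by rewrite /sign_energy -mulrA mulr_suml.
rewrite dotp_sigma_hat -!mulrBr invfM -[RHS]mulrA; congr (_ * _).
rewrite cE bE [2 * dotp x theta * _]mulr_sumr -big_split/= [RHS]mulr_sumr -!sumrB; apply: eq_bigr => i _.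
rewrite dotp_bucket_mean (dotpC theta x); field.
by rewrite gt_eqF.
Qed.

(** The cross and block forms are realised by a vector h and a symmetric matrix W, so the net bounds
    extend to all x at the price of a factor 2 each. Polarisation then passes from the quadratic
    form of the error matrix to its bilinear form. *)
Lemma sigma_hat_error (A1 A2 : R) :
  (forall f, @net_mem R d f -> `|cross_form (net_point f)| <= A1) ->
  (forall f, @net_mem R d f -> `|block_form (net_point f)| <= A2) ->
  forall x y, `|dotp x (sigma_hat observation l *m y) - k%:R^-1 * dotp x y
     - dotp (Num.sqrt sign_energy *: theta) x * dotp (Num.sqrt sign_energy *: theta) y|
   <= (l%:R * k%:R)^-1 * (4 * norm2 theta * A1 + 2 * A2) * (norm2 x * norm2 y).
Proof.
move=> H1 H2.
have lk0 : 0 < l%:R * k%:R :> R by rewrite mulr_gt0.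
have A10 : 0 <= A1.
  have [|f [fm _]] := @net_approx R d 0 d0; first by rewrite dotp0l.
  exact: le_trans (H1 f fm).
have A20 : 0 <= A2.
  have [|f [fm _]] := @net_approx R d 0 d0; first by rewrite dotp0l.
  exact: le_trans (H2 f fm).
pose h := \sum_j cross_coef j *: xi j.
have hE x : dotp x h = cross_form x.
  by rewrite dotp_sumr; apply: eq_bigr => j _; rewrite dotpZr.
pose z (i : 'I_l) := \sum_(j in block n i) (Num.sqrt k%:R)^-1 *: xi j.
pose W : 'M[R]_d := \sum_(i < l) z i *m (z i)^T - l%:R%:M.
have zzE i x y : dotp x (z i *m (z i)^T *m y) = dotp x (z i) * dotp y (z i).
  rewrite -mulmxA (_ : (z i)^T *m y = (dotp y (z i))%:M).
    by rewrite mul_mx_scalar dotpZr mulrC.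
  apply/matrixP => a b; rewrite !ord1 !mxE eqxx mulr1n; apply: eq_bigr => c _.
  by rewrite mxE mulrC.
have WE x : dotp x (W *m x) = block_form x.
  rewrite /W mulmxBl mulmx_suml dotpDr dotpNr dotp_sumr mul_scalar_mx dotpZr.
  rewrite /block_form sumrB sumr_const card_ord mulr_natl; congr (_ - _).
  apply: eq_bigr => i _; rewrite zzE -expr2; congr (_ ^+ 2).
  by rewrite dotp_sumr; apply: eq_bigr => j _; rewrite dotpZr.
have sW : W^T = W.
  rewrite /W linearB/= tr_scalar_mx linear_sum/=; congr (_ - _).
  by apply: eq_bigr => i _; rewrite trmx_mul trmxK.
have Hl x : `|cross_form x| <= 2 * A1 * norm2 x.
  by rewrite -hE; apply: net_linear => // f fm; rewrite hE H1.
have Hq x : `|block_form x| <= 2 * A2 * dotp x x.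
  by rewrite -WE; apply: net_quadratic => // f fm; rewrite WE H2.
pose E : 'M[R]_d := sigma_hat observation l - k%:R^-1%:M - sign_energy *: (theta *m theta^T).
have ttE x y : dotp x (theta *m theta^T *m y) = dotp theta x * dotp theta y.
  rewrite -mulmxA (_ : theta^T *m y = (dotp theta y)%:M).
    by rewrite mul_mx_scalar dotpZr mulrC (dotpC x).
  apply/matrixP => a b; rewrite !ord1 !mxE eqxx mulr1n; apply: eq_bigr => c _.
  by rewrite mxE.
have EE x y : dotp x (E *m y) = dotp x (sigma_hat observation l *m y) - k%:R^-1 * dotp x y - sign_energy * (dotp theta x * dotp theta y).
  by rewrite /E !mulmxBl !dotpDr !dotpNr mul_scalar_mx -[(sign_energy *: _) *m y]scalemxAl !dotpZr ttE.
have sE : E^T = E.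
  by rewrite /E !linearB/= sigma_hat_sym tr_scalar_mx linearZ/= trmx_mul trmxK.
set q := _ * (_ + _).
have q0 : 0 <= q by rewrite mulr_ge0 ?invr_ge0 ?(ltW lk0)// addr_ge0 ?mulr_ge0 ?norm2_ge0.
have Eq x : `|dotp x (E *m x)| <= q * dotp x x.
  rewrite EE -expr2 sigma_hat_decomposition normrM ger0_norm ?invr_ge0 ?(ltW lk0)//.
  rewrite /q -[leRHS]mulrA; apply: ler_wpM2l; first by rewrite invr_ge0 (ltW lk0).
  apply: le_trans (ler_normD _ _) _; rewrite [leRHS]mulrDl; apply: lerD; last exact: Hq.
  rewrite !normrM ger0_norm// -norm2_sqr.
  have h1 := dotp_le x theta; have h2 := Hl x.
  have := ler_pM (normr_ge0 _) (normr_ge0 _) h1 h2; lra.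
move=> x y; have := polarization_bound sE q0 Eq x y; rewrite EE.
rewrite !dotpZl (_ : Num.sqrt sign_energy * _ * _ = sign_energy * (dotp theta x * dotp theta y))//.
by rewrite mulrACA -expr2 sqr_sqrtr ?sign_energy_ge0.
Qed.

End SigmaHat.

(** * The bias from sign flips inside blocks *)

Section SignEnergy.
Context {R : realType} {m l : nat}.
Variable e : {ffun 'I_m.+1 -> bool}.
Hypothesis l0 : (0 < l)%N.
Hypothesis ln : (l <= m.+1)%N.
Let k := (m.+1 %/ l)%N.
Let k0 : (0 < k)%N. Proof. by rewrite divn_gt0. Qed.

Definition flip_at (t : 'I_m) : bool := e (widen_ord (leqnSn m) t) (+) e (lift ord0 t).

Lemma block_const (i : 'I_l) :
  (forall t : 'I_m, (i * k <= t)%N -> (t.+1 < i.+1 * k)%N -> ~~ flip_at t) ->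
  sign_mean (R := R) e i ^+ 2 = 1.
Proof.
move=> H.
have ik : (i.+1 * k <= m.+1)%N.
  by rewrite (leq_trans _ (leq_divM m.+1 l))// mulnC leq_mul2l ltn_ord orbT.
have key (s : nat) : (i * k + s < i.+1 * k)%N -> e (inord (i * k + s)) = e (inord (i * k)).
  elim: s => [|s IH] hs; first by rewrite addn0.
  rewrite addnS in hs *; rewrite -IH; last exact: ltnW.
  have tm : (i * k + s < m)%N by rewrite -ltnS (leq_trans hs).
  have := H (Ordinal tm) (leq_addr _ _) hs; rewrite /flip_at negb_add => /eqP.
  rewrite (_ : widen_ord _ _ = inord (i * k + s)); last first.
    by apply: val_inj; rewrite /= inordK// ltnS ltnW.
  rewrite (_ : lift _ _ = inord (i * k + s).+1)//.
  by apply: val_inj; rewrite /= inordK.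
rewrite /sign_mean (eq_bigr (fun=> sgn (e (inord (i * k))))); last first.
  move=> j; rewrite mem_block => /andP[h1 h2]; congr sgn.
  by rewrite -(key (j - i * k)%N) subnKC// inord_val.
rewrite sumr_const card_block// -[sgn _ *+ _]mulr_natl mulrA mulVf ?mul1r; last by rewrite pnatr_eq0 -lt0n.
by rewrite /sgn; case: (e _); rewrite ?sqrrN expr1n.
Qed.

(** A block without an inner flip has sign mean 1 or -1 and loses nothing; any other block loses at
    most 1 and contains a flip time. Blocks being disjoint, no flip is charged twice. *)
Lemma sign_energy_flips : l%:R * (1 - sign_energy (R := R) (l := l) e) <= (flips e)%:R.
Proof.
have lR : 0 < l%:R :> R by rewrite ltr0n.
rewrite /sign_energy mulrBr mulr1 mulVKf ?gt_eqF//.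
have -> : l%:R = \sum_(i < l) (1 : R) by rewrite sumr_const card_ord.
rewrite -sumrB.
apply: (@le_trans _ _ (\sum_(i < l) \sum_(t < m | (i * k <= t)%N && (t < i.+1 * k)%N) (flip_at t : nat)%:R)).
  apply: ler_sum => i _.
  have [H|/existsNP[t /not_implyP[t1 /not_implyP[t2 /negP ft]]]] := pselect (forall t : 'I_m, (i * k <= t)%N -> (t.+1 < i.+1 * k)%N -> ~~ flip_at t).
    by rewrite block_const// subrr sumr_ge0.
  rewrite (bigD1 t)/=; last by rewrite t1 ltnW.
  move: ft; rewrite negbK => ->; apply: (@le_trans _ _ 1).
    by rewrite gerBl sqr_ge0.
  by rewrite lerDl sumr_ge0.
rewrite (eq_bigr (fun i : 'I_l => \sum_(t < m) if (i * k <= t)%N && (t < i.+1 * k)%N then (flip_at t : nat)%:R else 0)); last first.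
  by move=> i _; rewrite big_mkcond.
rewrite exchange_big/= /flips natr_sum; apply: ler_sum => t _.
rewrite -big_mkcond/=.
have [/existsP[i hi]|/existsPn H] := boolP [exists i : 'I_l, (i * k <= t)%N && (t < i.+1 * k)%N].
  rewrite (big_pred1 i)// => i'; apply/idP/eqP => [hi'|->//].
  exact: block_uniq hi' hi.
by rewrite big_pred0 ?ler0n// => i; apply/negbTE.
Qed.

(** Averages of single observations have no bias; this treats the top level, where l need not be
    large compared with the flips. *)
Lemma sign_energy_singletons : k = 1%N -> sign_energy (R := R) (l := l) e = 1.
Proof.
move=> k1; have lR : 0 < l%:R :> R by rewrite ltr0n.
rewrite /sign_energy (eq_bigr (fun=> 1)); last first.
  move=> i _; apply: block_const => t; rewrite k1 !muln1 ltnS => h1 h2.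
  by have := leq_ltn_trans h1 h2; rewrite ltnn.
by rewrite sumr_const card_ord mulVf// gt_eqF.
Qed.

End SignEnergy.

Section LevelLoss.
Context {R : realType}.

(** The cross term 4 |theta| * 20 sqrt (d n) is at most 160 sqrt (d l) when n |theta|^2 <= 2 l, the
    block term is 2 [quad_const] sqrt (d l), and dividing by l k >= n / 2 doubles both. *)
Definition err_const : R := 320 + 4 * quad_const.
(** 33^2 = 1089 exceeds 2 * 504 + 2 * 26, the spectral and bias constants that meet in
    [level_loss]. *)
Definition level_const : R := 33 * err_const.

Lemma err_const_ge1 : 1 <= err_const.
Proof.
rewrite /err_const; have : 0 <= quad_const :> R; last lra.
by rewrite /quad_const mulr_ge0// addr_ge0// mulr_ge0// sqr_ge0.
Qed.

Lemma level_const_ge1 : 1 <= level_const.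
Proof. by rewrite /level_const; have := err_const_ge1; lra. Qed.

(* t = |theta|^2; b bounds the bias 1 - rho and b l the number of sign flips. *)
Lemma bias_bound (n d l a t delta b : R) : 0 < d -> d <= l -> 0 < n ->
  0 < a -> a ^+ 2 * n ^+ 2 = d * l -> 0 <= t -> n * t <= 2 * l ->
  0 <= b -> b <= 1 -> 0 <= delta ->
  b * l <= 3 * (n * delta) + d -> delta ^+ 2 * n ^+ 4 * t ^+ 2 <= d * l ^+ 3 ->
  b ^+ 2 * t * Num.max a t <= 26 * a ^+ 2.
Proof.
move=> d0 dl n0 a0 an t0 nt b0 b1 de0 bl hd.
have a2 : 0 <= a ^+ 2 := sqr_ge0 a.
have b2 : b ^+ 2 <= 1 by rewrite expr_le1.
have [ta|ta] := leP t a.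
  have : b ^+ 2 * t <= a by apply: le_trans ta; rewrite ler_piMl.
  by move=> /(ler_wpM2r (ltW a0)); rewrite -expr2 => h; lra.
have l0 : 0 < l by lra.
have L : 0 < n ^+ 2 * l ^+ 2 by rewrite mulr_gt0 ?exprn_gt0.
rewrite -(ler_pM2r L).
(* With [h2] and [h3] below, the coefficients 18 and 2 produce the constant 18 + 2 * 4 = 26. *)
have bl2 : (b * l) ^+ 2 <= 18 * (n * delta) ^+ 2 + 2 * d ^+ 2.
  have nd0 : 0 <= n * delta by rewrite mulr_ge0// ltW.
  apply: (@le_trans _ _ ((3 * (n * delta) + d) ^+ 2)).
    by rewrite ler_pXn2r// nnegrE ?mulr_ge0 ?addr_ge0 ?mulr_ge0 ?(ltW l0) ?(ltW d0) ?(ltW n0).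
  by have := sqr_ge0 (3 * (n * delta) - d); lra.
have nt2 : (n * t) ^+ 2 <= 4 * l ^+ 2.
  have nt0 : 0 <= n * t by rewrite mulr_ge0// ltW.
  rewrite (_ : 4 * l ^+ 2 = (2 * l) ^+ 2); last by ring.
  by rewrite ler_pXn2r// nnegrE// mulr_ge0// ltW.
have e1 : b ^+ 2 * t * t * (n ^+ 2 * l ^+ 2) = (b * l) ^+ 2 * (n * t) ^+ 2 by ring.
have e2 : 26 * a ^+ 2 * (n ^+ 2 * l ^+ 2) = 26 * (d * l ^+ 3).
  have -> : 26 * a ^+ 2 * (n ^+ 2 * l ^+ 2) = 26 * (a ^+ 2 * n ^+ 2) * l ^+ 2 by ring.
  by rewrite an; ring.
rewrite e1 e2.
have h1 : (b * l) ^+ 2 * (n * t) ^+ 2 <= (18 * (n * delta) ^+ 2 + 2 * d ^+ 2) * (n * t) ^+ 2.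
  by rewrite ler_wpM2r ?sqr_ge0.
have h2 : (n * delta) ^+ 2 * (n * t) ^+ 2 <= d * l ^+ 3.
  by apply: le_trans hd; rewrite le_eqVlt; apply/orP; left; apply/eqP; ring.
have h3 : d ^+ 2 * (n * t) ^+ 2 <= 4 * (d * l ^+ 3).
  apply: (@le_trans _ _ (d ^+ 2 * (4 * l ^+ 2))); first by rewrite ler_wpM2l ?sqr_ge0.
  rewrite (_ : d ^+ 2 * _ = 4 * (d * l ^+ 2 * d)); last by ring.
  rewrite (_ : d * l ^+ 3 = d * l ^+ 2 * l); last by ring.
  by rewrite ler_pM2l// ler_wpM2l// mulr_ge0 ?sqr_ge0 ?(ltW d0).
lra.
Qed.

(** Spectral perturbation compares the estimate with u = sqrt rho theta, and the bias |u - theta| <=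
    (1 - rho) |theta| is added. The perturbation bound is relative to |u|^2, not |theta|^2, so a
    small rho needs its own argument. *)
Lemma level_loss (m d l : nat) (vmax : 'M[R]_d -> 'cV[R]_d) (theta : 'cV[R]_d)
    (e : {ffun 'I_m.+1 -> bool}) (xi : 'I_m.+1 -> 'cV[R]_d) (delta : R) :
  let n := m.+1 in
  let a := Num.sqrt (d%:R * l%:R) / n%:R in
  (0 < d)%N -> (d <= l)%N -> (l <= n)%N -> top_eigenvector vmax -> 0 <= delta ->
  (forall f, @net_mem R d f -> `|cross_form (l := l) e xi (net_point f)| <= 20 * Num.sqrt (d%:R * n%:R)) ->
  (forall f, @net_mem R d f -> `|block_form (l := l) xi (net_point f)| <= quad_const * Num.sqrt (d%:R * l%:R)) ->
  (flips e)%:R <= 3 * (m%:R * delta) + d%:R ->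
  n%:R * norm2 theta ^+ 2 <= 2 * l%:R ->
  (n %/ l = 1)%N \/ delta ^+ 2 * n%:R ^+ 4 * (norm2 theta ^+ 2) ^+ 2 <= d%:R * l%:R ^+ 3 ->
  loss (theta_tilde vmax (observation theta e xi) l) theta ^+ 2 * Num.max a (norm2 theta ^+ 2)
    <= level_const ^+ 2 * a ^+ 2.
Proof.
move=> n a d0 dl ln Hv de0 Hc Hb Hf nt Hk.
have l0 : (0 < l)%N := leq_trans d0 dl.
have dR : 0 < d%:R :> R by rewrite ltr0n.
have lR : 0 < l%:R :> R by rewrite ltr0n.
have nR : 0 < n%:R :> R by rewrite ltr0n.
have dlR : d%:R <= l%:R :> R by rewrite ler_nat.
pose k := (n %/ l)%N.
have k0 : (0 < k)%N by rewrite divn_gt0.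
have kR : 0 < k%:R :> R by rewrite ltr0n.
have sdl0 : 0 < Num.sqrt (d%:R * l%:R) :> R by rewrite sqrtr_gt0 mulr_gt0.
have a0 : 0 < a by rewrite divr_gt0.
have an : a ^+ 2 * n%:R ^+ 2 = d%:R * l%:R.
  by rewrite /a expr_div_n divfK ?expf_neq0 ?gt_eqF// sqr_sqrtr// mulr_ge0.
have lk : n%:R / 2 <= l%:R * k%:R :> R.
  rewrite ler_pdivrMr// -natrM -(natrM _ _ 2) ler_nat.
  have := ltn_ceil n l0; rewrite -/k mulSn => h.
  have : (l <= k * l)%N by rewrite leq_pmull.
  by move=> h2; rewrite muln2 -addnn mulnC; apply: ltnW; apply: leq_trans h _; rewrite leq_add2r.
set T := norm2 theta ^+ 2 in nt Hk *.
have T0 : 0 <= T := sqr_ge0 _.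
have c1 := err_const_ge1.
pose A := err_const * a.
have A0 : 0 < A by rewrite mulr_gt0//; lra.
set rho := sign_energy (R := R) (l := l) e.
have rho0 : 0 <= rho by apply: sign_energy_ge0.
have rho1 : rho <= 1 by exact: (sign_energy_le1 e d0 dl ln).
pose u := Num.sqrt rho *: theta.
have u2 : norm2 u ^+ 2 = rho * T by rewrite norm2Z exprMn real_normK ?num_real// sqr_sqrtr.
set S := sigma_hat (observation theta e xi) l.
have HA x y : `|dotp x (S *m y) - k%:R^-1 * dotp x y - dotp u x * dotp u y| <= A * (norm2 x * norm2 y).
  have := sigma_hat_error theta d0 dl ln Hc Hb x y; rewrite -/S -/rho -/u -/k => /le_trans; apply.
  rewrite ler_wpM2r ?mulr_ge0 ?norm2_ge0//.
  have hs : norm2 theta * Num.sqrt (d%:R * n%:R) <= 2 * Num.sqrt (d%:R * l%:R).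
    rewrite -(@ler_pXn2r _ 2)// ?nnegrE ?mulr_ge0 ?norm2_ge0 ?sqrtr_ge0//.
    rewrite !exprMn -/T !sqr_sqrtr ?mulr_ge0//.
    rewrite (_ : T * _ = d%:R * (n%:R * T)); last by ring.
    rewrite (_ : 2 ^+ 2 * _ = d%:R * (4 * l%:R)); last by ring.
    by rewrite ler_pM2l//; lra.
  rewrite ler_pdivrMl ?mulr_gt0//.
  apply: (@le_trans _ _ (n%:R / 2 * A)); last by rewrite ler_wpM2r// ltW.
  have -> : n%:R / 2 * A = (160 + 2 * quad_const) * Num.sqrt (d%:R * l%:R).
    by rewrite /A /a /err_const; field; rewrite gt_eqF.
  lra.
have sS : S^T = S by exact: sigma_hat_sym.
have [Sv v1] := Hv S sS.
have := spectral_perturbation d0 sS A0 HA Sv v1.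
rewrite u2 -/(theta_tilde vmax (observation theta e xi) l).
set th := theta_tilde _ _ _ => Hth.
have Lu : loss th u ^+ 2 * Num.max a T <= 504 * err_const ^+ 2 * a ^+ 2 /\
    (1 - rho) ^+ 2 * T * Num.max a T <= 26 * a ^+ 2.
  have Hbias : (1 - rho) ^+ 2 * T * Num.max a T <= 26 * a ^+ 2.
    case: Hk => [k1|Hk].
      rewrite /rho sign_energy_singletons// subrr expr0n/= !mul0r.
      by have := sqr_ge0 a; lra.
    apply: (@bias_bound n%:R d%:R l%:R a T delta) => //; try lra.
    rewrite mulrC; apply: le_trans (sign_energy_flips _ _ _) _ => //.
    apply: le_trans Hf _; rewrite lerD2r ler_wpM2l// ler_wpM2r// ler_nat.
    by rewrite leqnSn.
  split => //.
  have L0 : 0 <= loss th u ^+ 2 := sqr_ge0 _.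
  have c12 : err_const <= err_const ^+ 2 by rewrite expr2 ler_peMr//; lra.
  have a20 : 0 <= a ^+ 2 := sqr_ge0 a.
  have [rh|rh] := leP (1 / 4) rho.
    have hM : Num.max a T <= 4 * Num.max A (rho * T).
      rewrite ge_max; apply/andP; split.
        have : a <= A by rewrite /A ler_peMl// ltW.
        have : A <= Num.max A (rho * T) by rewrite le_max lexx.
        by have := a0; lra.
      have : rho * T <= Num.max A (rho * T) by rewrite le_max lexx orbT.
      have := ler_wpM2r T0 rh; lra.
    have := ler_wpM2l L0 hM.
    rewrite mulrCA => /le_trans; apply.
    have := Hth; rewrite /A exprMn => h.
    have : 0 <= err_const ^+ 2 * a ^+ 2 by rewrite mulr_ge0// sqr_ge0.
    lra.
  (* For rho < 1 / 4 the bias bound reads against itself: (1 - rho)^2 >= 9 / 16 forces T^2 <= 49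
     a^2, and then the bound without |u|^2 suffices. *)
  have T7 : T <= 7 * a.
    have [//|h] := leP T (7 * a).
    have TM : T <= Num.max a T by rewrite le_max lexx orbT.
    have b34 : 9 / 16 <= (1 - rho) ^+ 2 by nra.
    have h1 : 9 / 16 * T * T <= 26 * a ^+ 2.
      apply: le_trans Hbias; apply: ler_pM => //; first by rewrite mulr_ge0.
      by rewrite ler_wpM2r.
    nra.
  have hM : Num.max a T <= 7 * a by rewrite ge_max T7 andbT; lra.
  have h1 : loss th u ^+ 2 * A <= 72 * A ^+ 2.
    by apply: le_trans Hth; rewrite ler_wpM2l// le_max lexx.
  have h2 : loss th u ^+ 2 <= 72 * A by move: h1; rewrite [A ^+ 2]expr2 mulrA ler_pM2r.
  apply: (@le_trans _ _ (72 * A * (7 * a))).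
    by apply: ler_pM => //; rewrite le_max (ltW a0).
  have := ler_wpM2r a20 c12; rewrite /A; lra.
have [L1' L2'] := Lu.
have tri := loss_triangle th u theta.
have bias : loss u theta <= (1 - rho) * norm2 theta.
  apply: le_trans (loss_le _ _) _.
  rewrite -[X in _ - X]scale1r -scalerBl norm2Z ler_wpM2r ?norm2_ge0//.
  have sr1 : Num.sqrt rho <= 1 by rewrite -sqrtr1 ler_wsqrtr.
  have sr0 := sqrtr_ge0 rho; have sr2 : Num.sqrt rho ^+ 2 = rho by rewrite sqr_sqrtr.
  by rewrite distrC ger0_norm ?subr_ge0//; nra.
have L0 := loss_ge0 th theta.
have l1 := loss_ge0 th u; have l2 := loss_ge0 u theta.
have M0 : 0 <= Num.max a T by rewrite le_max T0 orbT.
have : loss th theta ^+ 2 <= 2 * loss th u ^+ 2 + 2 * ((1 - rho) ^+ 2 * T).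
  apply: (@le_trans _ _ ((loss th u + (1 - rho) * norm2 theta) ^+ 2)).
    by apply: lerXn2r; rewrite ?nnegrE//; lra.
  by have := sqr_ge0 (loss th u - (1 - rho) * norm2 theta); rewrite /T; lra.
move=> /(ler_wpM2r M0) h; apply: le_trans h _.
have c12 : 1 <= err_const ^+ 2 by rewrite exprn_ege1.
have := ler_wpM2r (sqr_ge0 a) c12; have := sqr_ge0 a; move: L1' L2'.
rewrite /level_const [(33 * _) ^+ 2]exprMn.
move: (loss th u ^+ 2) ((1 - rho) ^+ 2 * T) (Num.max a T) (err_const ^+ 2) (a ^+ 2).
by clear => X Z M E2 a2; lra.
Qed.

End LevelLoss.

(** * Lepski's method *)

Section Lepski.
Context {R : realType}.
Variable a : nat -> R.
Hypothesis a0 : forall j, 0 < a j.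
Hypothesis aS : forall j, a j.+1 ^+ 2 = 2 * a j ^+ 2.

(* The square root of the threshold a_j /\ a_j^2 / s of the j-th comparison; s
   stands for a squared norm. *)
Definition rate (j : nat) (s : R) : R := Num.sqrt (a j ^+ 2 / Num.max (a j) s).

Let max_gt0 j s : 0 < Num.max (a j) s.
Proof. by rewrite lt_max a0. Qed.

Let Q_gt0 j s : 0 < a j ^+ 2 / Num.max (a j) s.
Proof. by rewrite divr_gt0 ?exprn_gt0. Qed.

Lemma rate_gt0 j s : 0 < rate j s.
Proof. by rewrite sqrtr_gt0. Qed.

Lemma rate_sqr j s : rate j s ^+ 2 * Num.max (a j) s = a j ^+ 2.
Proof. by rewrite sqr_sqrtr ?(ltW (Q_gt0 _ _))// divfK// gt_eqF. Qed.

Lemma le_rateP (x c s : R) j : 0 <= x -> 0 <= c ->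
  (x ^+ 2 * Num.max (a j) s <= c ^+ 2 * a j ^+ 2) = (x <= c * rate j s).
Proof.
move=> x0 c0; have r0 := rate_gt0 j s.
rewrite -(@ler_pXn2r _ 2 _ x)// ?nnegrE ?mulr_ge0 ?(ltW r0)//.
by rewrite exprMn -(rate_sqr j s) mulrA ler_pM2r.
Qed.

Lemma rate_le (c s s' : R) j j' : 0 <= c ->
  a j ^+ 2 * Num.max (a j') s' <= c ^+ 2 * a j' ^+ 2 * Num.max (a j) s ->
  rate j s <= c * rate j' s'.
Proof.
move=> c0 H; rewrite -le_rateP ?(ltW (rate_gt0 _ _))// -(ler_pM2r (max_gt0 j s)).
by rewrite mulrAC rate_sqr.
Qed.

Lemma a_mono i j : (i <= j)%N -> a i <= a j.
Proof.
move=> /subnK <-; elim: (j - i)%N => [|m IH]; first by rewrite add0n.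
apply: le_trans IH _; rewrite addSn -(@ler_pXn2r _ 2)// ?nnegrE ?(ltW (a0 _))// aS.
by have := sqr_ge0 (a (m + i)); lra.
Qed.

Lemma a_double i m : a (m.*2 + i) = 2 ^+ m * a i.
Proof.
elim: m => [|m IH]; first by rewrite double0 add0n expr0 mul1r.
apply/eqP; rewrite -(@eqrXn2 _ 2) ?mulr_ge0 ?exprn_ge0 ?(ltW (a0 _))//.
rewrite doubleS !addSn !aS IH [2 ^+ m.+1]exprS; apply/eqP; ring.
Qed.

Lemma rate_mono i j s : (i <= j)%N -> rate i s <= rate j s.
Proof.
move=> /a_mono ij; rewrite -[leRHS]mul1r; apply: rate_le => //; rewrite expr1n mul1r.
have ai := a0 i; have aj := a0 j.
have [h1|h1] := leP (a j) s; have [h2|h2] := leP (a i) s.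
- by have s0 : 0 < s by [exact: lt_le_trans h2]; rewrite ler_pM2r// ler_pXn2r// nnegrE ltW.
- by have := lt_le_trans (le_lt_trans h1 h2) ij; rewrite ltxx.
- have s0 : 0 < s by exact: lt_le_trans h2.
  have := ler_wpM2l (ltW (mulr_gt0 ai aj)) h2.
  by have := ler_wpM2l (ltW (mulr_gt0 s0 aj)) ij; rewrite !expr2; lra.
- by have := ler_wpM2l (ltW (mulr_gt0 ai aj)) ij; rewrite !expr2; lra.
Qed.

(** a_j^2 doubles while the maximum grows by at most sqrt 2, so the squared rate grows by at least
    sqrt 2 > (7 / 6)^2. The resulting geometric sum is the factor 7 = 1 / (1 - 6 / 7) of
    [loss_chain]. *)
Lemma rate_growth j s : 7 / 6 * rate j s <= rate j.+1 s.
Proof.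
rewrite -ler_pdivlMl ?divr_gt0//; apply: rate_le; first by rewrite invr_ge0 divr_ge0.
have aj := a0 j; have aj1 := a0 j.+1; have h := aS j.
have h1 : a j <= a j.+1 by exact: a_mono.
rewrite h.
have hM : 49 * Num.max (a j.+1) s <= 72 * Num.max (a j) s.
  have h2 : 49 * a j.+1 <= 72 * a j.
    rewrite -(@ler_pXn2r _ 2)// ?nnegrE ?mulr_ge0 ?(ltW aj) ?(ltW aj1)//.
    by rewrite !exprMn h; have := sqr_ge0 (a j); lra.
  have [h3|h3] := leP (a j.+1) s; have [h4|h4] := leP (a j) s; lra.
have := ler_wpM2l (sqr_ge0 (a j)) hM; lra.
Qed.

Lemma rate0 j : rate j 0 ^+ 2 = a j.
Proof.
have aj := a0 j; have := rate_sqr j 0; rewrite (max_idPl (ltW aj)) expr2 => h.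
by apply: (mulIf (lt0r_neq0 aj)); rewrite h expr2.
Qed.

Context {d : nat}.
Variable th : nat -> 'cV[R]_d.

Lemma loss_chain (B s : R) m j : 0 <= B -> (m <= j)%N ->
  (forall i, (m < i <= j)%N -> loss (th i) (th i.-1) <= B * rate i s) ->
  loss (th m) (th j) <= 7 * B * rate j s.
Proof.
move=> B0 /subnK <-; elim: (j - m)%N => [|k IH] H.
  by rewrite add0n loss_refl !mulr_ge0// ltW// rate_gt0.
rewrite addSn; apply: le_trans (loss_triangle _ (th (k + m)) _) _.
have h1 : loss (th m) (th (k + m)) <= 7 * B * rate (k + m) s.
  by apply: IH => i /andP[mi ik]; apply: H; rewrite mi addSn ltnW.
have h2 : loss (th (k + m)) (th (k + m).+1) <= B * rate (k + m).+1 s.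
  by rewrite lossC; apply: H; rewrite addSn leqnn ltnS leq_addl.
by have := ler_wpM2l B0 (rate_growth (k + m) s); lra.
Qed.

End Lepski.

(* After the first pass loss (th m1) theta <= C' sqrt(a ms). Either |theta| is
   at most of order sqrt(a ms), and then the two terms of the rate are
   comparable at ms, or |th m1| and |theta| are within a factor 2. The second
   pass therefore stops at most 2 c levels after ms, where 2^c >= C'^2. *)
Lemma lepski_two_step {R : realType} (C0 : R) : 1 <= C0 ->
  exists C K : R, [/\ 0 < C, 0 < K &
  forall (d : nat) (a : nat -> R) (th : nat -> 'cV[R]_d) (theta : 'cV[R]_d) (M ms m1 m2 : nat),
  (forall j, 0 < a j) -> (forall j, a j.+1 ^+ 2 = 2 * a j ^+ 2) ->
  let close s j := loss (th j) (th j.-1) ^+ 2 * Num.max (a j) (s ^+ 2) <= 4 * C ^+ 2 * a j ^+ 2 in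
  let selects s m := (m <= M)%N /\ (forall j, (m < j <= M)%N -> close (s j) j) /\
    (forall m', (m' <= M)%N -> (forall j, (m' < j <= M)%N -> close (s j) j) -> (m <= m')%N) in
  (ms <= M)%N ->
  (forall j, (ms <= j <= M)%N ->
    loss (th j) theta ^+ 2 * Num.max (a j) (norm2 theta ^+ 2) <= C0 ^+ 2 * a j ^+ 2) ->
  selects (fun j => norm2 (th j)) m1 ->
  selects (fun=> norm2 (th m1)) m2 ->
  loss (th m2) theta ^+ 2 * Num.max (a ms) (norm2 theta ^+ 2) <= K * a ms ^+ 2].
Proof.
(* 2 C0 bounds the distance of neighbouring good levels, by the triangle inequality through theta; 1
   + C0 is the price of replacing |theta| by |th j| in the rate. *)
move=> C01; pose C := 2 * C0 * (1 + C0).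
have CC : 2 * C0 <= C by rewrite /C; nra.
have Cpos : 0 < C by lra.
(* A chain of accepted tests, each with threshold 2 C, costs 7 * 2 C, and the oracle level itself
   costs C0. *)
pose C' := 14 * C + C0.
have C'1 : 1 <= C' by rewrite /C'; lra.
pose c := (Num.truncn (C' ^+ 2)).+1.
have cC : C' ^+ 2 <= 2 ^+ c.
  have h1 : C' ^+ 2 < c%:R by exact: truncnS_gt.
  apply: le_trans (ltW h1) _; rewrite -natrX ler_nat; exact: ltnW (ltn_expl _ _).
pose p : R := 2 ^+ c.
have p1 : 1 <= p by rewrite exprn_ege1// ler1n.
pose B := 14 * C * (2 * C' * p) + C0 * p.
have B0 : 0 < B by rewrite addr_gt0 ?mulr_gt0//; lra.
exists C, (B ^+ 2); split => //; first exact: exprn_gt0.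
move=> d a th theta M ms m1 m2 a0 aS close selects msM good [m1M [cl1 min1]] [m2M [cl2 min2]].
set T := norm2 theta ^+ 2 in good *.
have T0 : 0 <= T := sqr_ge0 _.
have nth0 := norm2_ge0 theta.
have ra := rate_gt0 a0.
have closeP s j : close s j <-> loss (th j) (th j.-1) <= 2 * C * rate a j (s ^+ 2).
  have C20 : 0 <= 2 * C by lra.
  rewrite /close -(le_rateP a0) ?loss_ge0//.
  by rewrite (_ : (2 * C) ^+ 2 = 4 * C ^+ 2)//; ring.
have C00 : 0 <= C0 by lra.
have {good}good j : (ms <= j <= M)%N -> loss (th j) theta <= C0 * rate a j T.
  by move=> /good; rewrite (le_rateP a0) ?loss_ge0.
have step j : (ms < j <= M)%N -> loss (th j) (th j.-1) <= 2 * C0 * rate a j T.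
  move=> /andP[msj jM].
  have j1 : (ms <= j.-1 <= M)%N.
    by case: (j) msj jM => //= j' h h'; rewrite -ltnS h ltnW.
  have h1 := good j; rewrite (ltnW msj) jM in h1; have {}h1 := h1 isT.
  have h2 := good _ j1; rewrite lossC in h2.
  have h3 := rate_mono a0 aS T (leq_pred j).
  apply: le_trans (loss_triangle _ theta _) _.
  have := ler_wpM2l C00 h3; lra.
have max_rate j : rate a j T ^+ 2 <= Num.max (a j) T.
  have m0 : 0 < Num.max (a j) T by rewrite lt_max a0.
  rewrite -(ler_pM2r m0) (rate_sqr a0) -expr2.
  by rewrite ler_pXn2r// ?nnegrE ?(ltW m0) ?(ltW (a0 j))// le_max lexx.
(* Every test above the oracle level succeeds, so the minimality of m1 applies to ms. *)
have m1ms : (m1 <= ms)%N.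
  apply: min1 => // j /andP[msj jM]; apply/closeP.
  have h1 := good j; rewrite (ltnW msj) jM in h1; have {}h1 := h1 isT.
  have h2 : rate a j T <= (1 + C0) * rate a j (norm2 (th j) ^+ 2).
    apply: (rate_le a0); first lra.
    rewrite -mulrA mulrCA; apply: ler_wpM2l; first exact: sqr_ge0.
    have hm : a j <= Num.max (a j) T by rewrite le_max lexx.
    have hT : T <= Num.max (a j) T by rewrite le_max lexx orbT.
    have h4 := max_rate j.
    rewrite ge_max; apply/andP; split.
      apply: le_trans hm _; rewrite ler_peMl ?(le_trans _ hT)//.
      by rewrite exprn_ege1//; lra.
    have n1 : norm2 (th j) <= norm2 theta + C0 * rate a j T.
      by apply: le_trans (loss_norm2 _ theta) _; lra.
    have r0 := ra j T.
    apply: (@le_trans _ _ ((norm2 theta + C0 * rate a j T) ^+ 2)).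
      by apply: lerXn2r; rewrite ?nnegrE ?norm2_ge0// addr_ge0// mulr_ge0//; lra.
    have hx : 2 * (norm2 theta * rate a j T) <= 2 * Num.max (a j) T.
      have := sqr_ge0 (norm2 theta - rate a j T); rewrite -/T; rewrite /T in hT *; lra.
      have := ler_wpM2l C00 hx; have := ler_wpM2l (sqr_ge0 C0) h4.
    by rewrite /T in hT *; lra.
  apply: le_trans (step j _) _; first by rewrite msj.
  have C20 : 0 <= 2 * C0 by lra.
  apply: le_trans (ler_wpM2l C20 h2) _; rewrite mulrA -/C ler_wpM2r ?(ltW (ra _ _))//; lra.
(* x = sqrt (a ms). As the norms |th j| below ms are arbitrary, the chain from m1 to ms is bounded
   with the second argument of [rate] set to 0. *)
set x := rate a ms 0.
have x0 : 0 < x := ra _ _.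
have x2 : x ^+ 2 = a ms := rate0 a0 ms.
have r_le0 j s : 0 <= s -> rate a j s <= rate a j 0.
  move=> s0; rewrite -[leRHS]mul1r; apply: (rate_le a0) => //; rewrite expr1n mul1r.
  by rewrite ler_wpM2l ?sqr_ge0// ge_max !le_max lexx s0 orbT.
have near1 : loss (th m1) theta <= C' * x.
  apply: le_trans (loss_triangle _ (th ms) _) _.
  have h1 : loss (th m1) (th ms) <= 7 * (2 * C) * rate a ms 0.
    apply: (loss_chain a0 aS) => //; first lra.
    move=> i /andP[m1i ims]; have iM : (m1 < i <= M)%N by rewrite m1i (leq_trans ims).
    have /closeP h := cl1 i iM; apply: le_trans h _; rewrite ler_wpM2l//; first lra.
    by apply: r_le0; exact: sqr_ge0.
  have h2 := good ms; rewrite leqnn msM in h2; have {}h2 := h2 isT.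
  have h3 := r_le0 ms T T0.
  have := ler_wpM2l C00 h3; rewrite -/x /C'; rewrite -/x in h1; lra.
set s := norm2 (th m1) in min2 cl2.
have s0 : 0 <= s := norm2_ge0 _.
have s_up : s <= norm2 theta + C' * x by apply: le_trans (loss_norm2 _ theta) _; lra.
have s_lo : norm2 theta <= s + C' * x.
  by apply: le_trans (loss_norm2 _ (th m1)) _; rewrite lossC -/s; lra.
(* Two levels double a, so 2 c levels multiply it by 2^c >= C'^2. Above mss the error C' x of the
   first pass is at most sqrt (a j), too small for the use of s instead of |theta| to spoil a
   test. *)
pose mss := minn M (c.*2 + ms).
have mssM : (mss <= M)%N by rewrite geq_minl.
have ms_mss : (ms <= mss)%N by rewrite leq_min msM leq_addl.
have m2mss : (m2 <= mss)%N.
  apply: min2 => // j /andP[mj jM]; apply/closeP.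
  have cj : (c.*2 + ms < j)%N.
    by move: mj; rewrite /mss gtn_min => /orP[h|//]; have := leq_trans h jM; rewrite ltnn.
  have msj : (ms < j)%N by exact: leq_ltn_trans ms_mss mj.
  have aj : (C' * x) ^+ 2 <= a j.
    rewrite exprMn x2; apply: le_trans (a_mono a0 aS (ltnW cj)).
    by rewrite (a_double a0 aS) ler_wpM2r// ltW.
  have h2 : rate a j T <= 2 * rate a j (s ^+ 2).
    apply: (rate_le a0) => //.
    rewrite -mulrA mulrCA; apply: ler_wpM2l; first exact: sqr_ge0.
    have hm : a j <= Num.max (a j) T by rewrite le_max lexx.
    have hT : T <= Num.max (a j) T by rewrite le_max lexx orbT.
    rewrite ge_max; apply/andP; split; first lra.
    apply: (@le_trans _ _ ((norm2 theta + C' * x) ^+ 2)).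
      by apply: lerXn2r; rewrite ?nnegrE// addr_ge0// mulr_ge0 ?(ltW x0)//; lra.
    by have := sqr_ge0 (norm2 theta - C' * x); rewrite /T in hT *; lra.
  apply: le_trans (step j _) _; first by rewrite msj.
  have r0 := ra j (s ^+ 2).
  have C20 : 0 <= 2 * C0 by lra.
  have := ler_wpM2l C20 h2; have := ler_wpM2r (ltW r0) CC; lra.
have rT0 := ra ms T.
have a_mss : a mss <= p * a ms.
  rewrite -(a_double a0 aS); apply: (a_mono a0 aS); exact: geq_minr.
have amss := a0 mss; have ams := a0 ms.
have a_mono_mss : a ms <= a mss by exact: (a_mono a0 aS).
have rT : rate a mss T <= p * rate a ms T.
  apply: (rate_le a0); first lra.
  have h1 : a mss ^+ 2 <= p ^+ 2 * a ms ^+ 2.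
    by rewrite -exprMn; apply: lerXn2r; rewrite ?nnegrE ?mulr_ge0//; lra.
  have h2 : Num.max (a ms) T <= Num.max (a mss) T by rewrite ge_max !le_max a_mono_mss lexx orbT.
  by apply: ler_pM => //; rewrite ?sqr_ge0// le_max (ltW ams).
have rs : rate a mss (s ^+ 2) <= 2 * C' * p * rate a ms T.
  have [hb|hb] := leP (2 * C' * x) (norm2 theta).
    have h1 : rate a mss (s ^+ 2) <= 2 * rate a mss T.
      apply: (rate_le a0) => //.
      rewrite -mulrA mulrCA; apply: ler_wpM2l; first exact: sqr_ge0.
      have hm : a mss <= Num.max (a mss) (s ^+ 2) by rewrite le_max lexx.
      have hs : s ^+ 2 <= Num.max (a mss) (s ^+ 2) by rewrite le_max lexx orbT.
      rewrite ge_max; apply/andP; split; first lra.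
      have ts : norm2 theta <= 2 * s by lra.
      have : T <= (2 * s) ^+ 2 by rewrite /T; apply: lerXn2r; rewrite ?nnegrE ?mulr_ge0.
      by rewrite exprMn; lra.
    apply: le_trans h1 _; have : 2 * rate a mss T <= 2 * (p * rate a ms T) by lra.
    move=> /le_trans; apply.
    have : 1 * (p * rate a ms T) <= C' * (p * rate a ms T).
      by rewrite ler_wpM2r// mulr_ge0 ?(ltW rT0)//; lra.
    lra.
  apply: le_trans (r_le0 _ _ (sqr_ge0 s)) _.
  apply: (rate_le a0); first by rewrite !mulr_ge0//; lra.
  rewrite (max_idPl (ltW amss)) expr2 -mulrA mulrC -mulrA.
  rewrite [leRHS](_ : _ = a mss * ((2 * C' * p) ^+ 2 * a ms ^+ 2)); last by ring.
  rewrite [leLHS](_ : _ = a mss * (a mss * Num.max (a ms) T)); last by ring.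
  apply: ler_wpM2l; first exact: ltW.
  have hM : Num.max (a ms) T <= (2 * C') ^+ 2 * a ms.
    have C2 : 1 <= (2 * C') ^+ 2 by rewrite exprn_ege1//; lra.
    rewrite ge_max; apply/andP; split; first by rewrite ler_peMl// ltW.
    rewrite -x2 -exprMn /T; apply: lerXn2r; rewrite ?nnegrE//; last exact: ltW.
    by rewrite mulr_ge0 ?(ltW x0)//; lra.
  have pp : p <= p ^+ 2 by rewrite expr2 ler_peMl//; lra.
  apply: (@le_trans _ _ (p * a ms * ((2 * C') ^+ 2 * a ms))).
    by apply: ler_pM => //; rewrite ?(ltW amss)// le_max (ltW ams).
  rewrite [leLHS](_ : _ = p * ((2 * C') ^+ 2 * a ms ^+ 2)); last by ring.
  rewrite [leRHS](_ : _ = p ^+ 2 * ((2 * C') ^+ 2 * a ms ^+ 2)); last by ring.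
  by rewrite ler_wpM2r// mulr_ge0 ?sqr_ge0.
rewrite (le_rateP a0) ?loss_ge0 ?(ltW B0)//.
apply: le_trans (loss_triangle _ (th mss) _) _.
have h1 : loss (th m2) (th mss) <= 7 * (2 * C) * rate a mss (s ^+ 2).
  apply: (loss_chain a0 aS) => //; first lra.
  move=> i /andP[m2i imss]; have iM : (m2 < i <= M)%N by rewrite m2i (leq_trans imss).
  by have /closeP := cl2 i iM.
have h2 := good mss; rewrite ms_mss mssM in h2; have {}h2 := h2 isT.
have C14 : 0 <= 14 * C by lra.
have := ler_wpM2l C00 rT; have := ler_wpM2l C14 rs; rewrite /B; lra.
Qed.

(** * Levels and rates *)

Section Levels.
Context {R : realType}.

Definition level_scale (n d j : nat) : R := Num.sqrt (d%:R * (grid d j)%:R) / n%:R.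

Lemma grid_gt0 d j : (0 < d)%N -> (0 < grid d j)%N.
Proof. by move=> d0; rewrite muln_gt0 expn_gt0. Qed.

Lemma gridS d j : grid d j.+1 = (2 * grid d j)%N.
Proof. by rewrite /grid expnS mulnA. Qed.

Lemma level_scale_gt0 n d j : (0 < d)%N -> (0 < n)%N -> 0 < level_scale n d j.
Proof. by move=> d0 n0; rewrite divr_gt0 ?sqrtr_gt0 ?mulr_gt0 ?ltr0n ?grid_gt0. Qed.

Lemma level_scale_sqr n d j : level_scale n d j ^+ 2 = d%:R * (grid d j)%:R / n%:R ^+ 2.
Proof. by rewrite expr_div_n sqr_sqrtr ?mulr_ge0. Qed.

Lemma level_scaleS n d j : level_scale n d j.+1 ^+ 2 = 2 * level_scale n d j ^+ 2.
Proof. by rewrite !level_scale_sqr gridS natrM; ring. Qed.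

(** When s = 0 the quotient is +oo and the minimum is a, which is also what a^2 / max(a, 0) gives;
    one real inequality thus covers the extended-real definition. *)
Lemma close_levelsE n d (vmax : 'M[R]_d -> 'cV[R]_d) (Y : 'I_n -> 'cV[R]_d) C s j :
  (0 < d)%N -> (0 < n)%N ->
  close_levels vmax Y C s j =
  (loss (theta_tilde vmax Y (grid d j)) (theta_tilde vmax Y (grid d j.-1)) ^+ 2 *
    Num.max (level_scale n d j) (s ^+ 2) <= 4 * C ^+ 2 * level_scale n d j ^+ 2).
Proof.
move=> d0 n0; rewrite /close_levels -/(level_scale n d j).
set a := level_scale n d j; have a0 : 0 < a by exact: level_scale_gt0.
have a2 : d%:R * (grid d j)%:R = a ^+ 2 * n%:R ^+ 2.
  by rewrite level_scale_sqr divfK// expf_neq0// pnatr_eq0 -lt0n.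
rewrite a2; have nn : n%:R != 0 :> R by rewrite pnatr_eq0 -lt0n.
set L := loss _ _ ^+ 2; have [->|s0] := eqVneq s 0.
  rewrite expr0n mulr0 inver eqxx gt0_muley; last first.
    by rewrite lte_fin mulr_gt0 ?exprn_gt0// lt_neqAle eq_sym nn ler0n.
  rewrite (min_idPl (leey _)) lee_fin (max_idPl (ltW a0)).
  by rewrite [a ^+ 2]expr2 [4 * _ * (a * a)]mulrA ler_pM2r.
have s2 : 0 < s ^+ 2 by rewrite exprn_even_gt0.
rewrite inver mulf_eq0 !expf_eq0 (negbTE nn) (negbTE s0) /= -EFinM -EFin_min -EFinM lee_fin.
rewrite (_ : a ^+ 2 * _ / _ = a ^+ 2 / s ^+ 2); last by field; rewrite s0 nn.
have [h|h] := leP a (s ^+ 2).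
  rewrite min_r; last by rewrite ler_pdivrMr// expr2 ler_pM2l.
  by rewrite mulrA ler_pdivlMr.
rewrite min_l; first by rewrite [a ^+ 2]expr2 [4 * _ * (a * a)]mulrA ler_pM2r.
by rewrite ler_pdivlMr// expr2 ler_pM2l// ltW.
Qed.

Lemma select_levelP n d (vmax : 'M[R]_d -> 'cV[R]_d) (Y : 'I_n -> 'cV[R]_d) C s :
  let M := max_level n d in let m := select_level vmax Y C s in
  (m <= M)%N /\ (forall j, (m < j <= M)%N -> close_levels vmax Y C (s j) j) /\
  (forall m', (m' <= M)%N ->
     (forall j, (m' < j <= M)%N -> close_levels vmax Y C (s j) j) -> (m <= m')%N).
Proof.
rewrite /select_level; case: arg_minnP => [|m /forallP H min].
  by apply/forallP => j; apply/implyP; rewrite ltnNge -ltnS ltn_ord.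
split; first by rewrite -ltnS.
split=> [j /andP[mj jM]|m' m'M H'].
  by have /implyP := H (Ordinal (jM : (j < (max_level n d).+1)%N)); exact.
apply: (min (Ordinal (m'M : (m' < (max_level n d).+1)%N))).
by apply/forallP => j; apply/implyP => /= m'j; apply: H'; rewrite m'j -ltnS /=.
Qed.

Lemma grid_max_level n d : (d <= n)%N -> (grid d (max_level n d) <= n)%N.
Proof.
move=> dn; rewrite /max_level /grid.
elim/big_ind: _ => [|x y hx hy|i //]; first by rewrite mul1n.
by rewrite /maxn; case: ifP.
Qed.

Lemma lt_grid_max_level n d : (0 < d)%N -> (n < grid d (max_level n d).+1)%N.
Proof.
move=> d0; rewrite ltnNge; apply/negP => h.
have hn : ((max_level n d).+1 < n.+1)%N.
  rewrite ltnS; apply: leq_trans h; rewrite /grid.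
  by apply: leq_trans (ltnW (ltn_expl _ (isT : (1 < 2)%N))) _; rewrite leq_pmulr.
by have := @leq_bigmax_cond _ (fun i : 'I_n.+1 => (2 ^ i * d <= n)%N) (fun i => i : nat) (Ordinal hn) h;
  rewrite ltnn.
Qed.

Lemma leq_grid d i j : (i <= j)%N -> (grid d i <= grid d j)%N.
Proof. by move=> ij; rewrite leq_mul2r leq_exp2l// ij orbT. Qed.

(** At the last level the buckets are single observations, without bias. This secures an oracle
    level even when l** exceeds every point of the grid. *)
Lemma divn_grid_max_level n d : (0 < d)%N -> (d <= n)%N -> (n %/ grid d (max_level n d) = 1)%N.
Proof.
move=> d0 dn; have g0 := grid_gt0 (max_level n d) d0.
apply/eqP; rewrite eqn_leq; apply/andP; split.
  by rewrite -ltnS ltn_divLR// -gridS lt_grid_max_level.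
by rewrite leq_divRL// mul1n grid_max_level.
Qed.

(** The number of levels, to be paid in the union bound: 2^M <= n / d and e^(1 / 2) <= 2 give M / 2
    <= ln (n / d). *)
Lemma max_level_ln n d : (0 < d)%N -> (d <= n)%N ->
  (max_level n d).+1%:R <= 2 * ln (expR 1 * n%:R / d%:R) :> R.
Proof.
move=> d0 dn; have dR : 0 < d%:R :> R by rewrite ltr0n.
have nR : 0 < n%:R :> R by rewrite ltr0n (leq_trans d0).
set M := max_level n d.
rewrite -mulrA lnM ?posrE ?expR_gt0 ?divr_gt0// expRK.
suff : M%:R / 2 <= ln (n%:R / d%:R) :> R by rewrite -[M.+1%:R]natr1; lra.
rewrite -ler_expR lnK ?posrE ?divr_gt0// ler_pdivlMr//.
have h2 : expR 2^-1 <= 2 :> R.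
  have := @expR_ge1Dx R (- 2^-1); rewrite expRN => h.
  have e0 := @expR_gt0 R 2^-1.
  have : 2^-1 * expR 2^-1 <= 1 :> R by rewrite -ler_pdivlMr//; lra.
  by lra.
have : (expR 2^-1) ^+ M <= 2 ^+ M :> R by apply: lerXn2r; rewrite ?nnegrE ?expR_ge0.
rewrite -expRM_natl => h; have := grid_max_level dn; rewrite -(ler_nat R) natrM natrX => h3.
by apply: le_trans h3; rewrite ler_pM2r.
Qed.

End Levels.

(** * The oracle level and the target rates *)

Section Rates.
Context {R : realType}.
Variables (n d : nat) (delta : R) (theta : 'cV[R]_d).
Hypothesis d0 : (0 < d)%N.
Hypothesis dn : (d <= n)%N.
Hypothesis delta0 : 0 < delta.
Hypothesis theta1 : norm2 theta ^+ 2 <= 1.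

Let t := norm2 theta ^+ 2.
Let dR : 0 < d%:R :> R. Proof. by rewrite ltr0n. Qed.
Let nR : 0 < n%:R :> R. Proof. by rewrite ltr0n (leq_trans d0). Qed.
Let t0 : 0 <= t. Proof. exact: sqr_ge0. Qed.

(** The solution l of d l^3 = delta^2 n^4 t^2, the condition under which [bias_bound] keeps the bias
    below the rate of the level. *)
Definition middle_term : R :=
  (delta `^ (2 / 3)) * (n%:R `^ (4 / 3)) * (norm2 theta `^ (4 / 3)) / (d%:R `^ (1 / 3)).

Lemma powR3 (x : R) k : 0 <= x -> (x `^ (k%:R / 3)) ^+ 3 = x ^+ k.
Proof. by move=> x0; rewrite -powR_mulrn ?powR_ge0// -powRrM divfK// powR_mulrn. Qed.

Lemma middle_term_ge0 : 0 <= middle_term.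
Proof. by rewrite divr_ge0 ?mulr_ge0 ?powR_ge0. Qed.

Lemma middle_term_cube : middle_term ^+ 3 * d%:R = delta ^+ 2 * n%:R ^+ 4 * t ^+ 2.
Proof.
rewrite /middle_term expr_div_n !exprMn (powR3 2)// ?(ltW delta0)//.
rewrite (powR3 4) ?(ltW nR)// (powR3 4) ?norm2_ge0// (powR3 1) ?(ltW dR)// expr1.
by rewrite divfK ?gt_eqF//; ring.
Qed.

Let L : R := (l_star2 n delta theta)%:~R.

Lemma l_star2_ge : d%:R <= L.
Proof.
rewrite /L -[d%:R]/((d%:Z)%:~R) ler_int /l_star2 le_min le_max lexx /=.
by rewrite lez_nat.
Qed.

Lemma l_star2_lower : L = n%:R \/ [/\ n%:R * delta <= L, middle_term <= L & n%:R * t <= L].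
Proof.
rewrite /L /l_star2 -/middle_term -/t; set m := Num.max (Num.max _ _) _.
set c := Num.ceil m.
have cm : m <= c%:~R by exact: ceil_ge.
have [h|h] := leP (Num.max d%:Z c) n%:Z; last by left.
right; have h1 : c%:~R <= (Num.max d%:Z c)%:~R :> R by rewrite ler_int le_max lexx orbT.
have {}h1 := le_trans cm h1.
by split; apply: le_trans h1; rewrite /m !le_max lexx ?orbT.
Qed.

(** The ceiling costs at most 1 <= d, which the factor 2 absorbs. The strict positivity in the last
    two cases records that theta is nonzero. *)
Lemma l_star2_upper : [\/ L <= 2 * d%:R, L <= 2 * (n%:R * delta),
  0 < middle_term /\ L <= 2 * middle_term | 0 < t /\ L <= 2 * (n%:R * t)].
Proof.
set m := Num.max (Num.max (n%:R * delta) middle_term) (n%:R * t).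
have H : L <= d%:R \/ L <= m + 1.
  have : (l_star2 n delta theta <= Num.max d%:Z (Num.ceil m))%R by rewrite ge_min lexx.
  rewrite -(ler_int R) -/L; have [h|h] := leP d%:Z (Num.ceil m) => hL; last by left.
  by right; apply: (le_trans hL); have := ceilB1_lt m; rewrite intrB => h'; apply: ltW; lra.
have d1 : 1 <= d%:R :> R by rewrite ler1n.
have [md|md] := leP m d%:R; first by constructor 1; case: H => H; lra.
have {}H : L <= 2 * m by case: H; lra.
have [h1|h1] := leP (Num.max (n%:R * delta) middle_term) (n%:R * t).
  have mE : m = n%:R * t by rewrite /m max_r.
  constructor 4; rewrite -mE; split => //; rewrite lt_neqAle t0 eq_sym andbT.
  by apply/eqP => tE; move: md; rewrite mE tE mulr0; lra.
have mE : m = Num.max (n%:R * delta) middle_term by rewrite /m max_l// ltW.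
have [h2|h2] := leP (n%:R * delta) middle_term; rewrite ?(max_r h2) ?(max_l (ltW h2)) in mE.
  by constructor 3; rewrite -mE; split => //; lra.
by constructor 2; rewrite -mE.
Qed.

(** ms is the first level with g >= l**, or M if there is none; minimality gives g <= 2 l**. At
    level M the buckets are singletons and |theta| <= 1 gives n t <= n < 2 g. Below M the case l** =
    n cannot occur, since there 2 g <= n. *)
Lemma oracle_level : exists ms, [/\ (ms <= max_level n d)%N,
  (grid d ms)%:R <= 2 * L &
  forall j, (ms <= j <= max_level n d)%N -> n%:R * t <= 2 * (grid d j)%:R /\
    ((n %/ grid d j = 1)%N \/ delta ^+ 2 * n%:R ^+ 4 * t ^+ 2 <= d%:R * (grid d j)%:R ^+ 3)].
Proof.
set M := max_level n d.
pose p := [pred j : nat | (M <= j)%N || (L <= (grid d j)%:R)].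
have exp : exists j, p j by exists M; rewrite /= leqnn.
case: (ex_minnP exp) => ms pms msmin.
have msM : (ms <= M)%N by apply: msmin; rewrite /= leqnn.
have gM : n%:R < 2 * (grid d M)%:R :> R.
  by have := lt_grid_max_level n d0; rewrite gridS -(ltr_nat R) natrM.
have L0 := l_star2_ge.
exists ms; split => //.
  case: (posnP ms) => [->|ms0].
    have -> : grid d 0 = d by rewrite /grid expn0 mul1n.
    have : 0 <= d%:R :> R by []; lra.
  case: ms ms0 msmin msM pms => // ms _ msmin msM _.
  have : ~~ p ms by apply/negP => /msmin; rewrite ltnn.
  by rewrite /= negb_or -ltNge gridS natrM => /andP[_ h]; lra.
move=> j /andP[msj jM].
have H1 : (M <= j)%N -> n%:R * t <= 2 * (grid d j)%:R /\ (n %/ grid d j = 1)%N.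
  move=> Mj; have -> : j = M by apply/eqP; rewrite eqn_leq jM.
  split; last exact: divn_grid_max_level.
  by have := ler_wpM2l (ltW nR) theta1; rewrite -/t; lra.
have [Mj|jM'] := leqP M j; first by have [h1 h2] := H1 Mj; split => //; left.
have Lj : L <= (grid d j)%:R.
  case/orP: pms => h; first by have := leq_trans h msj; rewrite leqNgt jM'.
  by apply: le_trans h _; rewrite ler_nat leq_grid.
have [LE|[h1 h2 h3]] := l_star2_lower.
  have gn : (grid d M <= n)%N by exact: grid_max_level.
  have gj : (grid d j.+1 <= grid d M)%N by exact: leq_grid.
  have := leq_trans gj gn; rewrite gridS -(ler_nat R) natrM => h.
  by exfalso; have n1 : 0 < n%:R :> R := nR; lra.
have gj0 : 0 <= (grid d j)%:R :> R by [].
split; first lra.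
right; rewrite -middle_term_cube mulrC ler_pM2l//; apply: lerXn2r; rewrite ?nnegrE ?middle_term_ge0//.
lra.
Qed.

(** Both X <= K a and X t <= K a^2 hold, and the second is the local bound. For the global one the
    dominant term of l** decides. If it is d or n delta, a is of order d / n or sqrt (delta d / n);
    if it is n t, the second bound is of order d / n. For the middle term the two are interpolated:
    X^4 t^2 = X^2 (X t)^2 <= K^4 a^6, and a^6 is at most 64 (delta d / n)^2 t^2 up to the slack in
    the constants, so that t cancels. *)
Lemma final_rate (K X g : R) : 1 <= K -> 0 <= X -> 0 < g -> g <= 2 * L ->
  let a := Num.sqrt (d%:R * g) / n%:R in
  X * Num.max a t <= K * a ^+ 2 ->
  X <= 4 * K * global_rate n d delta /\
  (X%:E <= (4 * K)%:E * local_rate n delta theta)%E.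
Proof.
move=> K1 X0 g0 gL a H.
have a0 : 0 < a by rewrite divr_gt0 ?sqrtr_gt0 ?mulr_gt0.
have a2 : a ^+ 2 = d%:R * g / n%:R ^+ 2 by rewrite expr_div_n sqr_sqrtr// mulr_ge0// ltW.
have Xt : X * t <= K * a ^+ 2 by apply: le_trans H; rewrite ler_wpM2l// le_max lexx orbT.
have Xa : X <= K * a.
  by rewrite -(ler_pM2r a0) -mulrA -expr2; apply: le_trans H; rewrite ler_wpM2l// le_max lexx.
have a_le (c y : R) : 0 <= c -> 0 <= y -> g * d%:R <= (c * y * n%:R) ^+ 2 -> a <= c * y.
  move=> c0 y0 h; rewrite ler_pdivrMr// -(@ler_pXn2r _ 2)// ?nnegrE ?sqrtr_ge0// ?mulr_ge0// ?(ltW nR)//.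
  by rewrite sqr_sqrtr 1?mulrC// mulr_ge0// ltW.
have S0 : 0 <= Num.sqrt (delta * d%:R / n%:R) by exact: sqrtr_ge0.
have S2 : Num.sqrt (delta * d%:R / n%:R) ^+ 2 = delta * d%:R / n%:R.
  by rewrite sqr_sqrtr// divr_ge0 ?mulr_ge0// ltW.
have dn0 : 0 < d%:R / n%:R :> R by rewrite divr_gt0.
split.
  rewrite /global_rate; set S := Num.sqrt _ in S0 S2 *.
  case: l_star2_upper => [h|h|[x0 h]|[tp h]].
  - have : a <= 2 * (d%:R / n%:R).
      apply: a_le; [by []|exact: ltW|].
      rewrite (_ : 2 * _ * _ = 2 * d%:R); last by field; rewrite gt_eqF.
      have -> : (2 * d%:R) ^+ 2 = 4 * d%:R * d%:R :> R by ring.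
      by rewrite ler_pM2r//; lra.
    have K0 : 0 <= K by lra.
    move=> /(ler_wpM2l K0) h'; have := mulr_ge0 K0 S0; have := mulr_ge0 K0 (ltW dn0); lra.
  - have : a <= 2 * S.
      apply: a_le => //.
      rewrite !exprMn S2 (_ : 2 ^+ 2 * _ * _ = 4 * (n%:R * delta) * d%:R); last by field; rewrite gt_eqF.
      by rewrite ler_pM2r//; lra.
    have K0 : 0 <= K by lra.
    move=> /(ler_wpM2l K0) h'; have := mulr_ge0 K0 S0; have := mulr_ge0 K0 (ltW dn0); lra.
  - have tp : 0 < t.
      rewrite lt_neqAle t0 eq_sym andbT; apply/eqP => tE.
      have := middle_term_cube; rewrite tE expr0n mulr0 => /eqP.
      by rewrite mulf_eq0 expf_eq0 !gt_eqF.
    have K0 : 0 < K by lra.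
    suff : X <= 4 * K * S by have := mulr_ge0 (ltW K0) (ltW dn0); lra.
    have gx : g ^+ 3 <= 64 * middle_term ^+ 3.
      have -> : 64 * middle_term ^+ 3 = (4 * middle_term) ^+ 3 by ring.
      have g4 : g <= 4 * middle_term by lra.
      have x4 : 0 <= 4 * middle_term by lra.
      by apply: lerXn2r; rewrite ?nnegrE// ltW.
    have X2 : X ^+ 2 <= (K * a) ^+ 2 by apply: lerXn2r; rewrite ?nnegrE ?mulr_ge0 ?(ltW a0) ?(ltW K0).
    have Xt2 : (X * t) ^+ 2 <= (K * a ^+ 2) ^+ 2.
      have Xt0 : 0 <= X * t by exact: mulr_ge0.
      by apply: lerXn2r; rewrite ?nnegrE ?(le_trans Xt0).
    have h4 := ler_pM (sqr_ge0 _) (sqr_ge0 _) X2 Xt2.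
    rewrite -(@ler_pXn2r _ 4)// ?nnegrE ?mulr_ge0 ?(ltW K0)//.
    rewrite -(@ler_pM2r _ (t ^+ 2) (exprn_gt0 2 tp)).
    have -> : X ^+ 4 * t ^+ 2 = X ^+ 2 * (X * t) ^+ 2 by ring.
    apply: le_trans h4 _.
    have -> : (K * a) ^+ 2 * (K * a ^+ 2) ^+ 2 = K ^+ 4 * (a ^+ 2) ^+ 3 by ring.
    have -> : (4 * K * S) ^+ 4 * t ^+ 2 = K ^+ 4 * (256 * (S ^+ 2) ^+ 2 * t ^+ 2) by ring.
    apply: ler_wpM2l; first by rewrite exprn_ge0// ltW.
    rewrite a2 S2.
    have -> : 256 * (delta * d%:R / n%:R) ^+ 2 * t ^+ 2 =
        4 * (64 * (middle_term ^+ 3 * d%:R) * d%:R ^+ 2 / n%:R ^+ 6).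
      by rewrite middle_term_cube; field; rewrite gt_eqF.
    have -> : (d%:R * g / n%:R ^+ 2) ^+ 3 = g ^+ 3 * (d%:R ^+ 3 / n%:R ^+ 6).
      by field; rewrite gt_eqF.
    have -> : 4 * (64 * (middle_term ^+ 3 * d%:R) * d%:R ^+ 2 / n%:R ^+ 6) =
        4 * (64 * middle_term ^+ 3) * (d%:R ^+ 3 / n%:R ^+ 6) by field; rewrite gt_eqF.
    apply: ler_wpM2r; first by rewrite divr_ge0 ?exprn_ge0// ltW.
    by have := exprn_gt0 3 x0; lra.
  - have K0 : 0 <= K by lra.
    suff : X <= 4 * K * (d%:R / n%:R) by have := mulr_ge0 K0 S0; lra.
    rewrite -(ler_pM2r tp); apply: le_trans Xt _; rewrite a2.
    have -> : 4 * K * (d%:R / n%:R) * t = K * (d%:R / n%:R ^+ 2) * (4 * (n%:R * t)).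
      by field; rewrite gt_eqF.
    have -> : K * (d%:R * g / n%:R ^+ 2) = K * (d%:R / n%:R ^+ 2) * g by ring.
    apply: ler_wpM2l; last by lra.
    by rewrite mulr_ge0 ?divr_ge0 ?exprn_ge0 ?(ltW dR) ?(ltW nR)//; lra.
rewrite /local_rate -/L -/t.
have Ld : 0 < L * d%:R by rewrite mulr_gt0//; have := l_star2_ge; lra.
have n2 : n%:R ^+ 2 != 0 :> R by rewrite expf_neq0 ?gt_eqF.
have [tE|tn] := eqVneq t 0.
  rewrite tE mulr0 inver eqxx gt0_muley ?lte_fin// addye ?ltNyr//.
  by rewrite gt0_muley ?leey// lte_fin; lra.
rewrite inver ifF; last by rewrite mulf_eq0 (negbTE n2) (negbTE tn).
rewrite -(EFinM (L * d%:R)) -EFinD -EFinM lee_fin.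
have tp : 0 < t by rewrite lt_neqAle t0 eq_sym tn.
apply: (@le_trans _ _ (2 * K * (L * d%:R / (n%:R ^+ 2 * t)))).
  rewrite -(ler_pM2r tp); apply: le_trans Xt _; rewrite a2.
  have -> : K * (d%:R * g / n%:R ^+ 2) = K * (d%:R / n%:R ^+ 2) * g by ring.
  have -> : 2 * K * (L * d%:R / (n%:R ^+ 2 * t)) * t = K * (d%:R / n%:R ^+ 2) * (2 * L).
    by field; rewrite ?tn ?gt_eqF.
  apply: ler_wpM2l => //.
  by rewrite mulr_ge0 ?divr_ge0 ?exprn_ge0 ?(ltW dR) ?(ltW nR)//; lra.
have h : 0 <= L * d%:R / (n%:R ^+ 2 * t).
  by apply: divr_ge0; [exact: ltW | apply: mulr_ge0 => //; exact: sqr_ge0].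
have K0 : 0 <= K by lra.
have := mulr_ge0 K0 h; have := mulr_ge0 K0 (ltW dn0); lra.
Qed.

End Rates.

(** * The good event *)

Section GoodEvent.
Context {disp : measure_display} {T : measurableType disp} {R : realType}.
Variables (P : probability T R) (m d : nat) (delta : R).
Variable eta : 'I_m.+1 -> {RV P >-> R}.
Variable xi : 'I_m.+1 -> {RV P >-> borel_cV R d}.
Hypothesis chain : switching_chain P delta eta.
Hypothesis delta01 : 0 <= delta <= 1.
Hypothesis indep_xi : mutually_independent P xi.
Hypothesis iso_xi : forall i, isotropic P (xi i).
Hypothesis subg_xi : forall i, subgaussian1 P (xi i).
Hypothesis indep_eta_xi : independent_families P eta xi.
Hypothesis d0 : (0 < d)%N.
Hypothesis dn : (d <= m.+1)%N.

Let eta_sign i w : eta i w = 1 \/ eta i w = -1.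
Proof. by case: chain => H _ _; exact: H. Qed.

Let noise w j : 'cV[R]_d := xi j w.

(** [independent_families] concerns events of the generated sigma-algebras, so measurability alone
    would not allow [cross_tail] to factorise. *)
Lemma lincomb_event_sigma v (c : 'I_m.+1 -> R) (b : R) :
  sigma_of (fun j => xi j : T -> borel_cV R d)
    [set w | b <= `|\sum_j c j * noise_proj xi v j w|].
Proof.
pose S := \bigcup_(j in [set: 'I_m.+1])
  preimage_set_system [set: T] (xi j : T -> borel_cV R d) measurable.
pose T' := g_sigma_algebraType S.
have mxi j : measurable_fun [set: T'] (xi j : T' -> borel_cV R d).
  by move=> _ B mB; apply: sub_sigma_algebra; exists j => //; exists B.
have mf : measurable_fun [set: T'] (fun w : T' => `|\sum_j c j * noise_proj xi v j w|).
  apply: measurableT_comp => //; apply: measurable_sum => j; apply: measurable_funM => //.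
  exact: (measurableT_comp (measurable_dotp v) (mxi j)).
have := mf measurableT `[b, +oo[%classic (measurable_itv _).
rewrite setTI (_ : _ @^-1` _ = [set w | b <= `|\sum_j c j * noise_proj xi v j w|])//.
by apply/seteqP; split => w /=; rewrite in_itv/= andbT.
Qed.

Lemma measurable_lincomb_event v (c : 'I_m.+1 -> R) (b : R) :
  measurable [set w | b <= `|\sum_j c j * noise_proj xi v j w|].
Proof.
apply: (smallest_sub _ _ (lincomb_event_sigma v c b)); first exact: sigma_algebra_measurable.
move=> _ [j _ [B mB <-]]; apply: measurableI => //.
by rewrite -[X in measurable X]setTI; apply: (measurable_funPT (xi j)).
Qed.

(** The coefficients are functions of the signs: for a frozen pattern [lincomb_tail] applies, and
    [pattern_bound] reassembles the patterns. *)
Lemma cross_tail v (l : nat) : (d <= l)%N -> (l <= m.+1)%N -> dotp v v <= 1 ->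
  let B e := [set w | 20 * Num.sqrt (d%:R * m.+1%:R) <= `|cross_form (l := l) e (noise w) v|] in
  measurable [set w | B (pattern eta w) w] /\
  (P [set w | B (pattern eta w) w] <= (2 * expR (- (19 * d%:R)))%:E)%E.
Proof.
move=> dl ln v1 B.
have mB e : measurable (B e) by exact: measurable_lincomb_event.
split; first exact: measurable_pattern_event.
apply: pattern_bound => //.
- move=> e; apply: indep_eta_xi; first exact: pattern_set_sigma.
  exact: lincomb_event_sigma.
- by move=> e; apply: lincomb_tail => // j; exact: cross_coef_le1 e d0 dl ln j.
Qed.

Lemma block_tail v (l : nat) : (d <= l)%N -> (l <= m.+1)%N -> dotp v v <= 1 ->
  let B := [set w | quad_const * Num.sqrt (d%:R * l%:R) <= `|block_form (l := l) (noise w) v|] in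
  measurable B /\ (P B <= (2 * expR (- (19 * d%:R)))%:E)%E.
Proof.
move=> dl ln v1 B; have l0 : (0 < l)%N by exact: leq_trans dl.
split; last first.
  apply: block_quadratic_tail => //; first by move=> i k; exact: block_disjoint.
  move=> i; rewrite card_block// exprVn sqr_sqrtr ?ler0n// mulVf// pnatr_eq0 -lt0n.
  by rewrite divn_gt0.
have mf : measurable_fun [set: T] (fun w => `|block_form (l := l) (noise w) v|).
  by apply: measurableT_comp => //; exact: measurable_block_quadratic.
have := mf measurableT `[quad_const * Num.sqrt (d%:R * l%:R), +oo[%classic (measurable_itv _).
rewrite setTI (_ : _ @^-1` _ = B)//.
by apply/seteqP; split => w /=; rewrite in_itv/= andbT.
Qed.

(** Each pair of a level and a net point costs 4 e^(-19 d), and there are at most (M + 1) e^(18 d)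
    pairs; the flips add e^(-d). Together this is at most 5 (M + 1) e^(-d), and M + 1 <= 2 ln (e n /
    d) gives the constant 10. *)
Lemma good_event : exists A : set T, [/\ measurable A,
  ((1 - 10 * ln (expR 1 * m.+1%:R / d%:R) * expR (- d%:R))%:E <= P A)%E &
  forall w, A w -> (flips (pattern eta w))%:R <= 3 * (m%:R * delta) + d%:R /\
    forall i f, (i <= max_level m.+1 d)%N -> @net_mem R d f ->
    `|cross_form (l := grid d i) (pattern eta w) (noise w) (net_point f)|
       <= 20 * Num.sqrt (d%:R * m.+1%:R) /\
    `|block_form (l := grid d i) (noise w) (net_point f)|
       <= quad_const * Num.sqrt (d%:R * (grid d i)%:R)].
Proof.
set M := max_level _ _.
pose I := ('I_M.+1 * @net_index d)%type.
pose Q : pred I := [predX predT & @net_mem R d].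
(* Indices outside the net receive the empty event, because [union_bound] wants every event
   measurable while the tail lemmas are stated in the unit ball. *)
pose B1 (p : I) := if Q p then [set w | 20 * Num.sqrt (d%:R * m.+1%:R) <=
  `|cross_form (l := grid d p.1) (pattern eta w) (noise w) (net_point p.2)|] else set0.
pose B2 (p : I) := if Q p then [set w | quad_const * Num.sqrt (d%:R * (grid d p.1)%:R) <=
  `|block_form (l := grid d p.1) (noise w) (net_point p.2)|] else set0.
pose B p := B1 p `|` B2 p.
pose F := [set w | 3 * (m%:R * delta) + d%:R <= (flips (pattern eta w))%:R].
have gl (i : 'I_M.+1) : (d <= grid d i)%N /\ (grid d i <= m.+1)%N.
  split; first by rewrite leq_pmull// expn_gt0.
  by apply: leq_trans (grid_max_level dn); rewrite leq_grid// -ltnS.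
have H1 p : measurable (B1 p) /\ (P (B1 p) <= (2 * expR (- (19 * d%:R)))%:E)%E.
  rewrite /B1; case: ifP => [/andP[_ hp]|_].
    by have [g1 g2] := gl p.1; exact: cross_tail.
  by rewrite measure0 lee_fin mulr_ge0 ?expR_ge0.
have H2 p : measurable (B2 p) /\ (P (B2 p) <= (2 * expR (- (19 * d%:R)))%:E)%E.
  rewrite /B2; case: ifP => [/andP[_ hp]|_].
    by have [g1 g2] := gl p.1; exact: block_tail.
  by rewrite measure0 lee_fin mulr_ge0 ?expR_ge0.
have mB p : measurable (B p) by apply: measurableU; [exact: (H1 p).1 | exact: (H2 p).1].
have PB p : (P (B p) <= (4 * expR (- (19 * d%:R)))%:E)%E.
  apply: le_trans (measureU2 _ (H1 p).1 (H2 p).1) _.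
  by apply: le_trans (leeD (H1 p).2 (H2 p).2) _; rewrite -EFinD lee_fin; lra.
have mF : measurable F.
  pose G e : set T := [set _ | 3 * (m%:R * delta) + d%:R <= (flips (m := m) e)%:R].
  have mG e : measurable (G e).
    by case: (boolP (3 * (m%:R * delta) + d%:R <= (flips e)%:R)) => h;
      [rewrite (_ : G e = setT) | rewrite (_ : G e = set0)] => //;
      apply/seteqP; split => // w; rewrite /G/= ?(negbTE h).
  exact: (measurable_pattern_event eta_sign mG).
have PF : (P F <= (expR (- d%:R))%:E)%E by exact: flips_tail.
pose U := \big[setU/set0]_(p | Q p) B p.
have mU : measurable U by apply: bigsetU_measurable.
have PU : (P U <= (#|Q|%:R * (4 * expR (- (19 * d%:R))))%:E)%E.
  by apply: union_bound => //; rewrite mulr_ge0 ?expR_ge0.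
exists (~` (U `|` F)); split.
- exact/measurableC/measurableU.
- rewrite probability_setC; last exact: measurableU.
  have PUF := le_trans (measureU2 _ mU mF) (leeD PU PF).
  rewrite -leeN2 in PUF; apply: le_trans (leeD2l 1%E PUF).
  rewrite -[leRHS]/((1 - (_ + _))%:E) lee_fin.
  have Qc : (#|Q|%:R : R) = M.+1%:R * #|@net_mem R d|%:R.
    by rewrite cardX cardT size_enum_ord natrM.
  have h1 : #|@net_mem R d|%:R * expR (- (19 * d%:R)) <= expR (- d%:R) :> R.
    have h0 := @net_card R d d0.
    have {}h0 := ler_wpM2r (expR_ge0 (- (19 * d%:R) : R)) h0.
    apply: le_trans h0 _.
    by rewrite -expRD ler_expR; lra.
  have h2 := ler_wpM2l (ler0n R M.+1) h1.
  have h3 := ler_wpM2r (expR_ge0 (- d%:R)) (@max_level_ln R _ _ d0 dn).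
  have h4 : 1 * expR (- d%:R) <= M.+1%:R * expR (- d%:R) :> R.
    by rewrite ler_wpM2r ?expR_ge0// ler1n.
  rewrite Qc; rewrite -/M in h3; lra.
- move=> w /= /not_orP[nU nF]; split.
    by rewrite leNgt; apply/negP => h; apply: nF; exact: ltW.
  move=> i f iM fm.
  have Qp : Q (Ordinal (iM : (i < M.+1)%N), f) by exact: fm.
  have nB : ~ B (Ordinal (iM : (i < M.+1)%N), f) w.
    by move=> h; apply: nU; rewrite /U (bigD1 _ Qp); left.
  by split; rewrite leNgt; apply/negP => h; apply: nB; [left; rewrite /B1 Qp|right; rewrite /B2 Qp]; exact: ltW.
Qed.

End GoodEvent.

Theorem theorem14 (R : realType) :
  exists C K c0 c1 : R, [/\ 0 < C, 0 < K, 0 < c0 & 0 < c1] /\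
  forall (n d : nat), (1 <= d)%N -> (d <= n)%N ->
  forall (delta : R), 0 < delta -> delta < 1 / 2 ->
  forall (theta : 'cV[R]_d), norm2 theta ^+ 2 <= 1 ->
  forall (disp : measure_display) (T : measurableType disp)
    (P : probability T R)
    (eta : 'I_n -> {RV P >-> R}) (xi : 'I_n -> {RV P >-> borel_cV R d}),
  switching_chain P delta eta ->
  mutually_independent P xi ->
  identically_distributed xi ->
  (forall i, isotropic P (xi i)) ->
  (forall i, subgaussian1 P (xi i)) ->
  independent_families P eta xi ->
  forall (vmax : 'M[R]_d -> 'cV[R]_d), top_eigenvector vmax ->
  let Y (w : T) (i : 'I_n) : 'cV[R]_d :=
    eta i w *: theta + (xi i w : 'cV[R]_d) in
  let theta_hat (w : T) : 'cV[R]_d :=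
    theta_tilde vmax (Y w) (l_tilde2 vmax (Y w) C) in
  let p : R :=
    1 - c1 * ln (expR 1 * n%:R / d%:R) * expR (- (c0 * d%:R)) in
  with_prob_ge P p
    [set w | ((loss (theta_hat w) theta ^+ 2)%:E <=
      K%:E * Order.min (global_rate n d delta)%:E
                       (local_rate n delta theta))%E] /\
  with_prob_ge P p
    [set w | loss (theta_hat w) theta ^+ 2 <= K * global_rate n d delta].
Proof.
have [C [K [C0 K0 lepski]]] := lepski_two_step (@level_const_ge1 R).
(* [final_rate] needs a constant at least 1, hence K + 1, and multiplies it by 4; 1 and 10 come from
   [good_event]. *)
exists C, (4 * (K + 1)), 1, 10; split; first by split => //; lra.
move=> n d d0 dn delta de0 de1 theta th1 disp T P eta xi chain ind_xi _ iso subg ind vmax topv Y theta_hat p.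
have [m mn] : exists m, n = m.+1 by exists n.-1; rewrite prednK// (leq_trans d0).
subst n.
have de01 : 0 <= delta <= 1 by apply/andP; split; lra.
have [A [mA PA HA]] := good_event chain de01 ind_xi iso subg ind d0 dn.
have eta_sign : forall i w, eta i w = 1 \/ eta i w = -1 by case: chain.
have main w : A w -> loss (theta_hat w) theta ^+ 2 <= 4 * (K + 1) * global_rate m.+1 d delta /\
    ((loss (theta_hat w) theta ^+ 2)%:E <= (4 * (K + 1))%:E * local_rate m.+1 delta theta)%E.
  move=> /HA[fl bd].
  have [ms [msM gL Hms]] := @oracle_level R m.+1 d delta theta d0 dn de0 th1.
  have YE : Y w = observation theta (pattern eta w) (fun j => xi j w).
    by apply/funext => j; rewrite /Y /observation (eta_pattern eta_sign).
  apply: (@final_rate R m.+1 d delta theta d0 dn de0 (K + 1) _ (grid d ms)%:R) => //.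
  - by lra.
  - exact: sqr_ge0.
  - by rewrite ltr0n grid_gt0.
  pose th j := theta_tilde vmax (Y w) (grid d j).
  have selP s : let M := max_level m.+1 d in let m0 := select_level vmax (Y w) C s in
    (m0 <= M)%N /\ (forall j, (m0 < j <= M)%N ->
      loss (th j) (th j.-1) ^+ 2 * Num.max (level_scale m.+1 d j) (s j ^+ 2) <=
      4 * C ^+ 2 * level_scale m.+1 d j ^+ 2) /\
    (forall m', (m' <= M)%N -> (forall j, (m' < j <= M)%N ->
      loss (th j) (th j.-1) ^+ 2 * Num.max (level_scale m.+1 d j) (s j ^+ 2) <=
      4 * C ^+ 2 * level_scale m.+1 d j ^+ 2) -> (m0 <= m')%N).
    have [h1 [h2 h3]] := select_levelP vmax (Y w) C s.
    split => //; split => [j /h2|m' m'M H]; first by rewrite close_levelsE.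
    by apply: h3 => // j /H; rewrite close_levelsE.
  have := lepski d (level_scale m.+1 d) th theta _ ms _ _ (fun j => @level_scale_gt0 R m.+1 d j d0 isT)
    (fun j => level_scaleS m.+1 d j) msM _ (selP _) (selP _).
  rewrite -/(level_scale m.+1 d ms) => H; apply: le_trans (H _) _; last first.
    by rewrite ler_wpM2r ?sqr_ge0//; lra.
  move=> j jM; have [h1 h2] := Hms j jM; have /andP[_ jM'] := jM.
  rewrite /th YE; apply: (level_loss (delta := delta)) => //.
  - by rewrite leq_pmull// expn_gt0.
  - by apply: leq_trans (grid_max_level dn); exact: leq_grid.
  - exact: ltW.
  - by move=> f fm; have [] := bd j f jM' fm.
  - by move=> f fm; have [] := bd j f jM' fm.
have pA : (p%:E <= P A)%E by move: PA; rewrite /p mul1r.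
split; exists A; split => // w Aw; last by have [] := main w Aw.
have [h1 h2] := main w Aw; rewrite /=.
have K4 : (0 <= (4 * (K + 1))%:E)%E by rewrite lee_fin; lra.
by case: (leP (global_rate m.+1 d delta)%:E) => _ //; rewrite -EFinM lee_fin.
Qed.
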